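(* Let $a<b$ and $a\le A<B\le b$ be real numbers, let $0<\alpha,\beta<1$, let $y_a,y_b,l\in\mathbb R$, and let $L,g:[a,b]\times\mathbb R^3\to\mathbb R$ be of class $C^1$. For $y\in{}_a^{\alpha}E_b^{\beta}$ write $[y](x)=(x,y(x),{}_a^CD_x^\alpha y(x),{}_x^CD_b^\beta y(x))$ and $$J^*(y)=\int_A^B L[y](x)\,dx,\qquad I^*(y)=\int_A^B g[y](x)\,dx.$$ Let $y\in{}_a^{\alpha}E_b^{\beta}$ be a local minimum of $J^*$ subject to the boundary conditions $y(a)=y_a$, $y(b)=y_b$ and the integral constraint $I^*(y)=l$. Assume that, along $y$, $\partial_3L$ and $\partial_3g$ have continuous right Riemann--Liouville derivatives ${}_xD_B^\alpha\partial_3L$, ${}_xD_B^\alpha\partial_3g$ on $[a,B]$, and $\partial_4L$ and $\partial_4g$ have continuous left Riemann--Liouville derivatives ${}_AD_x^\beta\partial_4L$, ${}_AD_x^\beta\partial_4g$ on $[A,b]$. Then there exist two constants $\lambda_0,\lambda\in\mathbb R$, not both zero, such that, with $K=\lambda_0L+\lambda g$, $$\left\{\begin{array}{ll} \partial_2 K+{}_xD_B^\alpha\,\partial_3 K+{}_AD_x^\beta\,\partial_4 K=0 & \text{for all } x \in [A,B],\\ {}_xD_B^\alpha\, \partial_3 K-{}_xD_A^\alpha\,\partial_3 K=0 & \text{for all } x \in [a,A],\\ {}_AD_x^\beta\, \partial_4 K-{}_BD_x^\beta\,\partial_4 K=0 & \text{for all } x \in [B,b], \end{array}\right.$$ where the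 partial derivatives of $K$ are evaluated at $[y](x)$.
   Context: Fractional operators. Let $0<\gamma<1$, $p<q$ real, $\Gamma$ the Euler gamma function. The left and right Riemann--Liouville derivatives of order $\gamma$ are $${}_pD_x^\gamma f(x)=\frac{1}{\Gamma(1-\gamma)}\frac{d}{dx}\int_p^x (x-t)^{-\gamma}f(t)\,dt,\qquad {}_xD_q^\gamma f(x)=\frac{-1}{\Gamma(1-\gamma)}\frac{d}{dx}\int_x^q (t-x)^{-\gamma}f(t)\,dt$$ (one-sided derivatives at endpoints). The left and right Caputo derivatives are, for absolutely continuous $f:[a,b]\to\mathbb R$, $${}_a^CD_x^\gamma f(x)=\frac{1}{\Gamma(1-\gamma)}\int_a^x (x-t)^{-\gamma}f'(t)\,dt,\qquad {}_x^CD_b^\gamma f(x)=\frac{-1}{\Gamma(1-\gamma)}\int_x^b (t-x)^{-\gamma}f'(t)\,dt,$$ with the value at $x=a$ (left) or $x=b$ (right) understood as the limit. Function space: ${}_a^{\alpha}E_b^{\beta}$ is the set of $y:[a,b]\to\mathbb R$ for which ${}_a^CD_x^\alpha y$ and ${}_x^CD_b^\beta y$ exist and are continuous on $[a,b]$. $\partial_i$ denotes the partial derivative with respect to the $i$-th variable, $i=1,2,3,4$, of a function of $(x,y,u,v)$. An expression such as ${}_xD_B^\alpha\partial_3K$ means the operator applied to the function $x\mapsto\partial_3K[y](x)$. Fix a norm $\|\cdot\|$ on ${}_a^{\alpha}E_b^{\beta}$ (any norm). $y$ is a local minimum of $J^*$ subject to given conditions if it satisfies them and there is $\delta>0$ with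 $J^*(y)\le J^*(y_1)$ for every $y_1\in{}_a^{\alpha}E_b^{\beta}$ satisfying the same conditions with $\|y-y_1\|<\delta$. Convention: if $A=a$ the second line of the system is void; if $B=b$ the third line is void. *)

(* Defs.v *)
From HB Require Import structures.
From mathcomp Require Import all_boot all_order all_algebra.
From mathcomp Require Import all_classical all_reals all_analysis.

Set Implicit Arguments.
Unset Strict Implicit.
Unset Printing Implicit Defensive.

Import Order.TTheory GRing.Theory Num.Theory.
Import numFieldNormedType.Exports.

Local Open Scope classical_set_scope.
Local Open Scope ring_scope.

(* Derivative relative to a set S: two-sided at interior points of S and
   one-sided at the endpoints when S is an interval. *)
Definition derivable_within (R : realType) (S : set R) (F : R -> R) (x : R) :
    Prop :=
  cvg ((F t - F x) / (t - x) @[t --> within S x^']).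

Definition deriv_within (R : realType) (S : set R) (F : R -> R) (x : R) : R :=
  lim ((F t - F x) / (t - x) @[t --> within S x^']).

Definition Gamma (R : realType) (z : R) : R :=
  \int[lebesgue_measure]_(t in `]0, +oo[) (t `^ (z - 1) * expR (- t)).

Definition abs_continuous (R : realType) (a b : R) (f : R -> R) : Prop :=
  forall e : R, 0 < e -> exists2 d : R, 0 < d &
    forall (n : nat) (u v : 'I_n -> R),
      (forall i, [/\ a <= u i, u i <= v i & v i <= b]) ->
      trivIset [set: 'I_n] (fun i => `]u i, v i[%classic) ->
      \sum_(i < n) (v i - u i) < d ->
      \sum_(i < n) `|f (v i) - f (u i)| < e.

(* In [RL_left c p q f] the function f lives on [p, q], the base point is p, and
   q only matters for the derivative being one-sided at q (dually for
   [RL_right], whose base point is q). *)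

Definition RL_left_integrand (R : realType) (c : R) (f : R -> R) (x t : R) : R :=
  (x - t) `^ (- c) * f t.

Definition RL_right_integrand (R : realType) (c : R) (f : R -> R) (x t : R) : R :=
  (t - x) `^ (- c) * f t.

Definition RL_left_integral (R : realType) (c p : R) (f : R -> R) (x : R) : R :=
  \int[lebesgue_measure]_(t in `[p, x]) RL_left_integrand c f x t.

Definition RL_right_integral (R : realType) (c q : R) (f : R -> R) (x : R) : R :=
  \int[lebesgue_measure]_(t in `[x, q]) RL_right_integrand c f x t.

Definition RL_left_ex (R : realType) (c p q : R) (f : R -> R) (x : R) : Prop :=
  (forall z, z \in `[p, q] ->
     lebesgue_measure.-integrable `[p, z] (EFin \o RL_left_integrand c f z)) /\
  derivable_within `[p, q] (RL_left_integral c p f) x.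

Definition RL_right_ex (R : realType) (c p q : R) (f : R -> R) (x : R) : Prop :=
  (forall z, z \in `[p, q] ->
     lebesgue_measure.-integrable `[z, q] (EFin \o RL_right_integrand c f z)) /\
  derivable_within `[p, q] (RL_right_integral c q f) x.

Definition RL_left (R : realType) (c p q : R) (f : R -> R) (x : R) : R :=
  (Gamma (1 - c))^-1 * deriv_within `[p, q] (RL_left_integral c p f) x.

Definition RL_right (R : realType) (c p q : R) (f : R -> R) (x : R) : R :=
  - (Gamma (1 - c))^-1 * deriv_within `[p, q] (RL_right_integral c q f) x.

Definition has_continuous_RL_left (R : realType) (c p q : R) (f : R -> R) : Prop :=
  (forall x, x \in `[p, q] -> RL_left_ex c p q f x) /\
  {within `[p, q], continuous (RL_left c p q f)}.

Definition has_continuous_RL_right (R : realType) (c p q : R) (f : R -> R) : Prop :=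
  (forall x, x \in `[p, q] -> RL_right_ex c p q f x) /\
  {within `[p, q], continuous (RL_right c p q f)}.

(* Meant for f absolutely continuous on [a, b], so that
   the derivative [derive1 f] exists almost everywhere on [a, b]. *)

Definition caputo_left_formula (R : realType) (c a : R) (f : R -> R) (x : R) : R :=
  (Gamma (1 - c))^-1 * RL_left_integral c a (derive1 f) x.

Definition caputo_right_formula (R : realType) (c b : R) (f : R -> R) (x : R) : R :=
  - (Gamma (1 - c))^-1 * RL_right_integral c b (derive1 f) x.

Definition caputo_left (R : realType) (c a : R) (f : R -> R) (x : R) : R :=
  if x == a then lim (caputo_left_formula c a f t @[t --> a^'+])
  else caputo_left_formula c a f x.

Definition caputo_right (R : realType) (c b : R) (f : R -> R) (x : R) : R :=
  if x == b then lim (caputo_right_formula c b f t @[t --> b^'-])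
  else caputo_right_formula c b f x.

Definition caputo_left_ex (R : realType) (c a b : R) (f : R -> R) : Prop :=
  (forall x, x \in `]a, b] ->
     lebesgue_measure.-integrable `[a, x]
       (EFin \o RL_left_integrand c (derive1 f) x)) /\
  cvg (caputo_left_formula c a f t @[t --> a^'+]).

Definition caputo_right_ex (R : realType) (c a b : R) (f : R -> R) : Prop :=
  (forall x, x \in `[a, b[ ->
     lebesgue_measure.-integrable `[x, b]
       (EFin \o RL_right_integrand c (derive1 f) x)) /\
  cvg (caputo_right_formula c b f t @[t --> b^'-]).

(* A function on [a, b] is represented by a total function R -> R whose values
   outside [a, b] are irrelevant. *)
Definition fracE (R : realType) (alpha beta a b : R) : set (R -> R) :=
  [set y | [/\ abs_continuous a b y,
               caputo_left_ex alpha a b y,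
               {within `[a, b], continuous (caputo_left alpha a y)},
               caputo_right_ex beta a b y &
               {within `[a, b], continuous (caputo_right beta b y)}]].

(* The zero vector of a space E of functions on [a, b] is any y vanishing on
   [a, b]; hence N takes equal values at functions that agree on [a, b]. *)
Definition is_norm_on (R : realType) (a b : R) (E : set (R -> R))
    (N : (R -> R) -> R) : Prop :=
  [/\ forall y, E y -> 0 <= N y,
      forall y, E y -> (N y = 0 <-> (forall x, x \in `[a, b] -> y x = 0)),
      forall (k : R) y, E y -> N (k \*: y) = `|k| * N y &
      forall y z, E y -> E z -> N (y \+ z) <= N y + N z].

Definition partial1 (R : realType) (a b : R) (F : R -> R -> R -> R -> R) :=
  fun x y u v : R => deriv_within `[a, b] (fun s => F s y u v) x.
Definition partial2 (R : realType) (F : R -> R -> R -> R -> R) :=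
  fun x y u v : R => derive1 (fun s => F x s u v) y.
Definition partial3 (R : realType) (F : R -> R -> R -> R -> R) :=
  fun x y u v : R => derive1 (fun s => F x y s v) u.
Definition partial4 (R : realType) (F : R -> R -> R -> R -> R) :=
  fun x y u v : R => derive1 (fun s => F x y u s) v.

Definition continuous4 (R : realType) (a b : R) (F : R -> R -> R -> R -> R) :
    Prop :=
  {within [set z : R * R * R * R | z.1.1.1 \in `[a, b]],
    continuous (fun z : R * R * R * R => F z.1.1.1 z.1.1.2 z.1.2 z.2)}.

Definition classC1 (R : realType) (a b : R) (F : R -> R -> R -> R -> R) : Prop :=
  [/\ (forall x y u v, x \in `[a, b] ->
         [/\ derivable_within `[a, b] (fun s => F s y u v) x,
             derivable (fun s => F x s u v) y 1,
             derivable (fun s => F x y s v) u 1 &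
             derivable (fun s => F x y u s) v 1]),
      continuous4 a b F &
      [/\ continuous4 a b (partial1 a b F), continuous4 a b (partial2 F),
          continuous4 a b (partial3 F) & continuous4 a b (partial4 F)]].

(* F[y](x) = F(x, y(x), left Caputo derivative, right Caputo derivative). *)
Definition along (R : realType) (alpha beta a b : R)
    (F : R -> R -> R -> R -> R) (y : R -> R) (x : R) : R :=
  F x (y x) (caputo_left alpha a y x) (caputo_right beta b y x).

Definition functional (R : realType) (alpha beta a b A B : R)
    (F : R -> R -> R -> R -> R) (y : R -> R) : R :=
  \int[lebesgue_measure]_(x in `[A, B]) along alpha beta a b F y x.

Definition local_min (R : realType) (E : set (R -> R)) (N : (R -> R) -> R)
    (J : (R -> R) -> R) (C : set (R -> R)) (y : R -> R) : Prop :=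
  [/\ E y, C y & exists2 d : R, 0 < d &
      forall y1, E y1 -> C y1 -> N (y \- y1) < d -> J y <= J y1].

(* Main.v *)
(* Let phi be continuous on [a, b] with integral zero. Its primitive eta vanishes at
   both endpoints and y + eta stays in the function space, its Caputo derivatives
   being those of y plus fractional integrals of phi. Fractional integration by
   parts writes the first variation of the functional with integrand F as the
   integral of phi * v_F, where v_F is continuous: it is the sum of
   \int_x^B d_2 F and of fractional integrals of d_3 F and d_4 F, all truncated to
   [A, B]. If v_L, v_g and 1 were linearly independent, some phi1 of mean zero
   orthogonal to v_g but not to v_L, together with some phi2 of mean zero not
   orthogonal to v_g, would allow J to be decreased without changing I; only the
   first order expansions at y and continuity along lines are needed for this.
   Hence v_K = lam0 v_L + lam v_g is constant on [a, b] for some (lam0, lam) <> 0.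
   Differentiating this on [A, B] gives the first equation. On [a, A] and on [B, b]
   it says that the fractional integrals of d_3 K based at B and A, respectively
   those of d_4 K based at A and B, differ by a constant.

   The Caputo derivatives involve the derivative of an absolutely continuous
   function, so that additivity rests on Lebesgue's theorem that such a function is
   differentiable almost everywhere. *)
Require Import Defs.
From HB Require Import structures.
From mathcomp Require Import all_boot all_order all_algebra.
From mathcomp Require Import all_classical all_reals all_analysis.
From mathcomp Require Import measurable_realfun.
From mathcomp Require Import ring lra.
Set Implicit Arguments.
Unset Strict Implicit.
Unset Printing Implicit Defensive.
Import Order.TTheory GRing.Theory Num.Theory.
Import numFieldNormedType.Exports.
Local Open Scope classical_set_scope.
Local Open Scope ring_scope.

(** * Monotone and absolutely continuous functions are differentiable almost everywhere *)

(** The norm in the definition of a local minimum is arbitrary, so nothing relates it to uniform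
    convergence and no differential calculus in a normed function space is at hand. Competitors are
    therefore taken in a plane y + s eta1 + t eta2, where homogeneity and the triangle inequality
    alone bound the norm by the coefficients, while the expansions are measured by the supremum of
    the densities. Varying the density phi rather than eta leads to an argument of du Bois-Reymond
    type: v_F needs only continuity, and the Riemann-Liouville derivatives enter only when the
    constant is differentiated. Truncation to [A, B] makes the partial derivatives along y
    discontinuous, so fractional integrals are studied for bounded measurable densities; v_F is
    still continuous because the kernels are Hoelder continuous in L^1. Absolutely continuous
    functions are reached through the Jordan decomposition into continuous monotone functions, to
    which Vitali's covering theorem applies. *)

Section vitali_cover_slope.
Context {R : realType}.

(* The default (0, 1) makes [rat_ball n] a genuine ball for every index n. *)
Definition rat_cr (n : nat) : R * R :=
  if unpickle n is Some (c, r) then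
    (if (0 : rat) < r then (ratr c, ratr r) else (0, 1)) else (0, 1).

Definition rat_ball (n : nat) : set R := ball (rat_cr n).1 (rat_cr n).2.

Lemma rat_cr_gt0 n : 0 < (rat_cr n).2.
Proof.
rewrite /rat_cr; case: (unpickle n) => [[c r]|] //=.
by case: ifPn => //=; rewrite ltr0q.
Qed.

Lemma rat_cr_surj (c r : rat) : 0 < r -> exists n, rat_cr n = (ratr c, ratr r).
Proof. by move=> r0; exists (pickle (c, r)); rewrite /rat_cr pickleK r0. Qed.

(** For [G z = q * z - F z] this says that difference quotients of F at x exceed q arbitrarily close
    to x; for [G z = F z - p * z], that they fall below p. It encodes conditions on Dini derivatives
    without upper and lower limits. *)
Definition freq_decr (G : R -> R) (x : R) :=
  forall d, 0 < d -> exists2 y, `|y - x| < d & (G y - G x) * (y - x) < 0.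

Definition rlo n : R := (rat_cr n).1 - (rat_cr n).2.
Definition rhi n : R := (rat_cr n).1 + (rat_cr n).2.

(** The point x is an endpoint of an interval across which G decreases. By continuity both endpoints
    can be pushed outwards to rationals, which makes x interior and keeps the decrease. *)
Lemma freq_decr_rat (G : R -> R) x : continuous G -> freq_decr G x ->
  forall d, 0 < d -> exists n,
    [/\ rlo n < x, x < rhi n, (rat_cr n).2 < d & G (rhi n) < G (rlo n)].
Proof.
move=> cG Gx d d0.
have [u [v [ux xv uv uvd Guv]]] :
    exists u v, [/\ u <= x, x <= v, u < v, v - u < d & G v < G u].
  have [y yxd Gxy] := Gx _ d0; have [xy|yx|xy] := ltgtP x y.
  - exists x, y; split=> //; first exact: ltW.
      by rewrite (le_lt_trans _ yxd)// ler_norm.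
    by move: Gxy; rewrite pmulr_llt0 ?subr_gt0// subr_lt0.
  - exists y, x; split=> //; first exact: ltW.
      by rewrite (le_lt_trans _ yxd)// distrC ler_norm.
    by move: Gxy; rewrite nmulr_llt0 ?subr_lt0// subr_gt0.
  - by move: Gxy; rewrite xy subrr mul0r ltxx.
pose m := (G u + G v) / 2.
have [mu mv] : m < G u /\ G v < m by rewrite /m; split; lra.
have /nbhs_ballP[e1 /= e10 ue1] : \forall z \near u, m < G z.
  exact: (cvgr_gt _ (cG u)).
have /nbhs_ballP[e2 /= e20 ve2] : \forall z \near v, G z < m.
  exact: (cvgr_lt _ (cG v)).
(* The radius of the rational interval will be below [(v - u) / 2 + e], hence below d. *)
pose e := Num.min (d / 2) (Num.min e1 e2).
have e0 : 0 < e by rewrite !lt_min e10 e20 divr_gt0.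
have [ed ee1 ee2] : [/\ e <= d / 2, e <= e1 & e <= e2].
  by rewrite /e !ge_min !lexx !orbT.
have [p pu] : exists p : rat, ratr p \in `]u - e, u[.
  by apply: rat_in_itvoo; rewrite ltrBlDr ltrDl.
have [q qv] : exists q : rat, ratr q \in `]v, v + e[.
  by apply: rat_in_itvoo; rewrite ltrDl.
move: pu qv; rewrite !in_itv/= => /andP[pu1 pu2] /andP[qv1 qv2].
have r0 : 0 < (q - p) / 2.
  rewrite divr_gt0// subr_gt0 -(@ltr_rat R).
  by rewrite (lt_trans pu2)// (lt_trans uv).
have [n En] := @rat_cr_surj ((p + q) / 2) ((q - p) / 2) r0.
have elo : rlo n = ratr p.
  by rewrite /rlo En/= -rmorphB/=; congr ratr; field.
have ehi : rhi n = ratr q.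
  by rewrite /rhi En/= -rmorphD/=; congr ratr; field.
exists n; rewrite elo ehi; split.
- exact: lt_le_trans ux.
- exact: le_lt_trans qv1.
- by rewrite En/= fmorph_div/= rmorphB/= ratr_nat; lra.
- apply: (@lt_trans _ _ m).
    by apply: ve2; rewrite /ball/= ltr_norml; apply/andP; split; lra.
  by apply: ue1; rewrite /ball/= ltr_norml; apply/andP; split; lra.
Qed.

Lemma rat_ballE n : rat_ball n = `]rlo n, rhi n[%classic.
Proof. by rewrite /rat_ball ball_itv. Qed.

Lemma closure_rat_ballE n : closure (rat_ball n) = `[rlo n, rhi n]%classic.
Proof. by rewrite /rat_ball closure_ballE closed_ball_itv// rat_cr_gt0. Qed.

Lemma rlo_lt_rhi n : rlo n < rhi n.
Proof. by have := rat_cr_gt0 n; rewrite /rlo /rhi; lra. Qed.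

(* The rational balls around points of [freq_decr G] across which G decreases
   form a Vitali cover; summing the increments of G over a disjoint subfamily
   compares Lebesgue and Lebesgue-Stieltjes measures. *)
Definition decr_balls (G : R -> R) (O : set R) : set nat :=
  [set n | `[rlo n, rhi n]%classic `<=` O /\ G (rhi n) < G (rlo n)].

Lemma vitali_cover_decr (G : R -> R) (O A : set R) :
  continuous G -> open O -> A `<=` O -> A `<=` [set x | freq_decr G x] ->
  vitali_cover A rat_ball (decr_balls G O).
Proof.
move=> cG oO AO Adecr; split=> [i|x Ax e e0]; first exact: is_ball_ball.
have /nbhs_ballP[d /= d0 xdO] := open_nbhs_nbhs (conj oO (AO _ Ax)).
have de0 : 0 < Num.min (d / 2) e by rewrite lt_min e0 divr_gt0.
have [n [xlo xhi nd Gn]] := freq_decr_rat cG (Adecr _ Ax) de0.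
exists n; split.
- split=> // z /=; rewrite in_itv/= => /andP[z1 z2].
  move: nd xlo xhi z1 z2; rewrite lt_min => /andP[nd _].
  rewrite /rlo /rhi => *; apply: xdO; rewrite /ball/=.
  by rewrite ltr_norml; apply/andP; split; lra.
- by rewrite rat_ballE/= in_itv/= xlo.
- rewrite /rat_ball radius_ball_num ?ltW ?rat_cr_gt0//.
  by move: nd; rewrite lt_min => /andP[].
Qed.

Notation mu := (@lebesgue_measure R).

(** Vitali's theorem yields disjoint closed balls; passing to open ones loses only their endpoints,
    a countable set. The outer measure is used because A is not known to be measurable. *)
Lemma vitali_decr (G : R -> R) (O A : set R) :
  continuous G -> open O -> A `<=` O -> A `<=` [set x | freq_decr G x] ->
  exists D : set nat, [/\ D `<=` decr_balls G O,
    trivIset D (fun n => `[rlo n, rhi n]%classic) &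
    ((wlength idfun)^* (A `\` \bigcup_(k in D) `]rlo k, rhi k[%classic))%mu = 0%E].
Proof.
move=> cG oO AO Adecr.
have B0 i : 0 < (radius (rat_ball i))%:num.
  by rewrite /rat_ball radius_ball_num ?ltW ?rat_cr_gt0.
have [D [cD DV tD muD]] := vitali_theorem B0 (vitali_cover_decr cG oO AO Adecr).
exists D; split=> //.
  by move: tD; congr trivIset; apply/funext => n /=; rewrite closure_rat_ballE.
have sub : A `\` \bigcup_(k in D) `]rlo k, rhi k[%classic `<=`
   (A `\` \bigcup_(k in D) closure (rat_ball k)) `|`
   (\bigcup_k [set rlo k; rhi k]).
  move=> x [Ax nx]; have [[k Dk]|nB] := pselect ((\bigcup_(k in D) closure (rat_ball k)) x); last by left.
  rewrite closure_rat_ballE/= in_itv/= => /andP[x1 x2]; right.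
  have [xl|xl] := eqVneq x (rlo k); first by exists k => //=; left.
  have [xh|xh] := eqVneq x (rhi k); first by exists k => //=; right.
  exfalso; apply: nx; exists k => //=; rewrite in_itv/=.
  by rewrite !lt_neqAle x1 x2 eq_sym xl xh.
have c0 : mu (\bigcup_k [set rlo k; rhi k]) = 0%E.
  apply: countable_lebesgue_measure0.
  by apply: bigcup_countable => // i _; exact/finite_set_countable/finite_set2.
apply/eqP; rewrite eq_le outer_measure_ge0 andbT.
apply: (le_trans (le_outer_measure ((wlength idfun)^*)%mu _ _ sub)).
apply: (le_trans (outer_measureU2 _ _ _)).
rewrite -[X in (_ <= X)%E]adde0; apply: leeD.
  by rewrite le_eqVlt; apply/orP; left; apply/eqP; exact: muD.
by rewrite le_eqVlt; apply/orP; left; apply/eqP; exact: c0.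
Qed.

End vitali_cover_slope.

Section lebesgue_stieltjes_slope.
Context {R : realType} (F : cumulative R R).
Hypothesis cF : continuous F.
Notation mu := (@lebesgue_measure R).
Notation muF := (lebesgue_stieltjes_measure F).
Local Open Scope ereal_scope.

Lemma lebesgue_stieltjes_itv_oc (u v : R) : (u <= v)%R ->
  muF `]u, v]%classic = (F v - F u)%:E.
Proof.
move=> uv; rewrite /lebesgue_stieltjes_measure/= /measure_extension.
rewrite measurable_mu_extE/=; last exact: is_ocitv.
by rewrite wlength_itv_bnd// EFinB.
Qed.

Lemma trivIset_oc (D : set nat) :
  trivIset D (fun n => `[@rlo R n, rhi n]%classic) ->
  trivIset D (fun n => `]@rlo R n, rhi n]%classic).
Proof.
move=> tD; apply/trivIsetP => i j Di Dj ij.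
move/trivIsetP : tD => /(_ _ _ Di Dj ij) /disjoints_subset H.
apply/disjoints_subset => x xi xj; apply: (H x); [move: xi|move: xj];
by apply: subset_itv_oc_cc.
Qed.

Lemma mu_bigcup_rat_oc (D : set nat) :
  trivIset D (fun n => `[@rlo R n, rhi n]%classic) ->
  mu (\bigcup_(k in D) `]rlo k, rhi k]%classic) =
  \sum_(k <oo | k \in D) (@rhi R k - rlo k)%:E.
Proof.
move=> tD; rewrite measure_bigcup//; last exact: trivIset_oc.
apply: eq_eseriesr => k _; rewrite [LHS]lebesgue_measure_itv/= lte_fin rlo_lt_rhi.
by rewrite EFinB.
Qed.

Lemma muF_bigcup_rat_oc (D : set nat) :
  trivIset D (fun n => `[@rlo R n, rhi n]%classic) ->
  muF (\bigcup_(k in D) `]rlo k, rhi k]%classic) =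
  \sum_(k <oo | k \in D) (F (@rhi R k) - F (rlo k))%:E.
Proof.
move=> tD; rewrite measure_bigcup//; last exact: trivIset_oc.
apply: eq_eseriesr => k _; apply: lebesgue_stieltjes_itv_oc.
by rewrite ltW// rlo_lt_rhi.
Qed.

Lemma slope_gt_measure (q : R) (O A : set R) : (0 < q)%R ->
  open O -> A `<=` O ->
  A `<=` [set x | freq_decr (fun z => q * z - F z)%R x] ->
  q%:E * ((wlength idfun)^*)%mu A <= muF O.
Proof.
move=> q0 oO AO Aq.
have cG : continuous (fun z => q * z - F z)%R.
  move=> z; apply: cvgB; last exact: cF.
  by apply: cvgM; [exact: cvg_cst|exact: cvg_id].
have [D [DV tD lD]] := vitali_decr cG oO AO Aq.
have lA : ((wlength idfun)^*)%mu A <= mu (\bigcup_(k in D) `]rlo k, rhi k]%classic).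
  apply: (@le_trans _ _ (((wlength idfun)^*)%mu ((A `\` \bigcup_(k in D) `]rlo k, rhi k[%classic) `|`
     \bigcup_(k in D) `]rlo k, rhi k]%classic))).
    apply: le_outer_measure => x Ax.
    have [[k Dk xk]|nx] := pselect ((\bigcup_(k in D) `]rlo k, rhi k[%classic) x).
      by right; exists k => //; apply: subset_itv_oo_oc xk.
    by left.
  apply: (le_trans (outer_measureU2 _ _ _)).
  rewrite -[leRHS]add0e; apply: leeD; last exact: lexx.
  by rewrite le_eqVlt; apply/orP; left; apply/eqP; exact: lD.
rewrite (le_trans (lee_wpmul2l _ lA)) ?lee_fin ?(ltW q0)//.
rewrite mu_bigcup_rat_oc// -nneseriesZl//; last first.
  by move=> i _; rewrite lee_fin subr_ge0 ltW// rlo_lt_rhi.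
apply: (@le_trans _ _ (muF (\bigcup_(k in D) `]rlo k, rhi k]%classic))).
  rewrite muF_bigcup_rat_oc//; apply: lee_nneseries => i.
    move=> _ _; rewrite -EFinM lee_fin mulr_ge0// ?(ltW q0)//.
    by rewrite subr_ge0 ltW// rlo_lt_rhi.
  move=> /set_mem/DV[_ /ltW]; rewrite -EFinM lee_fin; lra.
apply: le_measure; rewrite ?inE.
- by apply: bigcup_measurable => k _; exact: measurable_itv.
- exact: measurable_realfun.open_measurable.
- move=> x [k /DV[kO _] xk]; apply: kO; exact: subset_itv_oc_cc xk.
Qed.

(** The selected intervals satisfy [F v - F u < p * (v - u)]. They are kept as an open set U
    carrying almost all of A, so that [slope_gt_measure] can be applied inside U. *)
Lemma slope_lt_measure (p : R) (O A : set R) : (0 < p)%R ->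
  open O -> A `<=` O ->
  A `<=` [set x | freq_decr (fun z => F z - p * z)%R x] ->
  exists U, [/\ open U, ((wlength idfun)^*)%mu (A `\` U) = 0 &
    muF U <= p%:E * mu O].
Proof.
move=> p0 oO AO Aq.
have cG : continuous (fun z => F z - p * z)%R.
  move=> z; apply: cvgB; first exact: cF.
  by apply: cvgM; [exact: cvg_cst|exact: cvg_id].
have [D [DV tD lD]] := vitali_decr cG oO AO Aq.
exists (\bigcup_(k in D) `]rlo k, rhi k[%classic); split=> //.
  by apply: bigcup_open => i _; exact: interval_open.
apply: (@le_trans _ _ (muF (\bigcup_(k in D) `]rlo k, rhi k]%classic))).
  apply: le_measure; rewrite ?inE.
  - by apply: bigcup_measurable => k _; exact: measurable_itv.
  - by apply: bigcup_measurable => k _; exact: measurable_itv.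
  - by move=> x [k Dk xk]; exists k => //; exact: subset_itv_oo_oc xk.
apply: (@le_trans _ _ (p%:E * mu (\bigcup_(k in D) `]rlo k, rhi k]%classic))).
  rewrite muF_bigcup_rat_oc// mu_bigcup_rat_oc// -nneseriesZl//; last first.
    by move=> i _; rewrite lee_fin subr_ge0 ltW// rlo_lt_rhi.
  apply: lee_nneseries => i.
    move=> _ _; rewrite lee_fin subr_ge0.
    by apply: cumulative_is_nondecreasing; rewrite ltW// rlo_lt_rhi.
  move=> /set_mem/DV[_ /ltW]; rewrite -EFinM lee_fin; lra.
rewrite lee_wpmul2l ?lee_fin ?(ltW p0)//.
apply: le_measure; rewrite ?inE.
- by apply: bigcup_measurable => k _; exact: measurable_itv.
- exact: measurable_realfun.open_measurable.
- move=> x [k /DV[kO _] xk]; apply: kO; exact: subset_itv_oc_cc xk.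
Qed.

(** With |A| the outer measure, q |A| <= muF U <= p |W| <= p |A| + e, where W is an open set around
    A and U, obtained from [slope_lt_measure], carries almost all of A. Since [p < q] and e is
    arbitrary, |A| = 0; the bound M keeps |A| finite. *)
Lemma slope_lt_gt_null (p q M : R) : (0 < p)%R -> (p < q)%R ->
  mu.-negligible [set x | [/\ `|x|%R < M,
    freq_decr (fun z => F z - p * z)%R x &
    freq_decr (fun z => q * z - F z)%R x]]%R.
Proof.
move=> p0 pq; set A := [set x | _]; have q0 := lt_trans p0 pq.
apply/negligible_outer_measure.
have AM : A `<=` `]-M, M[%classic%R.
  by move=> x [xM _ _]; rewrite /= in_itv/= -ltr_norml.
have [s sE] : exists s : R, ((wlength idfun)^*)%mu A = s%:E.
  exists (fine (((wlength idfun)^*)%mu A)); rewrite fineK// ge0_fin_numE ?outer_measure_ge0//.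
  apply: (le_lt_trans (le_outer_measure ((wlength idfun)^*)%mu _ _ AM)).
  rewrite [X in X < _](_ : _ = mu `]-M, M[%classic%R)//.
  by rewrite lebesgue_measure_itv/=; case: ifPn => _; rewrite ltry.
have s0 : (0 <= s)%R by rewrite -lee_fin -sE outer_measure_ge0.
rewrite sE; congr EFin.
suff : (q * s <= p * s)%R.
  rewrite -subr_le0 -mulrBl pmulr_rle0 ?subr_gt0// => ?.
  by apply/eqP; rewrite eq_le s0 andbT.
apply/ler_addgt0Pr => e e0.
have ep0 : (0 < e / p)%R by rewrite divr_gt0.
have [W [oW AW]] := outer_measure_open_le A ep0; rewrite sE => muW.
have [|U [oU lU muU]] := @slope_lt_measure p W A p0 oW AW.
  by move=> x [].
have : q%:E * ((wlength idfun)^*)%mu (A `&` U) <= muF U.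
  apply: (slope_gt_measure q0 oU); first exact: subIsetr.
  by move=> x [[]].
have lAU : ((wlength idfun)^*)%mu A <= ((wlength idfun)^*)%mu (A `&` U).
  apply: (le_trans (le_outer_measureIC ((wlength idfun)^*)%mu U A)).
  rewrite -[leRHS]adde0 -setDE; apply: leeD; first exact: lexx.
  by rewrite le_eqVlt; apply/orP; left; apply/eqP; exact: lU.
move=> /(le_trans (lee_wpmul2l _ lAU)); rewrite lee_fin (ltW q0) => /(_ isT).
rewrite sE => /le_trans /(_ muU) /le_trans /(_ (lee_wpmul2l _ muW)).
rewrite lee_fin (ltW p0) => /(_ isT); rewrite -EFinD -!EFinM lee_fin.
by rewrite mulrDr mulrCA divff ?mulr1// gt_eqF.
Qed.

(** Slopes exceeding every n on a bounded set A give n |A| <= F M - F (- M) for all positive n. *)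
Lemma slope_infty_null (M : R) :
  mu.-negligible [set x | `|x|%R < M /\
    forall n : nat, freq_decr (fun z => n%:R * z - F z)%R x]%R.
Proof.
set A := [set x | _].
apply/negligible_outer_measure.
have [M0|M0] := leP M 0%R.
  rewrite [A](_ : _ = set0) ?outer_measure0// -subset0 => x [xM _].
  by move: (lt_le_trans xM M0); rewrite normr_lt0.
have MM : (- M <= M)%R by rewrite ge0_cp ?ltW.
have AM : A `<=` `]-M, M[%classic%R.
  by move=> x [xM _]; rewrite /= in_itv/= -ltr_norml.
have [s sE] : exists s : R, ((wlength idfun)^*)%mu A = s%:E.
  exists (fine (((wlength idfun)^*)%mu A)); rewrite fineK// ge0_fin_numE ?outer_measure_ge0//.
  apply: (le_lt_trans (le_outer_measure ((wlength idfun)^*)%mu _ _ AM)).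
  rewrite [X in X < _](_ : _ = mu `]-M, M[%classic%R)//.
  by rewrite lebesgue_measure_itv/=; case: ifPn => _; rewrite ltry.
have s0 : (0 <= s)%R by rewrite -lee_fin -sE outer_measure_ge0.
have H n : (n.+1%:R * s <= F M - F (- M))%R.
  rewrite -lee_fin EFinM -sE -lebesgue_stieltjes_itv_oc//.
  apply: (@le_trans _ _ (muF `]-M, M[%classic%R)).
    have oM : open `]-M, M[%classic%R by exact: interval_open.
    by apply: (slope_gt_measure _ oM AM) => // x [_ /(_ n.+1)].
  by apply: le_measure; rewrite ?inE//; exact: subset_itv_oo_oc.
rewrite sE; congr EFin; apply/eqP; rewrite eq_le s0 andbT leNgt; apply/negP => s1.
have := H (Num.bound ((F M - F (- M)) / s)%R).
rewrite leNgt -ltr_pdivrMr// => /negP; apply.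
rewrite (lt_le_trans (archi_boundP _))// ?ler_nat// divr_ge0//.
by rewrite subr_ge0 cumulative_is_nondecreasing.
Qed.

End lebesgue_stieltjes_slope.

Section derivable_slopes.
Context {R : realType}.

Lemma not_freq_decr (G : R -> R) x : ~ freq_decr G x ->
  exists2 d, 0 < d & forall y, `|y - x| < d -> 0 <= (G y - G x) * (y - x).
Proof.
move=> nG; apply: contrapT => H; apply: nG => d d0.
apply: contrapT => H2; apply: H; exists d => // y yxd.
rewrite leNgt; apply/negP => ?; apply: H2; by exists y.
Qed.

(** The derivative is the supremum l of the eventual lower bounds of the difference quotients. A
    rational slope above l is not such a bound, so by the hypothesis on pairs the quotients
    eventually stay below any larger rational slope. *)
Lemma derivable_of_slopes (F : R -> R) x : {homo F : x y / x <= y} ->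
  (exists n : nat, ~ freq_decr (fun z => n%:R * z - F z) x) ->
  (forall p q : rat, 0 < p -> p < q ->
    ~ (freq_decr (fun z => F z - ratr p * z) x /\
       freq_decr (fun z => ratr q * z - F z) x)) ->
  derivable F x 1.
Proof.
move=> ndF [n nn] npq.
pose DQ h := h^-1 *: (F (h *: (1:R) + x) - F x).
have DQE h : h != 0 -> F (h + x) - F x = DQ h * h.
  by move=> h0; rewrite /DQ [h *: 1]mulr1 [_ *: _]mulrC mulfVK.
pose S := [set p | exists2 d, 0 < d & forall h, h != 0 -> `|h| < d -> p <= DQ h].
have low p : ~ freq_decr (fun z => F z - p * z) x -> S p.
  move=> /not_freq_decr[d d0 H]; exists d => // h h0 hd.
  have := H (h + x); rewrite addrK => /(_ hd) le0.
  have h2 : 0 < h ^+ 2 by rewrite exprn_even_gt0.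
  rewrite -subr_ge0 -(pmulr_lge0 _ h2); apply: le_trans le0 _; rewrite le_eqVlt; apply/orP; left; apply/eqP.
  transitivity ((F (h + x) - F x - p * h) * h); first by ring.
  by rewrite DQE//; ring.
have up q : ~ freq_decr (fun z => q * z - F z) x ->
    exists2 d, 0 < d & forall h, h != 0 -> `|h| < d -> DQ h <= q.
  move=> /not_freq_decr[d d0 H]; exists d => // h h0 hd.
  have := H (h + x); rewrite addrK => /(_ hd) le0.
  have h2 : 0 < h ^+ 2 by rewrite exprn_even_gt0.
  rewrite -subr_ge0 -(pmulr_lge0 _ h2); apply: le_trans le0 _; rewrite le_eqVlt; apply/orP; left; apply/eqP.
  transitivity ((q * h - (F (h + x) - F x)) * h); first by ring.
  by rewrite DQE//; ring.
(* Monotonicity gives [0 <= l], so the slope p chosen above l is positive, as the hypothesis on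
   pairs requires. *)
have S0 : S 0.
  exists 1 => // h h0 _; rewrite /DQ [h *: 1]mulr1.
  case: (ltgtP h 0) h0 => // h0 _.
    by rewrite nmulr_rge0 ?invr_lt0// subr_le0 ndF// gerDr ltW.
  by rewrite pmulr_rge0 ?invr_gt0// subr_ge0 ndF// lerDr ltW.
have Sub (q : R) : (exists2 d, 0 < d & forall h, h != 0 -> `|h| < d -> DQ h <= q) ->
    ubound S q.
  move=> [d d0 dq] p [e e0 ep]; pose h := Num.min d e / 2.
  have m0 : 0 < Num.min d e by rewrite lt_min d0.
  have h0 : 0 < h by rewrite divr_gt0.
  have hde : h < Num.min d e by rewrite /h; lra.
  move: hde; rewrite lt_min => /andP[hd he].
  by rewrite (le_trans (ep h _ _) (dq h _ _)) ?gt_eqF ?gtr0_norm.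
have supS : has_sup S by split; [exists 0|exists n%:R; exact/Sub/up].
pose l := sup S.
have l0 : 0 <= l by exact: ub_le_sup supS.2 _ S0.
rewrite /derivable; apply/cvg_ex; exists l; apply/cvgrPdist_lt => e e0.
have [p1 [d1 d10 Hd1] lp1] := sup_adherent e0 supS.
have [p] : exists p : rat, ratr p \in `]l, l + e[ by apply: rat_in_itvoo; rewrite ltrDl.
rewrite in_itv/= => /andP[lp pe].
have [q] : exists q : rat, ratr q \in `]ratr p : R, l + e[ by apply: rat_in_itvoo.
rewrite in_itv/= => /andP[pq qe].
have p0 : 0 < p by rewrite -(ltr0q R) (le_lt_trans l0).
have nSp : freq_decr (fun z => F z - ratr p * z) x.
  apply: contrapT => /low Sp; have := ub_le_sup supS.2 Sp.
  by rewrite leNgt lp.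
have [d2 d20 Hd2] : exists2 d, 0 < d & forall h, h != 0 -> `|h| < d -> DQ h <= ratr q.
  apply: up => nSq; apply: (npq p q p0) => //.
  by rewrite -(ltr_rat R).
rewrite near_withinE.
have dd0 : 0 < Num.min d1 d2 by rewrite lt_min d10.
have := @nbhs0_lt _ R^o _ dd0; apply: filterS => h hd h0; rewrite -/(DQ h).
move: hd; rewrite lt_min => /andP[hd1 hd2].
have := Hd1 h h0 hd1; have := Hd2 h h0 hd2; move: lp1; rewrite -/l => *.
by rewrite ltr_norml; apply/andP; split; lra.
Qed.

End derivable_slopes.

Section lebesgue_monotone.
Context {R : realType}.
Notation mu := (@lebesgue_measure R).

(** The exceptional set is covered by countably many null sets of the two kinds, indexed by bounds M
    and by pairs of rationals, which [unpickle] enumerates. *)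
Lemma nondecreasing_derivable_ae (F : R -> R) :
  {homo F : x y / x <= y} -> continuous F -> {ae mu, forall x, derivable F x 1}.
Proof.
move=> ndF cF.
pose C : cumulative R R := HB.pack F (isCumulative.Build R _ R F ndF (right_continuousW cF)).
have cC : continuous C := cF.
have N1 := negligible_bigcup (fun M : nat => slope_infty_null cC M%:R).
have N2 (pq : rat * rat) (M : nat) : mu.-negligible [set x | [/\ 0 < pq.1 < pq.2, `|x| < M%:R,
    freq_decr (fun z => F z - ratr pq.1 * z) x &
    freq_decr (fun z => ratr pq.2 * z - F z) x]].
  have [/andP[p0 pq0]|npq] := boolP (0 < pq.1 < pq.2).
    have p0' : 0 < ratr pq.1 :> R by rewrite ltr0q.
    have pq' : ratr pq.1 < ratr pq.2 :> R by rewrite ltr_rat.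
    by apply: negligibleS (slope_lt_gt_null cC M%:R p0' pq') => x [].
  by apply: negligibleS (negligible_set0 mu) => x [H _ _ _]; case/negP: npq.
pose S (o : option (rat * rat)) (M : nat) : set R := if o is Some pq then
  [set x | [/\ 0 < pq.1 < pq.2, `|x| < M%:R,
    freq_decr (fun z => F z - ratr pq.1 * z) x &
    freq_decr (fun z => ratr pq.2 * z - F z) x]] else set0.
have N3 : mu.-negligible (\bigcup_(n : nat) \bigcup_(M : nat) S (unpickle n) M).
  apply: negligible_bigcup => n; apply: negligible_bigcup => M.
  by case: unpickle => [pq|]; [exact: N2|exact: negligible_set0].
apply: negligibleS (negligibleU N1 N3) => x /= nd.
have [M xM] : exists M : nat, `|x| < M%:R.
  by exists (Num.bound `|x|); exact: archi_boundP.
apply: contrapT => nU; apply: nd; apply: derivable_of_slopes => //.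
  apply: contrapT => H; apply: nU; left; exists M => //; split=> // n.
  by apply: contrapT => ?; apply: H; exists n.
move=> p q p0 pq [H1 H2]; apply: nU; right.
have Sx : S (unpickle (pickle (p, q))) M x by rewrite pickleK; split=> //; rewrite p0.
move: (pickle (p, q)) Sx => n Sx; exists n; [exact: I|].
by exists M; [exact: I|].
Qed.

End lebesgue_monotone.

(** * Continuity relative to a set, and extension from a segment *)

Section within_continuity.
Context {R : realType}.

Lemma within_continuous_ballP (T : pseudoMetricType R) (A : set T) (g : T -> R) :
  {within A, continuous g} <->
  forall x, A x -> forall e, 0 < e -> exists2 d, 0 < d &
    forall y, A y -> ball x d y -> `|g y - g x| < e.
Proof.
rewrite subspace_continuousP; split=> H x Ax.
  move=> e e0; have /cvgrPdist_lt/(_ _ e0) := H x Ax.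
  rewrite near_withinE => /nbhs_ballP[d /= d0 Hd]; exists d => // y Ay /Hd /(_ Ay).
  by rewrite distrC.
apply/cvgrPdist_lt => e e0; rewrite near_withinE.
have [d d0 Hd] := H x Ax e e0.
by apply/nbhs_ballP; exists d => //= y /Hd + Ay => /(_ Ay); rewrite distrC.
Qed.

Lemma within_continuous_distP (A : set R) (g : R -> R) :
  {within A, continuous g} <->
  forall x, A x -> forall e, 0 < e -> exists2 d, 0 < d &
    forall y, A y -> `|y - x| < d -> `|g y - g x| < e.
Proof.
rewrite (@within_continuous_ballP R).
by split=> H x Ax e /(H x Ax)[d d0 Hd]; exists d => // y Ay xy; apply: Hd => //;
  move: xy; rewrite /ball/= distrC.
Qed.

(** Retraction of the line onto [a, b]: composing with it turns a function continuous on the segment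
    into a total continuous one. *)
Definition clamp (a b x : R) := Num.max a (Num.min x b).

Lemma clamp_itv a b x : a <= b -> clamp a b x \in `[a, b].
Proof.
move=> ab; rewrite in_itv/= /clamp le_max lexx/= ge_max ab/=.
by rewrite ge_min lexx orbT.
Qed.

Lemma clamp_id a b x : x \in `[a, b] -> clamp a b x = x.
Proof. by rewrite in_itv/= /clamp => /andP[ax xb]; rewrite min_l// max_r. Qed.

Lemma clamp_homo a b : {homo clamp a b : x y / x <= y}.
Proof.
move=> x y xy; rewrite /clamp ge_max le_max lexx/= le_max.
by apply/orP; right; rewrite le_min !ge_min xy lexx !orbT.
Qed.

Lemma clamp_dist a b x y : a <= b -> `|clamp a b x - clamp a b y| <= `|x - y|.
Proof.
move=> ab; wlog xy : x y / y <= x.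
  move=> H; have [?|/ltW ?] := leP y x; first exact: H.
  by rewrite distrC (distrC x); exact: H.
rewrite !ger0_norm ?subr_ge0 ?clamp_homo// /clamp !minEle !maxEle.
by repeat case: ifPn => //; rewrite -?ltNge; lra.
Qed.

Lemma continuous_clamp a b (g : R -> R) : a <= b ->
  {within `[a, b], continuous g} -> continuous (g \o clamp a b).
Proof.
move=> ab /within_continuous_distP cg x; apply/cvgrPdist_lt => e e0.
have [d d0 Hd] := cg _ (clamp_itv x ab) e e0.
apply/nbhs_ballP; exists d => //= y; rewrite /ball/= => xy.
rewrite distrC; apply: Hd; first exact: clamp_itv.
by rewrite distrC (le_lt_trans (clamp_dist _ _ ab)).
Qed.

End within_continuity.

(** * Absolutely continuous functions *)

Section abs_continuous_derivable.
Context {R : realType}.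
Variables (a b : R) (f : R -> R).
Notation mu := (@lebesgue_measure R).
Hypotheses (ab : a < b) (acf : abs_continuous a b f).

Lemma abs_continuous_continuous : {within `[a, b], continuous f}.
Proof.
apply/within_continuous_distP => x /= xab e e0.
have [d d0 Hd] := acf e0; exists d => // y /= yab xyd.
pose u := Num.min x y; pose v := Num.max x y.
have -> : `|f y - f x| = `|f v - f u|.
  by rewrite /u /v minEle maxEle; case: ifPn => // _; rewrite distrC.
have := Hd 1%N (fun=> u) (fun=> v); rewrite !big_ord1; apply.
- move=> _; move: xab yab; rewrite !in_itv/= /u /v => /andP[? ?] /andP[? ?].
  by split; [rewrite le_min; apply/andP|rewrite ge_min !le_max lexx|
             rewrite ge_max; apply/andP].
- by apply/trivIsetP => i j _ _; rewrite !ord1 eqxx.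
- apply: le_lt_trans xyd; rewrite /u /v minEle maxEle.
  by case: ifPn => _; [|rewrite distrC]; exact: ler_norm.
Qed.

(** For [e = 1], the cells of a partition of a short interval form an admissible disjoint family, so
    every variation is below 1. *)
Lemma abs_continuous_bounded_variation_short : exists2 d, 0 < d &
  forall u v, a <= u -> u <= v -> v <= b -> v - u < d -> bounded_variation u v f.
Proof.
have [d d0 Hd] := acf ltr01; exists d => // u v au uv vb vud.
exists 1 => _ [s us <-]; rewrite /variation/= big_mkord; apply: ltW.
pose p i := nth v (u :: s) i.
have pge i : (i <= size s)%N -> u <= p i.
  by move=> si; apply: itv_partition_nth_ge us.
have ple i : (i <= size s)%N -> p i <= v.
  by move=> si; apply: itv_partition_nth_le us.
have plt i j : (i < j)%N -> (j <= size s)%N -> p i < p j.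
  move=> ij js; have [sa _] := us.
  have := @sorted_ltn_nth _ _ lt_trans v (u :: s) sa i j.
  by rewrite !inE/= !ltnS; apply => //; rewrite (leq_trans (ltnW ij)).
apply: (Hd (size s) (fun i => p i) (fun i => p i.+1)).
- move=> i; split.
  + by rewrite (le_trans au)// pge// ltnW.
  + by rewrite ltW// plt.
  + by rewrite (le_trans _ vb)// ple.
- have Hij (i j : 'I_(size s)) : (i < j)%N ->
      `]p i, p i.+1[%classic `&` `]p j, p j.+1[%classic = set0.
    move=> ij; rewrite -subset0 => x [] /=; rewrite !in_itv/= => /andP[_ x1] /andP[x2 _].
    have : p i.+1 <= p j.
      move: ij; rewrite leq_eqVlt => /predU1P[->//|ij].
      by rewrite ltW// plt// ltnW.
    by move=> /(lt_le_trans x1)/(lt_trans x2); rewrite ltxx.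
  apply/trivIsetP => i j _ _ ij; have [ji|ji|/val_inj eij] := ltngtP i j.
  + exact: Hij.
  + by rewrite setIC; exact: Hij.
  + by rewrite eij eqxx in ij.
- rewrite (_ : \sum_(i < size s) _ = v - u)//.
  rewrite -(big_mkord xpredT (fun i => p i.+1 - p i)) telescope_sumr//.
  by rewrite /p (itv_partition_nth_size _ us).
Qed.

Lemma abs_continuous_bounded_variation : bounded_variation a b f.
Proof.
have [d d0 H] := abs_continuous_bounded_variation_short.
(* Additivity of the total variation lets [a, b] be crossed in steps of [d / 2], each shorter than
   d. *)
have H2 n : forall x, a <= x -> x <= b -> x <= a + n%:R * (d / 2) -> bounded_variation a x f.
  elim: n => [|n IH] x ax xb.
    by rewrite mul0r addr0 => xa; rewrite (le_anti (introT andP (conj xa ax))); exact: bounded_variationxx.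
  move=> xn; have [xle|xgt] := leP x (a + n%:R * (d / 2)); first exact: IH.
  pose y := a + n%:R * (d / 2).
  have ay : a <= y by rewrite /y lerDl mulr_ge0// divr_ge0// ltW.
  have yx : y <= x by exact: ltW.
  apply/bounded_variationP => //; rewrite (total_variationD f ay yx) fin_numD.
  apply/andP; split; apply/bounded_variationP => //.
    by apply: IH => //; exact: le_trans xb.
  apply: H => //; move: xn; rewrite -natr1 /y; lra.
have d20 : 0 < d / 2 by rewrite divr_gt0.
apply: (H2 (Num.bound ((b - a) / (d / 2)))) => //; first exact: ltW.
have : (b - a) / (d / 2) < (Num.bound ((b - a) / (d / 2)))%:R.
  by apply: archi_boundP; rewrite divr_ge0 ?subr_ge0 ?ltW.
by rewrite ltr_pdivrMr// => ?; rewrite -lerBlDl ltW.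
Qed.

Lemma fine_neg_tvE (g : R -> R) x : bounded_variation a b g -> x \in `[a, b] ->
  fine (neg_tv a g x) = (fine (total_variation a x g) - g x) / 2.
Proof.
move=> bvg; rewrite in_itv/= => /andP[ax xb].
have fg : total_variation a x g \is a fin_num.
  by apply/bounded_variationP => //; exact: bounded_variationl bvg.
by rewrite /neg_tv fineM ?fin_numB ?fg// fineB.
Qed.

(** The negative variation of a continuous function of bounded variation is monotone and continuous;
    clamping makes it so on the whole line. *)
Lemma fine_neg_tv_derivable_ae (g : R -> R) :
  bounded_variation a b g -> {within `[a, b], continuous g} ->
  {ae mu, forall x, derivable ((fine \o neg_tv a g) \o clamp a b) x 1}.
Proof.
move=> bvg cg; apply: nondecreasing_derivable_ae.
  move=> x y xy; apply: (fine_neg_tv_nondecreasing bvg).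
  - exact/clamp_itv/ltW.
  - exact/clamp_itv/ltW.
  - exact: clamp_homo.
apply: continuous_clamp; first exact: ltW.
have /within_continuous_distP ctv := total_variation_continuous ab cg bvg.
move/within_continuous_distP : cg => cg; apply/within_continuous_distP => x /= xab e e0.
have [d1 d10 H1] := ctv x xab e e0; have [d2 d20 H2] := cg x xab e e0.
exists (Num.min d1 d2); first by rewrite lt_min d10.
move=> y yab; rewrite lt_min => /andP[/(H1 y yab) + /(H2 y yab)].
rewrite !fine_neg_tvE//= !ltr_norml => /andP[? ?] /andP[? ?].
by apply/andP; split; lra.
Qed.

Lemma abs_continuous_derivable_ae :
  {ae mu, forall x, x \in `]a, b[ -> derivable f x 1}.
Proof.
have bvf := abs_continuous_bounded_variation.
have cf := abs_continuous_continuous.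
have bvN : bounded_variation a b (\- f) by exact: bounded_variationN.
have cNf : {within `[a, b], continuous (\- f)}.
  by move=> x; apply: continuousN; exact: cf.
have := negligibleU (fine_neg_tv_derivable_ae bvf cf) (fine_neg_tv_derivable_ae bvN cNf).
apply: negligibleS => x /not_implyP[xab ndf]; apply: contrapT => /not_orP[/contrapT H1 /contrapT H2].
apply: ndf.
have := derivableB H2 H1; apply: near_eq_derivable.
have : \forall z \near x, z \in `]a, b[ by exact: near_in_itvoo.
apply: filterS => z zab; have zab' := subset_itv_oo_cc zab.
rewrite (bounded_variation_pos_neg_tvE bvf zab').
(* The positive variation of f is by definition the negative variation of [\- f], so one lemma
   serves both parts of the Jordan decomposition. *)
change (fine (neg_tv a (\- f) (clamp a b z)) - fine (neg_tv a f (clamp a b z)) =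
  fine (pos_tv a f z) - fine (neg_tv a f z)).
by rewrite clamp_id.
Qed.

End abs_continuous_derivable.

(** * The fundamental theorem of calculus for unbounded integrands *)

Section ftc_open.
Context {R : realType}.
Notation mu := (@lebesgue_measure R).

(** The function h may blow up at p and q, as power kernels do. The open interval is exhausted by
    compact ones: monotone convergence handles the integrals, and continuity of H up to the
    endpoints handles the increments. *)
Lemma ge0_FTC2_open (h H : R -> R) (p q : R) : p < q ->
  {in `]p, q[, continuous h} -> (forall x, x \in `]p, q[ -> 0 <= h x) ->
  (forall x, x \in `]p, q[ -> is_derive x 1 H (h x)) ->
  {within `[p, q], continuous H} ->
  measurable_fun `]p, q[ h /\
  (\int[mu]_(x in `]p, q[) (h x)%:E = (H q - H p)%:E)%E.
Proof.
move=> pq ch h0 dH cH.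
(* The shift [n.+3] keeps [e n] below half the length, so the inner intervals are nondegenerate from
   [n = 0] on. *)
have [e eE] : { e : nat -> R | forall n, e n = (q - p) / (n.+3)%:R } by eexists.
have e0 n : 0 < e n by rewrite eE divr_gt0// subr_gt0.
have e2 n : p + e n < q - e n.
  suff : e n < (q - p) / 2 by lra.
  by rewrite eE ltr_pM2l ?subr_gt0// ltf_pV2 ?posrE// ltr_nat.
have eS n m : (n <= m)%N -> e m <= e n.
  by move=> nm; rewrite !eE ler_pM2l ?subr_gt0// lef_pV2 ?posrE// ler_nat.
have ecvg : e n @[n --> \oo] --> 0.
  have -> : e = (fun n => (q - p) * harmonic (n + 2)%N).
    by apply/funext => n; rewrite eE /= addn2.
  rewrite -[X in _ --> X](mulr0 (q - p)).
  apply: cvgM; first exact: cvg_cst.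
  by have := @cvg_harmonic R; rewrite -(cvg_shiftn 2).
pose F n := `[p + e n, q - e n]%classic.
have FE : \bigcup_n F n = `]p, q[%classic.
  apply/seteqP; split=> [x [n _]|x]; rewrite /F/= !in_itv/=.
    by have := e0 n => ? /andP[? ?]; apply/andP; split; lra.
  move=> /andP[px xq].
  have : \forall n \near \oo, e n < Num.min (x - p) (q - x).
    by apply: (cvgr_lt _ ecvg); rewrite lt_min !subr_gt0 px.
  case=> n _ /(_ n (leqnn n)) /=; rewrite lt_min => /andP[? ?].
  by exists n => //=; rewrite /F/= in_itv/=; apply/andP; split; lra.
have ndF : nondecreasing_seq F.
  move=> n m nm; rewrite subsetEset => x; rewrite /F/= !in_itv/= => /andP[? ?].
  by have := eS _ _ nm => ?; apply/andP; split; lra.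
have Fsub n x : F n x -> x \in `]p, q[.
  by move=> Fx; suff : `]p, q[%classic x by []; rewrite -FE; exists n.
have mF n : measurable (F n) by exact: measurable_itv.
have mh : measurable_fun `]p, q[ h.
  have oI : open `]p, q[%classic by exact: interval_open.
  by apply: (open_continuous_measurable_fun oI) => x; rewrite inE; exact: ch.
split=> //.
have intF n : (\int[mu]_(x in F n) (h x)%:E = (H (q - e n) - H (p + e n))%:E)%E.
  rewrite (@continuous_FTC2 _ h H)//.
  - apply/within_continuous_distP => x xF e' e'0.
    have /cvgrPdist_lt/(_ _ e'0)/nbhs_ballP[d /= d0 Hd] := ch _ (Fsub _ _ xF).
    by exists d => // y _ xy; rewrite distrC; apply: Hd; rewrite /ball/= distrC.
  - have dcH x : F n x -> H z @[z --> x] --> H x.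
      move=> /Fsub/dH[dHx _]; apply: differentiable_continuous.
      exact/derivable1_diffP.
    split.
    + move=> x /subset_itv_oo_cc xF; by case: (dH x (Fsub n _ xF)).
    + apply: cvg_at_right_filter; apply: dcH.
      by rewrite /F/= in_itv/= lexx ltW.
    + apply: cvg_at_left_filter; apply: dcH.
      by rewrite /F/= in_itv/= lexx ltW.
  - by move=> x /subset_itv_oo_cc xF; have [_] := dH x (Fsub n _ xF); rewrite derive1E.
have mhF n : measurable_fun (F n) (EFin \o h).
  apply/measurable_EFinP; apply: measurable_funS mh => //.
  by move=> x /Fsub.
have cvF : (\int[mu]_(x in F n) (h x)%:E)%E @[n --> \oo] -->
    (\int[mu]_(x in \bigcup_n F n) (h x)%:E)%E.
  apply: ge0_nondecreasing_set_cvg_integral => //.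
  by move=> n x /Fsub/h0; rewrite lee_fin.
rewrite -FE; apply: cvg_unique cvF _ => //.
rewrite (_ : (fun n => _) = (fun n => (H (q - e n) - H (p + e n))%:E)); last first.
  by apply/funext => n; exact: intF.
apply: cvg_EFin; first by near=> n.
have cHe (z : R) (u : nat -> R) : z \in `[p, q] -> (forall n, u n \in `[p, q]) ->
    u n @[n --> \oo] --> z -> H (u n) @[n --> \oo] --> H z.
  move=> zpq upq uz; apply/cvgrPdist_lt => e' e'0.
  have [d d0 Hd] := (within_continuous_distP _ _).1 cH z zpq e' e'0.
  have /cvgrPdist_lt/(_ _ d0) := uz; apply: filterS => n un.
  by rewrite distrC; apply: Hd; [exact: upq|rewrite distrC].
apply: cvgB; apply: cHe.
- by rewrite in_itv/= lexx ltW.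
- by move=> n; have := e0 n; have := e2 n; rewrite in_itv/= => *; apply/andP; split; lra.
- by rewrite -[X in _ --> X]subr0; apply: cvgB => //; exact: cvg_cst.
- by rewrite in_itv/= lexx ltW.
- by move=> n; have := e0 n; have := e2 n; rewrite in_itv/= => *; apply/andP; split; lra.
- by rewrite -[X in _ --> X]addr0; apply: cvgD => //; exact: cvg_cst.
Unshelve. all: by end_near. Qed.

End ftc_open.

(** * Kernel integrals *)

Section power_kernel.
Context {R : realType}.
Notation mu := (@lebesgue_measure R).

Lemma is_derive_powR (r s : R) : 0 < s ->
  is_derive s (1 : R) (@powR R ^~ r) (r * s `^ (r - 1)).
Proof.
move=> s0; have s0' : s \in `]0, +oo[ by rewrite in_itv/= s0.
apply: DeriveDef; first exact: derivable_powR.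
by rewrite -derive1E powR_derive1.
Qed.

Lemma within_continuous_powR (r : R) : 0 < r ->
  {within [set s : R | 0 <= s], continuous (@powR R ^~ r)}.
Proof.
move=> r0; apply/within_continuous_distP => s /= s0 e e0.
move: s0; rewrite le_eqVlt => /predU1P[<-|s0].
  have /cvgrPdist_lt/(_ _ e0) := powR_cvg0 r0.
  rewrite near_withinE => /nbhs_ballP[d /= d0 Hd]; exists d => // y.
  rewrite /= le_eqVlt => /predU1P[<-|y0]; first by rewrite !subrr normr0.
  rewrite powR0 ?gt_eqF// => yd; have := Hd y; rewrite /ball/= distrC => /(_ yd y0).
  by rewrite distrC.
have [+ _] := is_derive_powR r s0 => /derivable1_diffP/differentiable_continuous.
move=> /cvgrPdist_lt/(_ _ e0)/nbhs_ballP[d /= d0 Hd]; exists d => // y _ yd.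
by rewrite distrC; apply: Hd; rewrite /ball/= distrC.
Qed.

Lemma within_continuous_powRB (r x p q : R) : 0 < r -> q <= x ->
  {within `[p, q], continuous (fun t => (x - t) `^ r)}.
Proof.
move=> r0 qx; apply/within_continuous_distP => s /= sq e e0.
have s0 : 0 <= x - s by move: sq; rewrite in_itv/= subr_ge0 => /andP[_ /le_trans]; exact.
have [d d0 Hd] := (within_continuous_distP _ _).1 (within_continuous_powR r0) _ s0 e e0.
exists d => // y yq ysd; apply: Hd.
  by move: yq; rewrite /= in_itv/= subr_ge0 => /andP[_ /le_trans]; exact.
have -> : x - y - (x - s) = s - y by ring.
by rewrite distrC.
Qed.

Lemma is_derive_powRB (r x s : R) : s < x ->
  is_derive s (1 : R) (fun t => (x - t) `^ r) (- (r * (x - s) `^ (r - 1))).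
Proof.
move=> sx; have xs0 : 0 < x - s by rewrite subr_gt0.
have H1 : is_derive s (1 : R) (fun t : R => x - t) (-1).
  have := is_deriveB (is_derive_cst x s (1 : R)) (is_derive_id s (1 : R)).
  by rewrite sub0r.
have := @is_derive1_comp R (@powR R ^~ r) (fun t : R => x - t) s _ _ (is_derive_powR r xs0) H1.
by rewrite mulrN1.
Qed.

Lemma integral_power_kernel_open (c x p q : R) : 0 <= c -> c < 1 -> p < q -> q <= x ->
  (\int[mu]_(t in `]p, q[) ((x - t) `^ (- c))%:E =
   (((x - p) `^ (1 - c) - (x - q) `^ (1 - c)) / (1 - c))%:E)%E.
Proof.
move=> c0 c1 pq qx; have r0 : 0 < 1 - c by rewrite subr_gt0.
have cpow : {within `[p, q], continuous (fun t => (x - t) `^ (1 - c))}.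
  exact: within_continuous_powRB.
have [||||_ ->] := @ge0_FTC2_open R (fun t => (x - t) `^ (- c))
   (fun t => - (1 - c)^-1 * (x - t) `^ (1 - c)) p q pq.
- move=> t; rewrite in_itv/= => /andP[_ tq].
  have := is_derive_powRB (- c) (lt_le_trans tq qx) => -[+ _].
  by move=> /derivable1_diffP/differentiable_continuous.
- by move=> t _; exact: powR_ge0.
- move=> t; rewrite in_itv/= => /andP[_ tq].
  have := is_derive_powRB (1 - c) (lt_le_trans tq qx) => D.
  have D2 := is_deriveZ (- (1 - c)^-1) D.
  apply: (is_derive_eq D2).
  rewrite -[_ *: _]/(_ * _) mulrNN mulKf ?gt_eqF//.
  by congr (_ `^ _); ring.
- move=> t; apply: cvgM; first exact: cvg_cst.
  exact: cpow.
- by congr EFin; field; rewrite gt_eqF.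
Qed.

Lemma ler_powRN (c s t : R) : 0 <= c -> 0 < s -> s <= t -> t `^ (- c) <= s `^ (- c).
Proof.
move=> c0 s0 st; rewrite !powRN lef_pV2 ?posrE ?powR_gt0//; last exact: lt_le_trans st.
by rewrite ge0_ler_powR// nnegrE ltW// (lt_le_trans s0).
Qed.

(** The power is nonincreasing in the distance, so the difference has a constant sign and its
    antiderivative gives the exact value. *)
Lemma integral_power_kernel_diff (c x x' p : R) : 0 <= c -> c < 1 -> p < x -> x <= x' ->
  (\int[mu]_(t in `]p, x[) ((x - t) `^ (- c) - (x' - t) `^ (- c))%:E =
   (((x - p) `^ (1 - c) - (x' - p) `^ (1 - c) + (x' - x) `^ (1 - c)) / (1 - c))%:E)%E.
Proof.
move=> c0 c1 px xx'; have r0 : 0 < 1 - c by rewrite subr_gt0.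
have [||||_ ->] := @ge0_FTC2_open R (fun t => (x - t) `^ (- c) - (x' - t) `^ (- c))
   (fun t => - (1 - c)^-1 * (x - t) `^ (1 - c) - (- (1 - c)^-1 * (x' - t) `^ (1 - c))) p x px.
- move=> t; rewrite in_itv/= => /andP[_ tq].
  have := is_derive_powRB (- c) tq => -[+ _].
  have := is_derive_powRB (- c) (lt_le_trans tq xx') => -[+ _].
  move=> /derivable1_diffP/differentiable_continuous H1.
  move=> /derivable1_diffP/differentiable_continuous H2.
  exact: cvgB.
- move=> t; rewrite in_itv/= => /andP[_ tx].
  by rewrite subr_ge0 ler_powRN// ?subr_gt0// lerD2r.
- move=> t; rewrite in_itv/= => /andP[_ tx].
  have D1 := is_deriveZ (- (1 - c)^-1) (is_derive_powRB (1 - c) tx).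
  have D2 := is_deriveZ (- (1 - c)^-1) (is_derive_powRB (1 - c) (lt_le_trans tx xx')).
  apply: (is_derive_eq (is_deriveB D1 D2)).
  rewrite -[_ *: - ((1 - c) * (x - t) `^ _)]/(_ * _) -[_ *: - ((1 - c) * (x' - t) `^ _)]/(_ * _).
  rewrite !mulrNN !mulKf ?gt_eqF//.
  by have -> : 1 - c - 1 = - c by ring.
- have cp1 := @within_continuous_powRB (1 - c) x p x r0 (lexx x).
  have cp2 := @within_continuous_powRB (1 - c) x' p x r0 xx'.
  move=> t; apply: cvgB; (apply: cvgM; first exact: cvg_cst).
    exact: cp1.
  exact: cp2.
- by rewrite subrr powR0 ?gt_eqF//; congr EFin; field; rewrite gt_eqF.
Qed.

(* Extended by 0, so that left and right fractional integrals become integrals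
   over the whole of [a, b]. The library's own value of [s `^ (- c)] at s <= 0
   is not 0 in general. *)
Definition kern (c s : R) : R := if 0 < s then s `^ (- c) else 0.

Lemma kern_ge0 c s : 0 <= kern c s.
Proof. by rewrite /kern; case: ifPn => // _; exact: powR_ge0. Qed.

Lemma measurable_kern c : measurable_fun [set: R] (kern c).
Proof.
apply: measurable_fun_ifT => //.
by apply: (@measurable_fun_ltr _ _ R setT (cst 0) id) => //; exact: measurable_id.
Qed.

Lemma measurable_kernB c x : measurable_fun [set: R] (fun t => kern c (x - t)).
Proof.
apply: (measurableT_comp (measurable_kern c)).
exact: measurable_funB.
Qed.

Lemma ge0_integral_itv_split (g : R -> R) a x b : a <= x -> x <= b ->
  measurable_fun [set: R] g -> (forall t, 0 <= g t) ->
  (\int[mu]_(t in `[a, b]) (g t)%:E = \int[mu]_(t in `]a, x[) (g t)%:E +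
    \int[mu]_(t in `]x, b[) (g t)%:E)%E.
Proof.
move=> ax xb mg g0.
have mg' D : measurable_fun D (EFin \o g) by apply/measurable_EFinP/measurable_funTS.
rewrite (@itv_bndbnd_setU _ _ (BLeft a) (BRight x) (BRight b))//.
rewrite ge0_integral_setU//=.
- by congr (_ + _)%E; apply: integral_itv_bndoo.
- exact: mg'.
- by move=> t _; rewrite lee_fin.
- apply/disj_setPS => t [] /=; rewrite !in_itv/= => /andP[_ tx] /andP[xt _].
  by move: (lt_le_trans xt tx); rewrite ltxx.
Qed.

Variables (c : R).
Hypotheses (c0 : 0 <= c) (c1 : c < 1).
Let r0 : 0 < 1 - c. Proof. by rewrite subr_gt0. Qed.

Lemma integral_kern_left a b x : a <= x -> x <= b ->
  (\int[mu]_(t in `[a, b]) (kern c (x - t))%:E = ((x - a) `^ (1 - c) / (1 - c))%:E)%E.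
Proof.
move=> ax xb; rewrite (ge0_integral_itv_split ax xb); last 2 first.
- exact: measurable_kernB.
- by move=> t; exact: kern_ge0.
rewrite [X in (_ + X)%E]integral0_eq ?adde0; last first.
  move=> t /=; rewrite in_itv/= => /andP[xt _].
  by rewrite /kern subr_gt0 ltNge (ltW xt).
move: ax; rewrite le_eqVlt => /predU1P[->|ax].
  by rewrite set_itvoo0 integral_set0 subrr powR0 ?gt_eqF// mul0r.
transitivity (\int[mu]_(t in `]a, x[) ((x - t) `^ (- c))%:E)%E.
  by apply: eq_integral => t; rewrite inE/= in_itv/= => /andP[_ tx]; rewrite /kern subr_gt0 tx.
by rewrite integral_power_kernel_open// subrr powR0 ?gt_eqF// subr0.
Qed.

(** Each side of x contributes one half of the bound. On ]a, x[ the exact value is at most the term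
    in [x' - x], the two other powers having a nonpositive difference; on ]x, b[ only the kernel
    based at [x'] survives. *)
Lemma integral_kern_diff_left a b x x' : a <= x -> x <= x' -> x' <= b ->
  (\int[mu]_(t in `[a, b]) (`|kern c (x' - t) - kern c (x - t)|)%:E <=
    (2 * (x' - x) `^ (1 - c) / (1 - c))%:E)%E.
Proof.
move=> ax xx' xb.
have mK : measurable_fun [set: R] (fun t => `|kern c (x' - t) - kern c (x - t)|).
  by apply: measurableT_comp => //; apply: measurable_funB; exact: measurable_kernB.
rewrite (ge0_integral_itv_split ax (le_trans xx' xb))//.
rewrite mulrDl mul1r mulrDl EFinD; apply: leeD.
  move: ax; rewrite le_eqVlt => /predU1P[->|ax].
    by rewrite set_itvoo0 integral_set0 lee_fin divr_ge0 ?powR_ge0// ltW.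
  have -> : (\int[mu]_(t in `]a, x[) (`|kern c (x' - t) - kern c (x - t)|)%:E =
      \int[mu]_(t in `]a, x[) ((x - t) `^ (- c) - (x' - t) `^ (- c))%:E)%E.
    apply: eq_integral => t; rewrite inE/= in_itv/= => /andP[_ tx].
    rewrite /kern !subr_gt0 tx (lt_le_trans tx xx') distrC ger0_norm//.
    by rewrite subr_ge0 ler_powRN// ?subr_gt0// lerD2r.
  rewrite integral_power_kernel_diff// lee_fin ler_pM2r ?invr_gt0//.
  rewrite -lerBrDr subrr subr_le0 ge0_ler_powR// ?nnegrE ?subr_ge0 ?lerD2r//.
  - exact: ltW.
  - exact: ltW.
  - exact: le_trans (ltW ax) xx'.
have -> : (\int[mu]_(t in `]x, b[) (`|kern c (x' - t) - kern c (x - t)|)%:E =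
    \int[mu]_(t in `]x, b[) (kern c (x' - t))%:E)%E.
  apply: eq_integral => t; rewrite inE/= in_itv/= => /andP[xt _].
  by rewrite [kern c (x - t)]/kern subr_gt0 ltNge (ltW xt)/= subr0 ger0_norm// kern_ge0.
apply: (@le_trans _ _ (\int[mu]_(t in `[x, b]) (kern c (x' - t))%:E)%E).
  apply: ge0_subset_integral => //.
  - apply/measurable_EFinP/measurable_funTS; exact: measurable_kernB.
  - by move=> t _; rewrite lee_fin kern_ge0.
  - exact: subset_itv_oo_cc.
by rewrite integral_kern_left.
Qed.

(** Reflection carries right kernels to left ones. Lebesgue measure is invariant under it because
    the image measure has the same values on half-open intervals. *)
Lemma integral_oppr a b (g : R -> R) : measurable_fun [set: R] g -> (forall t, 0 <= g t) ->
  (\int[mu]_(t in `[a, b]) (g t)%:E = \int[mu]_(t in `[(- b)%R, (- a)%R]) (g (- t)%R)%:E)%E.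
Proof.
move=> mg g0.
have mN : measurable_fun [set: measurableTypeR R] (-%R : measurableTypeR R -> measurableTypeR R).
  exact: (@oppr_measurable R).
pose N : {mfun (measurableTypeR R) >-> (measurableTypeR R)} := 
   HB.pack (-%R : measurableTypeR R -> measurableTypeR R) (isMeasurableFun.Build _ _ _ _ _ mN).
have muN X : measurable X -> mu X = pushforward mu N X.
  apply: lebesgue_measure_unique => _ [[u v] _ <-] /=.
  rewrite /pushforward (_ : N @^-1` _ = `[-v, -u[%classic); last first.
    by apply/seteqP; split => x; rewrite /= !in_itv/= lerNl ltrNr andbC.
  by rewrite !lebesgue_measure_itv/= !lte_fin ltrN2 -!EFinD opprK addrC.
transitivity (\int[pushforward mu N]_(t in `[a, b]) (g t)%:E)%E.
  by apply: eq_measure_integral => X mX _; exact: muN.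
rewrite ge0_integral_pushforward//=.
- congr integral; apply/seteqP; split => x; rewrite /= !in_itv/= lerNl lerNr andbC//.
- by apply/measurable_EFinP/measurable_funTS.
- by move=> x _; rewrite lee_fin.
Qed.

Lemma integral_kern_right a b x : a <= x -> x <= b ->
  (\int[mu]_(t in `[a, b]) (kern c (t - x))%:E = ((b - x) `^ (1 - c) / (1 - c))%:E)%E.
Proof.
move=> ax xb; rewrite integral_oppr; last 2 first.
- apply: (measurableT_comp (measurable_kern c)); exact: measurable_funB.
- by move=> t; exact: kern_ge0.
under eq_integral do rewrite addrC.
by rewrite integral_kern_left ?lerN2// opprK addrC.
Qed.

Lemma integral_kern_diff_right a b x x' : a <= x -> x <= x' -> x' <= b ->
  (\int[mu]_(t in `[a, b]) (`|kern c (t - x') - kern c (t - x)|)%:E <=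
    (2 * (x' - x) `^ (1 - c) / (1 - c))%:E)%E.
Proof.
move=> ax xx' xb; rewrite integral_oppr; last 2 first.
- apply: measurableT_comp => //; apply: measurable_funB;
  (apply: (measurableT_comp (measurable_kern c)); exact: measurable_funB).
- by [].
have -> : x' - x = - x - (- x') by ring.
under eq_integral do rewrite distrC (addrC (- _) (- x)) (addrC (- _) (- x')).
by apply: integral_kern_diff_left; rewrite ?lerN2.
Qed.

End power_kernel.

Section bounded_measurable.
Context {R : realType}.
Notation mu := (@lebesgue_measure R).
Variables (a b : R).

Let mab : measurable (`[a, b]%classic : set (measurableTypeR R)).
Proof. exact: measurable_itv. Qed.

Definition bounded_measurable (f : R -> R) : Prop :=
  measurable_fun `[a, b] f /\ exists M, forall t, t \in `[a, b] -> `|f t| <= M.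

Lemma within_continuous_bounded_measurable f : {within `[a, b], continuous f} ->
  bounded_measurable f.
Proof.
move=> cf; split.
  by apply: subspace_continuous_measurable_fun => //; exact: measurable_itv.
have /compact_bounded[M [_ Mf]] := continuous_compact cf (@segment_compact _ a b).
exists (M + 1) => t tab; apply: Mf; first by rewrite ltrDl.
by exists t.
Qed.

Lemma bounded_measurable_indic f (A : set R) : measurable A -> bounded_measurable f ->
  bounded_measurable (f \_ A).
Proof.
move=> mA [mf [M fM]]; split.
  by apply/measurable_restrict => //; apply: measurable_funS mf => //; exact: subIsetl.
exists `|M| => t tab; rewrite patchE; case: ifPn => _; last by rewrite normr0.
by rewrite (le_trans (fM _ tab))// ler_norm.
Qed.

Lemma bounded_measurable_integrable f : bounded_measurable f ->
  mu.-integrable `[a, b] (EFin \o f).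
Proof.
move=> [mf [M fM]]; apply: measurable_bounded_integrable => //.
- by rewrite /= lebesgue_measure_itv/=; case: ifPn => _; rewrite ltry.
- exists M; split; first exact: num_real.
  by move=> r Mr t tab; apply: (le_trans (fM t tab)); exact: ltW.
Qed.

Lemma bounded_measurableM f g : bounded_measurable f -> bounded_measurable g ->
  bounded_measurable (fun x => f x * g x).
Proof.
move=> [mf [M fM]] [mg [M' gM]]; split; first exact: measurable_funM.
by exists (M * M') => t tab; rewrite normrM ler_pM// ?fM// gM.
Qed.

Variables (k : R -> R -> R) (C r : R).
Hypotheses (k0 : forall x t, 0 <= k x t) (r0 : 0 < r)
  (mk : forall x, measurable_fun [set: R] (k x))
  (kC : forall x, x \in `[a, b] -> (\int[mu]_(t in `[a, b]) (k x t)%:E <= C%:E)%E)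
  (kD : forall x x', x \in `[a, b] -> x' \in `[a, b] ->
    (\int[mu]_(t in `[a, b]) (`|k x' t - k x t|)%:E <= (C * `|x' - x| `^ r)%:E)%E).

Lemma integrable_kernel x : x \in `[a, b] -> mu.-integrable `[a, b] (EFin \o k x).
Proof.
move=> xab; apply/integrableP; split.
  by apply/measurable_EFinP/measurable_funTS; exact: mk.
apply: le_lt_trans (ltry C); apply: le_trans (kC xab).
by under eq_integral do rewrite /= ger0_norm//.
Qed.

Lemma integrable_kernelM f x : bounded_measurable f -> x \in `[a, b] ->
  mu.-integrable `[a, b] (EFin \o (fun t => k x t * f t)).
Proof.
move=> [mf [M fM]] xab.
have ig : mu.-integrable `[a, b] (EFin \o (fun t => M * k x t)).
  have := integrableZl mab M (integrable_kernel xab).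
  by apply: eq_integrable.
apply: le_integrable ig => //.
- by apply/measurable_EFinP/measurable_funM => //; apply: measurable_funTS; exact: mk.
- move=> t tab; rewrite lee_fin /= !normrM mulrC ler_wpM2r//.
  by rewrite (le_trans (fM t tab))// ler_norm.
Qed.

Definition kernel_integral (f : R -> R) (x : R) : R :=
  \int[mu]_(t in `[a, b]) (k x t * f t).

(** An L^1 Hoelder bound of the kernel in x passes to the integral, uniformly over densities bounded
    by M. The kernel is abstract so that left and right integrals share one proof. *)
Lemma kernel_integral_dist (f : R -> R) M x x' : measurable_fun `[a, b] f ->
  (forall t, t \in `[a, b] -> `|f t| <= M) ->
  x \in `[a, b] -> x' \in `[a, b] ->
  `|kernel_integral f x' - kernel_integral f x| <= M * (C * `|x' - x| `^ r).
Proof.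
move=> mf fM xab x'ab; rewrite /kernel_integral.
have bf : bounded_measurable f by split=> //; exists M.
have M0 : 0 <= M by rewrite (le_trans _ (fM x xab)).
have [ix ix'] := (integrable_kernelM bf xab, integrable_kernelM bf x'ab).
rewrite -RintegralB//.
have iB : mu.-integrable `[a, b] (EFin \o (fun t => k x' t * f t - k x t * f t)).
  by have := integrableB _ ix' ix; apply.
rewrite (le_trans (le_normr_Rintegral _ iB))//.
have iD : mu.-integrable `[a, b] (EFin \o (fun t => `|k x' t - k x t|)).
  have /integrable_abse := integrableB mab (integrable_kernel x'ab) (integrable_kernel xab).
  by apply: eq_integrable => // t _ /=.
apply: (@le_trans _ _ (\int[mu]_(t in `[a, b]) (M * `|k x' t - k x t|))).
  apply: le_Rintegral => //.
  - by have /integrable_abse := iB; apply: eq_integrable => // t _ /=.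
  - by have := integrableZl mab M iD; apply.
  - by move=> t tab; rewrite -mulrBl normrM mulrC ler_wpM2r// fM.
rewrite RintegralZl// ler_wpM2l// -lee_fin /Rintegral fineK; first exact: kD.
exact: integrable_fin_num.
Qed.

Lemma kernel_integral_continuous f : bounded_measurable f ->
  {within `[a, b], continuous (kernel_integral f)}.
Proof.
move=> [mf [M fM]]; apply/within_continuous_distP => x xab e e0.
have K0 : 0 < M * C + 1.
  rewrite ltr_wpDl// mulr_ge0//; first by rewrite (le_trans _ (fM x xab)).
  by rewrite -lee_fin (le_trans _ (kC xab))// integral_ge0// => t _; rewrite lee_fin.
have eK0 : 0 < e / (M * C + 1) by rewrite divr_gt0.
have [d d0 Hd] := (within_continuous_distP _ _).1 (@within_continuous_powR R r r0) 0 (lexx 0) _ eK0.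
exists d => // y yab xyd.
rewrite (le_lt_trans (kernel_integral_dist mf fM xab yab))// mulrA.
have := Hd `|y - x| (normr_ge0 _).
rewrite subr0 normr_id powR0 ?gt_eqF// subr0 => /(_ xyd).
rewrite ger0_norm ?powR_ge0// ltr_pdivlMr// mulrC => H.
by rewrite (le_lt_trans _ H)// ler_wpM2r ?powR_ge0// lerDl.
Qed.

End bounded_measurable.

(** * Fractional integrals of bounded measurable functions *)

Section fractional_integrals.
Context {R : realType}.
Notation mu := (@lebesgue_measure R).
Variables (a b c : R).
Hypotheses (ab : a < b) (c0 : 0 <= c) (c1 : c < 1).

Let mab : measurable (`[a, b]%classic : set (measurableTypeR R)).
Proof. exact: measurable_itv. Qed.

Let r0 : 0 < 1 - c. Proof. by rewrite subr_gt0. Qed.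

(* Fractional integrals of order 1 - c without the factor 1 / Gamma (1 - c);
   for c = 0 they are ordinary primitives. *)
Definition frac_left := kernel_integral a b (fun x t => kern c (x - t)).
Definition frac_right := kernel_integral a b (fun x t => kern c (t - x)).

(** One constant serves both as L^1 bound of the kernel and as its Hoelder constant: the power of
    the length provides the former, the summand 1 the latter. *)
Definition kern_bound := 2 * ((b - a) `^ (1 - c) + 1) / (1 - c).

Lemma kern_bound_le : (b - a) `^ (1 - c) / (1 - c) <= kern_bound.
Proof.
rewrite ler_pM2r ?invr_gt0//.
by have := powR_ge0 (b - a) (1 - c); lra.
Qed.

Lemma kern_bound_mul s : 2 * s `^ (1 - c) / (1 - c) <= kern_bound * s `^ (1 - c).
Proof.
have H1 := powR_ge0 (b - a) (1 - c); have H2 := powR_ge0 s (1 - c).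
have -> : kern_bound * s `^ (1 - c) = 2 * ((b - a) `^ (1 - c) + 1) * s `^ (1 - c) / (1 - c).
  by rewrite /kern_bound mulrAC.
by rewrite ler_pM2r ?invr_gt0// ler_wpM2r//; lra.
Qed.

Let mkl x : measurable_fun [set: R] (fun t => kern c (x - t)).
Proof. exact: measurable_kernB. Qed.

Let mkr x : measurable_fun [set: R] (fun t => kern c (t - x)).
Proof. by apply: (measurableT_comp (measurable_kern c)); exact: measurable_funB. Qed.

Let klC x : x \in `[a, b] ->
  (\int[mu]_(t in `[a, b]) (kern c (x - t))%:E <= kern_bound%:E)%E.
Proof.
rewrite in_itv/= => /andP[ax xb]; rewrite integral_kern_left// lee_fin.
rewrite (le_trans _ kern_bound_le)// ler_pM2r ?invr_gt0//.
by rewrite ge0_ler_powR ?nnegrE ?subr_ge0 ?lerD2r// ?ltW.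
Qed.

Let krC x : x \in `[a, b] ->
  (\int[mu]_(t in `[a, b]) (kern c (t - x))%:E <= kern_bound%:E)%E.
Proof.
rewrite in_itv/= => /andP[ax xb]; rewrite integral_kern_right// lee_fin.
rewrite (le_trans _ kern_bound_le)// ler_pM2r ?invr_gt0//.
by rewrite ge0_ler_powR ?nnegrE ?subr_ge0 ?lerD2l ?lerN2// ?ltW.
Qed.

Let klD x x' : x \in `[a, b] -> x' \in `[a, b] ->
  (\int[mu]_(t in `[a, b]) (`|kern c (x' - t) - kern c (x - t)|)%:E <=
    (kern_bound * `|x' - x| `^ (1 - c))%:E)%E.
Proof.
wlog : x x' / x <= x'.
  move=> H xab x'ab; have [|/ltW] := leP x x'; move=> /H; first exact.
  move=> /(_ x'ab xab) H2; rewrite distrC; apply: le_trans H2.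
  by under eq_integral do rewrite distrC.
rewrite !in_itv/= => xx' /andP[ax xb] /andP[ax' x'b].
rewrite ger0_norm ?subr_ge0//.
by rewrite (le_trans (integral_kern_diff_left _ _ _ _ _))// lee_fin kern_bound_mul.
Qed.

Let krD x x' : x \in `[a, b] -> x' \in `[a, b] ->
  (\int[mu]_(t in `[a, b]) (`|kern c (t - x') - kern c (t - x)|)%:E <=
    (kern_bound * `|x' - x| `^ (1 - c))%:E)%E.
Proof.
wlog : x x' / x <= x'.
  move=> H xab x'ab; have [|/ltW] := leP x x'; move=> /H; first exact.
  move=> /(_ x'ab xab) H2; rewrite distrC; apply: le_trans H2.
  by under eq_integral do rewrite distrC.
rewrite !in_itv/= => xx' /andP[ax xb] /andP[ax' x'b].
rewrite ger0_norm ?subr_ge0//.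
by rewrite (le_trans (integral_kern_diff_right _ _ _ _ _))// lee_fin kern_bound_mul.
Qed.

Lemma frac_left_integrable f x : bounded_measurable a b f -> x \in `[a, b] ->
  mu.-integrable `[a, b] (EFin \o (fun t => kern c (x - t) * f t)).
Proof.
move=> bf xab.
exact: (integrable_kernelM (fun x t => kern_ge0 c (x - t)) mkl klC bf xab).
Qed.

Lemma frac_right_integrable f x : bounded_measurable a b f -> x \in `[a, b] ->
  mu.-integrable `[a, b] (EFin \o (fun t => kern c (t - x) * f t)).
Proof.
move=> bf xab.
exact: (integrable_kernelM (fun x t => kern_ge0 c (t - x)) mkr krC bf xab).
Qed.

Lemma frac_left_dist (f : R -> R) M x x' : measurable_fun `[a, b] f ->
  (forall t, t \in `[a, b] -> `|f t| <= M) ->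
  x \in `[a, b] -> x' \in `[a, b] ->
  `|frac_left f x' - frac_left f x| <= M * (kern_bound * `|x' - x| `^ (1 - c)).
Proof.
exact: (kernel_integral_dist (fun x t => kern_ge0 c (x - t)) mkl klC klD).
Qed.

Lemma frac_right_dist (f : R -> R) M x x' : measurable_fun `[a, b] f ->
  (forall t, t \in `[a, b] -> `|f t| <= M) ->
  x \in `[a, b] -> x' \in `[a, b] ->
  `|frac_right f x' - frac_right f x| <= M * (kern_bound * `|x' - x| `^ (1 - c)).
Proof.
exact: (kernel_integral_dist (fun x t => kern_ge0 c (t - x)) mkr krC krD).
Qed.

Lemma frac_left_continuous f : bounded_measurable a b f ->
  {within `[a, b], continuous (frac_left f)}.
Proof.
exact: (kernel_integral_continuous (fun x t => kern_ge0 c (x - t)) r0 mkl klC klD).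
Qed.

Lemma frac_right_continuous f : bounded_measurable a b f ->
  {within `[a, b], continuous (frac_right f)}.
Proof.
exact: (kernel_integral_continuous (fun x t => kern_ge0 c (t - x)) r0 mkr krC krD).
Qed.

(** The summand 1 pays for [s = 0], where [kern] is 0 but the power equals 1 when [c = 0]. *)
Lemma powRN_kern_le s : 0 <= s -> s `^ (- c) <= kern c s + 1.
Proof.
rewrite /kern le_eqVlt => /predU1P[<-|s0]; last by rewrite s0 lerDl.
by rewrite ltxx add0r /powR eqxx lern1 leq_b1.
Qed.

(** The two integrands agree on [a, x[, may differ on the null set {x}, and [kern] vanishes beyond
    x. This links the operators of the statement to integrals over the fixed segment [a, b]. *)
Lemma RL_leftE f x : bounded_measurable a b f -> x \in `[a, b] ->
  mu.-integrable `[a, x] (EFin \o RL_left_integrand c f x) /\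
  RL_left_integral c a f x = frac_left f x.
Proof.
move=> bf xab; have [mf [M fM]] := bf; have M0 : 0 <= M by rewrite (le_trans _ (fM x xab)).
move: (xab); rewrite in_itv/= => /andP[ax xb].
have subx : `[a, x]%classic `<=` `[a, b]%classic.
  by move=> t /=; rewrite !in_itv/= => /andP[-> /le_trans]; exact.
have mx : measurable (`[a, x]%classic : set (measurableTypeR R)) by exact: measurable_itv.
have iRL : mu.-integrable `[a, x] (EFin \o RL_left_integrand c f x).
  have ig : mu.-integrable `[a, x] (EFin \o (fun t => M * (kern c (x - t) + 1))).
    have bM : bounded_measurable a b (cst M) by apply: within_continuous_bounded_measurable; exact: cst_continuous.
    have i1 := integrableS mab mx subx (frac_left_integrable bM xab).
    have i2 := integrableS mab mx subx (bounded_measurable_integrable bM).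
    have := integrableD mx i1 i2; apply: eq_integrable => // t _.
    by rewrite /= -EFinD mulrDr mulr1 (mulrC M).
  apply: le_integrable ig => //.
    apply/measurable_EFinP/measurable_funM; last exact: measurable_funS mf.
    apply: measurable_funTS; apply: (measurableT_comp (@measurable_powR R (- c))).
    exact: measurable_funB.
  move=> t tax; have tab := subx _ tax.
  move: tax; rewrite /= in_itv/= => /andP[_ tx].
  have xt0 : 0 <= x - t by rewrite subr_ge0.
  rewrite lee_fin /RL_left_integrand normrM mulrC.
  rewrite [leRHS]ger0_norm; last by rewrite mulr_ge0// addr_ge0// kern_ge0.
  rewrite ler_pM//; first exact: fM.
  by rewrite ger0_norm ?powR_ge0// powRN_kern_le.
split=> //; rewrite /RL_left_integral -Rintegral_itv_bndo_bndc; last first.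
  by apply: integrableS iRL => //; exact: subset_itv_co_cc.
have -> : `[a, x[%classic = `[a, b]%classic `&` `[a, x[%classic.
  rewrite setIidr//; apply: subset_trans subx; exact: subset_itv_co_cc.
rewrite Rintegral_mkcondr; apply: eq_Rintegral => t.
rewrite inE/= in_itv/= => /andP[at_ tb].
rewrite patchE; case: ifPn.
  by rewrite inE/= in_itv/= at_/= /RL_left_integrand /kern subr_gt0 => ->.
rewrite notin_setE/= in_itv/= at_/= => /negP/negbTE tx.
by rewrite /kern subr_gt0 tx mul0r.
Qed.

Lemma RL_rightE f x : bounded_measurable a b f -> x \in `[a, b] ->
  mu.-integrable `[x, b] (EFin \o RL_right_integrand c f x) /\
  RL_right_integral c b f x = frac_right f x.
Proof.
move=> bf xab; have [mf [M fM]] := bf; have M0 : 0 <= M by rewrite (le_trans _ (fM x xab)).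
move: (xab); rewrite in_itv/= => /andP[ax xb].
have subx : `[x, b]%classic `<=` `[a, b]%classic.
  by move=> t /=; rewrite !in_itv/= => /andP[/(le_trans ax) -> ->].
have mx : measurable (`[x, b]%classic : set (measurableTypeR R)) by exact: measurable_itv.
have iRL : mu.-integrable `[x, b] (EFin \o RL_right_integrand c f x).
  have ig : mu.-integrable `[x, b] (EFin \o (fun t => M * (kern c (t - x) + 1))).
    have bM : bounded_measurable a b (cst M) by apply: within_continuous_bounded_measurable; exact: cst_continuous.
    have i1 := integrableS mab mx subx (frac_right_integrable bM xab).
    have i2 := integrableS mab mx subx (bounded_measurable_integrable bM).
    have := integrableD mx i1 i2; apply: eq_integrable => // t _.
    by rewrite /= -EFinD mulrDr mulr1 (mulrC M).
  apply: le_integrable ig => //.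
    apply/measurable_EFinP/measurable_funM; last exact: measurable_funS mf.
    apply: measurable_funTS; apply: (measurableT_comp (@measurable_powR R (- c))).
    exact: measurable_funB.
  move=> t tax; have tab := subx _ tax.
  move: tax; rewrite /= in_itv/= => /andP[tx _].
  have xt0 : 0 <= t - x by rewrite subr_ge0.
  rewrite lee_fin /RL_right_integrand normrM mulrC.
  rewrite [leRHS]ger0_norm; last by rewrite mulr_ge0// addr_ge0// kern_ge0.
  rewrite ler_pM//; first exact: fM.
  by rewrite ger0_norm ?powR_ge0// powRN_kern_le.
split=> //; rewrite /RL_right_integral -Rintegral_itv_obnd_cbnd; last first.
  by apply: integrableS iRL => //; exact: subset_itv_oc_cc.
have -> : `]x, b]%classic = `[a, b]%classic `&` `]x, b]%classic.
  rewrite setIidr//; apply: subset_trans subx; exact: subset_itv_oc_cc.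
rewrite Rintegral_mkcondr; apply: eq_Rintegral => t.
rewrite inE/= in_itv/= => /andP[at_ tb].
rewrite patchE; case: ifPn.
  by rewrite inE/= in_itv/= tb andbT /RL_right_integrand /kern subr_gt0 => ->.
rewrite notin_setE/= in_itv/= tb andbT => /negP/negbTE tx.
by rewrite /kern subr_gt0 tx mul0r.
Qed.

Lemma bounded_measurable_norm f : bounded_measurable a b f ->
  bounded_measurable a b (fun x => `|f x|).
Proof.
move=> [mf [M fM]]; split; first exact: measurableT_comp.
by exists M => t tab; rewrite normr_id fM.
Qed.

(** One of the two inner integrals for integration by parts. Both functions are extended by 0 so
    that Fubini's theorem applies on the whole plane. *)
Lemma frac_left_inner (f g : R -> R) x : bounded_measurable a b g ->
  (\int[mu]_t ((f \_ `[a, b]) x * kern c (x - t) * (g \_ `[a, b]) t)%:E =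
  (((fun x => f x * frac_left g x) \_ `[a, b]) x)%:E)%E.
Proof.
move=> bg; rewrite [in RHS]patchE; case: ifPn => xab; last first.
  by rewrite integral0_eq// => t _; rewrite [(f \_ _) x]patchE (negbTE xab) !mul0r.
move: (xab); rewrite inE/= => xab'.
transitivity (\int[mu]_(t in `[a, b]) ((f x)%:E * (kern c (x - t) * g t)%:E))%E.
  rewrite [RHS]integral_mkcond; apply: eq_integral => t _.
  rewrite [in RHS]patchE ![(_ \_ _) _]patchE xab; case: ifPn => _; rewrite ?mulr0//.
  by rewrite -EFinM mulrA.
rewrite integralZl//; last exact: frac_left_integrable.
rewrite EFinM /frac_left /kernel_integral /Rintegral fineK//.
by apply: integrable_fin_num => //; exact: frac_left_integrable.
Qed.

Lemma frac_right_inner (f g : R -> R) t : bounded_measurable a b f ->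
  (\int[mu]_x ((f \_ `[a, b]) x * kern c (x - t) * (g \_ `[a, b]) t)%:E =
  (((fun x => g x * frac_right f x) \_ `[a, b]) t)%:E)%E.
Proof.
move=> bg; rewrite [in RHS]patchE; case: ifPn => tab; last first.
  by rewrite integral0_eq// => x _; rewrite [(g \_ _) t]patchE (negbTE tab) mulr0.
move: (tab); rewrite inE/= => tab'.
transitivity (\int[mu]_(x in `[a, b]) ((g t)%:E * (kern c (x - t) * f x)%:E))%E.
  rewrite [RHS]integral_mkcond; apply: eq_integral => x _.
  rewrite [in RHS]patchE ![(_ \_ _) _]patchE tab; case: ifPn => _; rewrite ?mul0r//.
  by rewrite -EFinM; congr EFin; ring.
rewrite integralZl//; last exact: frac_right_integrable.
rewrite EFinM /frac_right /kernel_integral /Rintegral fineK//.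
by apply: integrable_fin_num => //; exact: frac_right_integrable.
Qed.

(** Fubini's theorem for f(x) kern(x - t) g(t): integrating in t gives a left integral of g,
    integrating in x a right integral of f. Integrability comes from Tonelli's theorem, because |f|
    times the left integral of |g| is bounded on [a, b]. *)
Lemma frac_integration_by_parts f g :
  bounded_measurable a b f -> bounded_measurable a b g ->
  \int[mu]_(x in `[a, b]) (f x * frac_left g x) =
  \int[mu]_(x in `[a, b]) (g x * frac_right f x).
Proof.
move=> bf bg; have [[mf [M fM]] [mg [M' gM]]] := (bf, bg).
pose f_ := f \_ `[a, b]; pose g_ := g \_ `[a, b].
have mf_ : measurable_fun [set: R] f_ by apply/(measurable_restrictT _ _).1.
have mg_ : measurable_fun [set: R] g_ by apply/(measurable_restrictT _ _).1.
pose Psi (z : measurableTypeR R * measurableTypeR R) := (f_ z.1 * kern c (z.1 - z.2) * g_ z.2)%:E.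
have mPsi : measurable_fun setT Psi.
  apply/measurable_EFinP; apply: measurable_funM; first apply: measurable_funM.
  - exact: (measurableT_comp mf_ measurable_fst).
  - apply: (measurableT_comp (measurable_kern c)).
    by apply: measurable_funB; [exact: measurable_fst|exact: measurable_snd].
  - exact: (measurableT_comp mg_ measurable_snd).
have iPsi : (mu \x mu)%E.-integrable setT Psi.
  apply/integrable12ltyP => //.
  have bf' := bounded_measurable_norm bf; have bg' := bounded_measurable_norm bg.
  have bfg := bounded_measurableM bf' (within_continuous_bounded_measurable (frac_left_continuous bg')).
  have := bounded_measurable_integrable bfg => /integrableP[_].
  apply: le_lt_trans; rewrite [leRHS]integral_mkcond.
  apply: ge0_le_integral => //.
  - by move=> x _; apply: integral_ge0.
  - apply: (measurable_fun_fubini_tonelli_F (abse \o Psi)) => //=.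
    exact: measurableT_comp.
  - apply/(measurable_restrictT _ _).1 => //; apply: measurableT_comp => //.
    by apply/measurable_EFinP; case: bfg.
  move=> x _; rewrite [leLHS](_ : _ = 
   \int[mu]_t (((fun x => `|f x|) \_ `[a, b]) x * kern c (x - t) * ((fun x => `|g x|) \_ `[a, b]) t)%:E)%E.
    rewrite frac_left_inner// !patchE; case: ifPn => //= _.
    by rewrite lee_fin ler_norm.
  apply: eq_integral => t _; rewrite /Psi/= !normrM (ger0_norm (kern_ge0 _ _)).
  by rewrite /f_ /g_ !patchE; congr (_ * _ * _)%:E; case: ifPn => //; rewrite normr0.
have := Fubini iPsi.
rewrite /Rintegral => H; congr fine.
rewrite [LHS]integral_mkcond [RHS]integral_mkcond.
transitivity (\int[mu]_x \int[mu]_y Psi (x, y))%E.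
  apply: eq_integral => x _; rewrite [RHS]frac_left_inner//.
  by rewrite !patchE; case: ifPn.
rewrite H; apply: eq_integral => t _; rewrite [LHS]frac_right_inner//.
by rewrite !patchE; case: ifPn.
Qed.
End fractional_integrals.

Section measurable_derivable.
Context {R : realType}.

(** Derivability at x is the Cauchy condition for the difference quotients as the increment tends to
    0. For fixed n and m it is an intersection of closed conditions, hence closed even though the
    increments h and k range over an uncountable set. *)
Lemma measurable_derivable (f : R -> R) : continuous f ->
  measurable [set x : R | derivable f x 1].
Proof.
move=> cf.
pose DQ (h x : R) : R := h^-1 *: ((f \o shift x) (h *: (1 : R)) - f x).
have cDQ h : continuous (DQ h).
  move=> x; apply: cvgM; first exact: cvg_cst.
  apply: cvgB; last exact: cf.
  apply: (@cvg_comp _ _ _ (fun x => h *: (1 : R) + x) f _ _ _ _ (cf _)).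
  by apply: cvgD; [exact: cvg_cst|exact: cvg_id].
pose P m : set (R * R) := [set hk | [/\ hk.1 != 0, hk.2 != 0,
  `|hk.1| < m.+1%:R^-1 & `|hk.2| < m.+1%:R^-1]].
pose S n m : set R := \bigcap_(hk in P m)
  [set x | `|DQ hk.1 x - DQ hk.2 x| <= n.+1%:R^-1].
have SE : [set x : R | derivable f x 1] = \bigcap_n \bigcup_m S n m.
  apply/seteqP; split=> x.
    move=> /= /cvg_ex[l /cvgrPdist_lt Hl] n _.
    have e0 : 0 < (n.+1%:R : R)^-1 / 2 by rewrite divr_gt0// invr_gt0.
    have := Hl _ e0; rewrite near_withinE => /nbhs_ballP[d /= d0 Hd].
    have [m md] : exists m : nat, m.+1%:R^-1 < d.
      have [m _ Hm] := near_infty_natSinv_lt (PosNum d0).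
      by exists m; exact: (Hm m (leqnn m)).
    exists m => // -[h k] [/= h0 k0 hm km].
    have hd : ball 0 d h by rewrite /ball/= sub0r normrN (lt_trans hm).
    have kd : ball 0 d k by rewrite /ball/= sub0r normrN (lt_trans km).
    have := Hd h hd h0; have := Hd k kd k0.
    rewrite -/(DQ h x) -/(DQ k x) => H1 H2.
    have -> : DQ h x - DQ k x = (l - DQ k x) - (l - DQ h x) by ring.
    rewrite (le_trans (ler_normB _ _))// (splitr (_^-1)) lerD// ltW//.
  move=> H /=; apply: cauchy_cvg; apply: cauchy_exP => e e0.
  have [n _ Hn] := near_infty_natSinv_lt (PosNum e0).
  have {Hn}ne := Hn n (leqnn n).
  have [m _ Hm] := H n I.
  pose h0 : R := m.+1%:R^-1 / 2.
  have m0 : 0 < (m.+1%:R : R)^-1 by rewrite invr_gt0.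
  have h00 : 0 < h0 by rewrite divr_gt0.
  have h0m : h0 < m.+1%:R^-1 by rewrite /h0 ltr_pdivrMr// ltr_pMr// ltr1n.
  exists (DQ h0 x); apply/nbhs_ballP; exists (m.+1%:R^-1) => //= h.
  rewrite /ball/= sub0r normrN => hm hn0.
  apply: le_lt_trans ne; apply: (Hm (h0, h)); split => //=.
  - by rewrite gt_eqF.
  - by rewrite gtr0_norm.
rewrite SE; apply: bigcapT_measurable => n; apply: bigcupT_measurable => m.
apply: closed_measurable; apply: closed_bigI => -[h k] _ /=.
apply: (@closed_comp _ _ (fun x => `|DQ h x - DQ k x|) [set y | y <= n.+1%:R^-1]); last exact: closed_le.
move=> x _; apply: cvg_norm; apply: cvgB; exact: cDQ.
Qed.

End measurable_derivable.

Section primitive.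
Context {R : realType}.
Notation mu := (@lebesgue_measure R).
Variables (a b : R).
Hypothesis ab : a < b.

Let mab : measurable (`[a, b]%classic : set (measurableTypeR R)).
Proof. exact: measurable_itv. Qed.

Definition primitive_of (phi eta : R -> R) :=
  {within `[a, b], continuous phi} /\
  forall x, x \in `[a, b] -> eta x = \int[mu]_(t in `[a, x]) phi t.

Lemma subset_itv_left x : x \in `[a, b] -> `[a, x]%classic `<=` `[a, b]%classic.
Proof.
rewrite in_itv/= => /andP[_ xb] t /=.
by rewrite !in_itv/= => /andP[-> /le_trans]; exact.
Qed.

Lemma within_continuous_integrable phi x : {within `[a, b], continuous phi} ->
  x \in `[a, b] -> mu.-integrable `[a, x] (EFin \o phi).
Proof.
move=> cphi xab; apply: (integrableS mab) (subset_itv_left xab) _ => //.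
exact/bounded_measurable_integrable/within_continuous_bounded_measurable.
Qed.

Lemma primitive_ofZ k phi eta : primitive_of phi eta ->
  primitive_of (fun x => k * phi x) (k \*: eta).
Proof.
move=> [cphi etaE]; split.
  by move=> x; apply: cvgM; [exact: cvg_cst|exact: cphi].
move=> x xab; rewrite RintegralZl//; last exact: within_continuous_integrable.
by rewrite -etaE.
Qed.

Lemma primitive_ofD phi eta phi' eta' : primitive_of phi eta ->
  primitive_of phi' eta' ->
  primitive_of (fun x => phi x + phi' x) (eta \+ eta').
Proof.
move=> [cphi etaE] [cphi' etaE']; split.
  by move=> x; apply: cvgD; [exact: cphi|exact: cphi'].
move=> x xab; rewrite RintegralD//; try exact: within_continuous_integrable.
by rewrite -etaE// -etaE'.
Qed.

Section one_primitive.
Variables (phi eta : R -> R).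
Hypothesis pe : primitive_of phi eta.

Let bphi : bounded_measurable a b phi.
Proof. by apply: within_continuous_bounded_measurable; case: pe. Qed.

Lemma primitive_frac x : x \in `[a, b] -> eta x = frac_left a b 0 phi x.
Proof.
move=> xab; rewrite pe.2//; have [_ <-] := RL_leftE ab (lexx 0) ltr01 bphi xab.
by apply: eq_Rintegral => t _; rewrite /RL_left_integrand oppr0 powRr0 mul1r.
Qed.

Lemma primitive_left : eta a = 0.
Proof.
by rewrite pe.2 ?in_itv/= ?lexx ?ltW// set_itv1 Rintegral_set1.
Qed.

Lemma primitive_is_derive x : x \in `]a, b[ -> is_derive x (1 : R) eta (phi x).
Proof.
move=> xab; have xab' := subset_itv_oo_cc xab.
have [ax xb] : a < x /\ x < b by move: xab; rewrite in_itv/= => /andP.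
have bab : b \in `[a, b] by rewrite in_itv/= lexx ltW.
have cx : {for x, continuous phi}.
  by have /(continuous_within_itvP phi ab)[+ _ _] := pe.1; exact.
have [dF F'] := continuous_FTC1_closed xb (within_continuous_integrable pe.1 bab) ax cx.
have DF : is_derive x (1 : R) (fun x => \int[mu]_(t in `[a, x]) phi t) (phi x).
  by apply: (DeriveDef dF); rewrite -derive1E; exact: F'.
apply: near_eq_is_derive DF.
have : \forall z \near x, z \in `]a, b[ by exact: near_in_itvoo.
apply: filterS => z zab; rewrite pe.2//; exact: subset_itv_oo_cc zab.
Qed.

(** At order 0 the Hoelder estimate of fractional integrals is a Lipschitz estimate. *)
Lemma primitive_abs_continuous : abs_continuous a b eta.
Proof.
have [mphi [M phiM]] := bphi.
have aab : a \in `[a, b] by rewrite in_itv/= lexx ltW.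
have M0 : 0 <= M by rewrite (le_trans _ (phiM a aab)).
pose C := M * kern_bound a b 0.
have lip u v : u \in `[a, b] -> v \in `[a, b] -> `|eta v - eta u| <= C * `|v - u|.
  move=> uab vab; rewrite !primitive_frac// /C -mulrA.
  have := frac_left_dist ab (lexx 0) ltr01 mphi phiM uab vab.
  by rewrite subr0 powRr1.
move=> e e0.
have C1 : 0 < `|C| + 1 by rewrite ltr_wpDl.
exists (e / (`|C| + 1)); first by rewrite divr_gt0.
move=> n u v uv _; rewrite ltr_pdivlMr// => sum_lt.
apply: le_lt_trans sum_lt; rewrite mulr_suml; apply: ler_sum => i _.
have [au uiv vb] := uv i.
rewrite (le_trans (lip _ _ _ _))// ?in_itv/= ?au ?vb ?(le_trans uiv)// ?(le_trans au)//.
rewrite ger0_norm ?subr_ge0// mulrC ler_wpM2l ?subr_ge0//.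
by rewrite (le_trans (ler_norm _))// lerDl.
Qed.

End one_primitive.

End primitive.

Section open_closed_itv.
Context {R : realType}.
Notation mu := (@lebesgue_measure R).

Lemma integrable_itv_oo_cc (p q : R) (f : R -> R) :
  mu.-integrable `]p, q[ (EFin \o f) -> mu.-integrable `[p, q] (EFin \o f).
Proof.
move=> /integrableP[mf foo]; apply/integrableP; split.
  exact: emeasurable_fun_itv_cc mf.
rewrite integral_itv_bndoo//; exact: measurableT_comp.
Qed.

Lemma Rintegral_itv_oo_cc (p q : R) (f : R -> R) :
  measurable_fun `]p, q[ f ->
  \int[mu]_(x in `[p, q]) f x = \int[mu]_(x in `]p, q[) f x.
Proof.
by move=> mf; rewrite /Rintegral integral_itv_bndoo//; exact/measurable_EFinP.
Qed.

End open_closed_itv.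

(** * Variations in the function space *)

Section variation.
Context {R : realType}.
Notation mu := (@lebesgue_measure R).
Variables (a b : R) (y phi eta : R -> R).
Hypotheses (ab : a < b) (acy : abs_continuous a b y) (pe : primitive_of a b phi eta).

Let mab : measurable (`[a, b]%classic : set (measurableTypeR R)).
Proof. exact: measurable_itv. Qed.

Let D := [set x : R | derivable (y \o clamp a b) x 1].
(* [derive1] takes the same junk value at all points of non-derivability, and
   y + eta is derivable exactly where y is; hence [derive1 (y + eta)] is [derive1 y] plus this
   density everywhere inside [a, b], and not only almost everywhere. *)
Definition trimmed_density := phi \_ D.

Let mD : measurable D.
Proof.
apply: measurable_derivable; apply: continuous_clamp; first exact: ltW.
exact: abs_continuous_continuous.
Qed.

Let clamp_near x : x \in `]a, b[ -> {near x, y \o clamp a b =1 y}.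
Proof.
move=> xab; have : \forall z \near x, z \in `]a, b[ by exact: near_in_itvoo.
by apply: filterS => z /subset_itv_oo_cc zab /=; rewrite clamp_id.
Qed.

Let derivableD x : x \in `]a, b[ -> D x <-> derivable y x 1.
Proof.
move=> xab; split; apply: near_eq_derivable; first exact: clamp_near.
by apply: filterS (clamp_near xab) => z.
Qed.

Let bphi : bounded_measurable a b phi.
Proof. by apply: within_continuous_bounded_measurable; case: pe. Qed.

Lemma bounded_measurable_trimmed : bounded_measurable a b trimmed_density.
Proof. exact: bounded_measurable_indic. Qed.

(** The endpoints are discarded separately, since derivability almost everywhere is known only
    inside [a, b]. *)
Lemma trimmed_ae_eq : {ae mu, forall x, `[a, b]%classic x -> trimmed_density x = phi x}.
Proof.
have N1 := abs_continuous_derivable_ae ab acy.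
have N2 (z : R) : mu.-negligible [set z].
  by exists [set z]; split=> //; exact: lebesgue_measure_set1.
apply: negligibleS (negligibleU N1 (negligibleU (N2 a) (N2 b))) => x /=.
move=> /not_implyP[xab nx].
have [xa|xa] := eqVneq x a; first by right; left.
have [xb|xb] := eqVneq x b; first by right; right.
have xab' : x \in `]a, b[.
  by move: xab; rewrite !in_itv/= !lt_neqAle eq_sym xa xb => /andP[-> ->].
left => /(_ xab') dx; have Dx := (derivableD xab').2 dx; apply: nx.
by rewrite /trimmed_density patchE mem_set.
Qed.

Lemma derive1_add_primitive x : x \in `]a, b[ ->
  derive1 (y \+ eta) x = derive1 y x + trimmed_density x.
Proof.
move=> xab; have De := primitive_is_derive ab pe xab.
have dn (g : R -> R) : ~ derivable g x 1 -> derive1 g x = point.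
  by rewrite derive1E => H; exact: dvgP.
rewrite /trimmed_density patchE; case: ifPn => [|].
  rewrite inE => /derivableD-/(_ xab) dy.
  have [deta etaE] := De.
  by rewrite !derive1E (deriveD dy deta) etaE.
rewrite notin_setE => nD.
have ny : ~ derivable y x 1.
  by move=> dy; apply: nD; exact: ((derivableD xab).2 dy).
rewrite (dn y ny) addr0; apply: dn => dye; apply: ny.
have [deta _] := De.
have E : (y \+ eta) - eta = y by apply/funext => z; exact: addrK.
have H := derivableB dye deta.
rewrite E in H.
exact H.
Qed.

Section caputo.
Variable c : R.
Hypotheses (c0 : 0 < c) (c1 : c < 1).

Let c0' : 0 <= c. Proof. exact: ltW. Qed.

Lemma trimmed_frac_left x : x \in `[a, b] ->
  frac_left a b c trimmed_density x = frac_left a b c phi x.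
Proof.
move=> xab; rewrite /frac_left /kernel_integral /Rintegral; congr fine.
have [i1 i2] := (frac_left_integrable ab c0' c1 bounded_measurable_trimmed xab,
                 frac_left_integrable ab c0' c1 bphi xab).
apply: ae_eq_integral => //.
- exact: measurable_int i1.
- exact: measurable_int i2.
apply: negligibleS trimmed_ae_eq => t /= /not_implyP[tab H].
by apply/not_implyP; split=> // E; apply: H; rewrite E.
Qed.

Lemma trimmed_frac_right x : x \in `[a, b] ->
  frac_right a b c trimmed_density x = frac_right a b c phi x.
Proof.
move=> xab; rewrite /frac_right /kernel_integral /Rintegral; congr fine.
have [i1 i2] := (frac_right_integrable ab c0' c1 bounded_measurable_trimmed xab,
                 frac_right_integrable ab c0' c1 bphi xab).
apply: ae_eq_integral => //.
- exact: measurable_int i1.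
- exact: measurable_int i2.
apply: negligibleS trimmed_ae_eq => t /= /not_implyP[tab H].
by apply/not_implyP; split=> // E; apply: H; rewrite E.
Qed.

(** At a and b the value of [derive1] depends on values outside [a, b], so the sum formula holds
    only inside. Integrability and integrals are transferred through the open interval, which
    differs by a null set. *)
Lemma RL_left_add_primitive x : x \in `]a, b] ->
  mu.-integrable `[a, x] (EFin \o RL_left_integrand c (derive1 y) x) ->
  mu.-integrable `[a, x] (EFin \o RL_left_integrand c (derive1 (y \+ eta)) x) /\
  RL_left_integral c a (derive1 (y \+ eta)) x =
  RL_left_integral c a (derive1 y) x + frac_left a b c phi x.
Proof.
move=> xab iy; have xab' := subset_itv_oc_cc xab.
have [it RLt] := RL_leftE ab c0' c1 bounded_measurable_trimmed xab'.
have mo : measurable (`]a, x[%classic : set (measurableTypeR R)) by exact: measurable_itv.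
have mx : measurable (`[a, x]%classic : set (measurableTypeR R)) by exact: measurable_itv.
have sub : `]a, x[%classic `<=` `[a, x]%classic by exact: subset_itv_oo_cc.
have E : {in `]a, x[%classic, (fun t => RL_left_integrand c (derive1 y) x t +
    RL_left_integrand c trimmed_density x t) =1 RL_left_integrand c (derive1 (y \+ eta)) x}.
  move=> t; rewrite inE/= => tax; rewrite /RL_left_integrand derive1_add_primitive ?mulrDr//.
  move: tax xab; rewrite !in_itv/= => /andP[-> tx] /andP[_ xb].
  exact: lt_le_trans xb.
have isum : mu.-integrable `[a, x] (EFin \o (fun t => RL_left_integrand c (derive1 y) x t +
    RL_left_integrand c trimmed_density x t)).
  by have := integrableD mx iy it; apply: eq_integrable.
have io : mu.-integrable `]a, x[ (EFin \o RL_left_integrand c (derive1 (y \+ eta)) x).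
  have := integrableS mx mo sub isum; apply: eq_integrable => // t tax.
  by rewrite /= E.
split; first exact: integrable_itv_oo_cc.
rewrite -trimmed_frac_left// -RLt /RL_left_integral -RintegralD//.
rewrite !Rintegral_itv_oo_cc; first by apply: eq_Rintegral => t tax; rewrite E.
- by apply/measurable_EFinP; apply: measurable_int (integrableS mx mo sub isum).
- by apply/measurable_EFinP; apply: measurable_int io.
Qed.

Lemma RL_right_add_primitive x : x \in `[a, b[ ->
  mu.-integrable `[x, b] (EFin \o RL_right_integrand c (derive1 y) x) ->
  mu.-integrable `[x, b] (EFin \o RL_right_integrand c (derive1 (y \+ eta)) x) /\
  RL_right_integral c b (derive1 (y \+ eta)) x =
  RL_right_integral c b (derive1 y) x + frac_right a b c phi x.
Proof.
move=> xab iy; have xab' := subset_itv_co_cc xab.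
have [it RLt] := RL_rightE ab c0' c1 bounded_measurable_trimmed xab'.
have mo : measurable (`]x, b[%classic : set (measurableTypeR R)) by exact: measurable_itv.
have mx : measurable (`[x, b]%classic : set (measurableTypeR R)) by exact: measurable_itv.
have sub : `]x, b[%classic `<=` `[x, b]%classic by exact: subset_itv_oo_cc.
have E : {in `]x, b[%classic, (fun t => RL_right_integrand c (derive1 y) x t +
    RL_right_integrand c trimmed_density x t) =1 RL_right_integrand c (derive1 (y \+ eta)) x}.
  move=> t; rewrite inE/= => tax; rewrite /RL_right_integrand derive1_add_primitive ?mulrDr//.
  move: tax xab; rewrite !in_itv/= => /andP[xt ->] /andP[ax _].
  by rewrite (le_lt_trans ax).
have isum : mu.-integrable `[x, b] (EFin \o (fun t => RL_right_integrand c (derive1 y) x t +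
    RL_right_integrand c trimmed_density x t)).
  by have := integrableD mx iy it; apply: eq_integrable.
have io : mu.-integrable `]x, b[ (EFin \o RL_right_integrand c (derive1 (y \+ eta)) x).
  have := integrableS mx mo sub isum; apply: eq_integrable => // t tax.
  by rewrite /= E.
split; first exact: integrable_itv_oo_cc.
rewrite -trimmed_frac_right// -RLt /RL_right_integral -RintegralD//.
rewrite !Rintegral_itv_oo_cc; first by apply: eq_Rintegral => t tax; rewrite E.
- by apply/measurable_EFinP; apply: measurable_int (integrableS mx mo sub isum).
- by apply/measurable_EFinP; apply: measurable_int io.
Qed.

End caputo.

End variation.

Section caputo_variation.
Context {R : realType}.
Notation mu := (@lebesgue_measure R).
Variables (a b : R).
Hypothesis (ab : a < b).

Lemma eq_within_continuous (f g : R -> R) (A : set R) :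
  (forall x, A x -> f x = g x) -> {within A, continuous f} -> {within A, continuous g}.
Proof.
move=> fg /within_continuous_distP cf; apply/within_continuous_distP => x Ax e e0.
have [d d0 Hd] := cf x Ax e e0; exists d => // z Az zx.
by rewrite -!fg//; exact: Hd.
Qed.

Lemma frac_left_a c phi : frac_left a b c phi a = 0.
Proof.
rewrite /frac_left /kernel_integral /Rintegral integral0_eq// => t /=.
by rewrite in_itv/= => /andP[at_ _]; rewrite /kern subr_gt0 ltNge at_/= mul0r.
Qed.

Lemma frac_right_b c phi : frac_right a b c phi b = 0.
Proof.
rewrite /frac_right /kernel_integral /Rintegral integral0_eq// => t /=.
by rewrite in_itv/= => /andP[_ tb]; rewrite /kern subr_gt0 ltNge tb/= mul0r.
Qed.

Section one_order.
Variables (y phi eta : R -> R) (c : R).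
Hypotheses (acy : abs_continuous a b y) (pe : primitive_of a b phi eta).
Hypotheses (c0 : 0 < c) (c1 : c < 1).

Let bphi : bounded_measurable a b phi.
Proof. by apply: within_continuous_bounded_measurable; case: pe. Qed.

Let aab : a \in `[a, b]. Proof. by rewrite in_itv/= lexx ltW. Qed.
Let bab : b \in `[a, b]. Proof. by rewrite in_itv/= lexx ltW. Qed.

(** The fractional integral of phi tends to 0 at a, so the limit that defines the Caputo derivative
    at a is unchanged, in agreement with the formula. *)
Lemma caputo_left_add_primitive : caputo_left_ex c a b y ->
  caputo_left_ex c a b (y \+ eta) /\
  forall x, x \in `[a, b] -> caputo_left c a (y \+ eta) x =
    caputo_left c a y x + (Gamma (1 - c))^-1 * frac_left a b c phi x.
Proof.
move=> [iy cy].
have formulaE x : x \in `]a, b] -> caputo_left_formula c a (y \+ eta) x =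
    caputo_left_formula c a y x + (Gamma (1 - c))^-1 * frac_left a b c phi x.
  move=> xab; rewrite /caputo_left_formula.
  by have [_ ->] := RL_left_add_primitive ab acy pe c0 c1 xab (iy x xab); rewrite mulrDr.
have cfrac : frac_left a b c phi t @[t --> a^'+] --> 0.
  have /(continuous_within_itvP _ ab)[_ + _] := frac_left_continuous ab (ltW c0) c1 bphi.
  by rewrite frac_left_a.
have cfor : caputo_left_formula c a (y \+ eta) t @[t --> a^'+] -->
    lim (caputo_left_formula c a y t @[t --> a^'+]).
  have : caputo_left_formula c a y t + (Gamma (1 - c))^-1 * frac_left a b c phi t @[t --> a^'+] -->
    lim (caputo_left_formula c a y t @[t --> a^'+]) + (Gamma (1 - c))^-1 * 0.
    by apply: cvgD => //; apply: cvgM; [exact: cvg_cst|exact: cfrac].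
  rewrite mulr0 addr0; apply: cvg_trans; apply: near_eq_cvg.
  near=> t; apply: esym; apply: formulaE; rewrite in_itv/=; apply/andP; split.
    by near: t; exact: nbhs_right_gt.
  by near: t; exact: nbhs_right_le.
split.
  split; last by apply/cvg_ex; eexists; exact: cfor.
  by move=> x xab; have [] := RL_left_add_primitive ab acy pe c0 c1 xab (iy x xab).
move=> x xab; rewrite /caputo_left; case: eqVneq => [->|xa].
  rewrite frac_left_a mulr0 addr0; exact: cvg_lim.
apply: formulaE; move: xab; rewrite !in_itv/= => /andP[ax ->].
by rewrite lt_neqAle eq_sym xa ax.
Unshelve. all: by end_near. Qed.

Lemma caputo_right_add_primitive : caputo_right_ex c a b y ->
  caputo_right_ex c a b (y \+ eta) /\
  forall x, x \in `[a, b] -> caputo_right c b (y \+ eta) x =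
    caputo_right c b y x + - (Gamma (1 - c))^-1 * frac_right a b c phi x.
Proof.
move=> [iy cy].
have formulaE x : x \in `[a, b[ -> caputo_right_formula c b (y \+ eta) x =
    caputo_right_formula c b y x + - (Gamma (1 - c))^-1 * frac_right a b c phi x.
  move=> xab; rewrite /caputo_right_formula.
  by have [_ ->] := RL_right_add_primitive ab acy pe c0 c1 xab (iy x xab); rewrite mulrDr.
have cfrac : frac_right a b c phi t @[t --> b^'-] --> 0.
  have /(continuous_within_itvP _ ab)[_ _ +] := frac_right_continuous ab (ltW c0) c1 bphi.
  by rewrite frac_right_b.
have cfor : caputo_right_formula c b (y \+ eta) t @[t --> b^'-] -->
    lim (caputo_right_formula c b y t @[t --> b^'-]).
  have : caputo_right_formula c b y t + - (Gamma (1 - c))^-1 * frac_right a b c phi t @[t --> b^'-] -->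
    lim (caputo_right_formula c b y t @[t --> b^'-]) + - (Gamma (1 - c))^-1 * 0.
    by apply: cvgD => //; apply: cvgM; [exact: cvg_cst|exact: cfrac].
  rewrite mulr0 addr0; apply: cvg_trans; apply: near_eq_cvg.
  near=> t; apply: esym; apply: formulaE; rewrite in_itv/=; apply/andP; split.
    by near: t; exact: nbhs_left_ge.
  by near: t; exact: nbhs_left_lt.
split.
  split; last by apply/cvg_ex; eexists; exact: cfor.
  by move=> x xab; have [] := RL_right_add_primitive ab acy pe c0 c1 xab (iy x xab).
move=> x xab; rewrite /caputo_right; case: eqVneq => [->|xb].
  rewrite frac_right_b mulr0 addr0; exact: cvg_lim.
apply: formulaE; move: xab; rewrite !in_itv/= => /andP[-> bx].
by rewrite lt_neqAle xb bx.
Unshelve. all: by end_near. Qed.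

End one_order.

Lemma abs_continuousD f g : abs_continuous a b f -> abs_continuous a b g ->
  abs_continuous a b (f \+ g).
Proof.
move=> acf acg e e0; have e20 : 0 < e / 2 by rewrite divr_gt0.
have [d1 d10 H1] := acf _ e20; have [d2 d20 H2] := acg _ e20.
exists (Num.min d1 d2); first by rewrite lt_min d10.
move=> n u v uv tuv; rewrite lt_min => /andP[/(H1 n u v uv tuv) h1 /(H2 n u v uv tuv) h2].
rewrite (splitr e); apply: le_lt_trans (ltrD h1 h2).
rewrite -big_split/=; apply: ler_sum => i _.
by rewrite opprD addrACA ler_normD.
Qed.

Variables (alpha beta : R).
Hypotheses (al0 : 0 < alpha) (al1 : alpha < 1) (be0 : 0 < beta) (be1 : beta < 1).

Lemma fracE_add_primitive y phi eta :
  fracE alpha beta a b y -> primitive_of a b phi eta ->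
  fracE alpha beta a b (y \+ eta).
Proof.
move=> [acy cly ccl cry ccr] pe.
have bphi : bounded_measurable a b phi.
  by apply: within_continuous_bounded_measurable; case: pe.
have [cle clE] := caputo_left_add_primitive acy pe al0 al1 cly.
have [cre crE] := caputo_right_add_primitive acy pe be0 be1 cry.
split.
- exact: abs_continuousD acy (primitive_abs_continuous ab pe).
- exact: cle.
- apply: (@eq_within_continuous (fun x => caputo_left alpha a y x + (Gamma (1 - alpha))^-1 * frac_left a b alpha phi x)).
    by move=> x xab; apply: esym; exact: clE.
  have cf := frac_left_continuous ab (ltW al0) al1 bphi.
  move=> x; apply: cvgD; first exact: ccl.
  by apply: cvgM; [exact: cvg_cst|exact: cf].
- exact: cre.
- apply: (@eq_within_continuous (fun x => caputo_right beta b y x + - (Gamma (1 - beta))^-1 * frac_right a b beta phi x)).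
    by move=> x xab; apply: esym; exact: crE.
  have cf := frac_right_continuous ab (ltW be0) be1 bphi.
  move=> x; apply: cvgD; first exact: ccr.
  by apply: cvgM; [exact: cvg_cst|exact: cf].
Qed.

(** Starting from zero, [fracE_add_primitive] puts the primitives themselves in the space; the norm
    axioms are applied to them later. *)
Lemma fracE0 : fracE alpha beta a b (fun=> 0).
Proof.
have d0 x : derive1 (fun=> 0 : R) x = (0 : R) by rewrite derive1_cst.
have l0 c x t : RL_left_integrand c (derive1 (fun=> 0 : R)) x t = 0.
  by rewrite /RL_left_integrand d0 mulr0.
have r0 c x t : RL_right_integrand c (derive1 (fun=> 0 : R)) x t = 0.
  by rewrite /RL_right_integrand d0 mulr0.
have fl0 c x : caputo_left_formula c a (fun=> 0) x = 0.
  rewrite /caputo_left_formula /RL_left_integral /Rintegral integral0_eq ?mulr0//.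
  by move=> t _; rewrite l0.
have fr0 c x : caputo_right_formula c b (fun=> 0) x = 0.
  rewrite /caputo_right_formula /RL_right_integral /Rintegral integral0_eq ?mulr0//.
  by move=> t _; rewrite r0.
have cl0 : caputo_left_formula alpha a (fun=> 0) t @[t --> a^'+] --> (0 : R).
  by under eq_fun do rewrite fl0; exact: cvg_cst.
have cr0 : caputo_right_formula beta b (fun=> 0) t @[t --> b^'-] --> (0 : R).
  by under eq_fun do rewrite fr0; exact: cvg_cst.
split.
- by move=> e e0; exists 1 => // n u v _ _ _; rewrite big1// => i _; rewrite subrr normr0.
- split; last by apply/cvg_ex; exists 0; exact: cl0.
  move=> x _; apply: (eq_integrable _ (cst 0%E)) => //; last exact: integrable0.
  by move=> t _; rewrite /= l0.
- have -> : caputo_left alpha a (fun=> 0) = cst 0.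
    apply/funext => x; rewrite /caputo_left fl0; case: ifPn => _; [exact: cvg_lim cl0|by []].
  exact: cst_continuous.
- split; last by apply/cvg_ex; exists 0; exact: cr0.
  move=> x _; apply: (eq_integrable _ (cst 0%E)) => //; last exact: integrable0.
  by move=> t _; rewrite /= r0.
- have -> : caputo_right beta b (fun=> 0) = cst 0.
    apply/funext => x; rewrite /caputo_right fr0; case: ifPn => _; [exact: cvg_lim cr0|by []].
  exact: cst_continuous.
Qed.

Lemma fracE_primitive phi eta : primitive_of a b phi eta -> fracE alpha beta a b eta.
Proof.
move=> pe; have -> : eta = (fun=> 0) \+ eta by apply/funext => x; rewrite /= add0r.
exact: fracE_add_primitive fracE0 pe.
Qed.

End caputo_variation.

(** * First order expansion of a C1 integrand along a curve *)

Section first_order_expansion.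
Context {R : realType}.
Notation mu := (@lebesgue_measure R).

(** The intermediate point is recorded as a displacement k with |k| <= |h|, which treats both signs
    of h at once. *)
Lemma mean_value (f : R -> R) (x h : R) : (forall z, derivable f z 1) ->
  exists2 k, `|k| <= `|h| & f (x + h) - f x = derive1 f (x + k) * h.
Proof.
move=> df.
have dis z : is_derive z (1 : R) f (derive1 f z).
  by rewrite derive1E; exact: derivableP.
have cf p q : {within `[p, q], continuous f}.
  apply: derivable_within_continuous => z _; exact: df.
have [h0|h0] := leP 0 h.
  have [|c cxh E] := @MVT_segment R f (derive1 f) x (x + h) _ (fun z _ => dis z) (cf _ _).
    by rewrite lerDl.
  move: cxh; rewrite in_itv/= => /andP[c1 c2].
  exists (c - x); first by rewrite !ger0_norm; lra.
  by rewrite E; congr (derive1 f _ * _); ring.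
have [|c cxh E] := @MVT_segment R f (derive1 f) (x + h) x _ (fun z _ => dis z) (cf _ _).
  by rewrite gerDl ltW.
move: cxh; rewrite in_itv/= => /andP[c1 c2].
exists (c - x); first by rewrite !ler0_norm; lra.
have -> : f (x + h) - f x = - (f x - f (x + h)) by ring.
by rewrite E -mulrN; congr (derive1 f _ * _); ring.
Qed.

Variables (a b : R).

Lemma continuous4_dist (G : R -> R -> R -> R -> R) : continuous4 a b G ->
  forall x y u v, x \in `[a, b] -> forall e, 0 < e -> exists2 d, 0 < d &
  forall x' y' u' v', x' \in `[a, b] -> `|x' - x| < d -> `|y' - y| < d ->
    `|u' - u| < d -> `|v' - v| < d -> `|G x' y' u' v' - G x y u v| < e.
Proof.
move=> /(@within_continuous_ballP R (R * R * R * R)%type) cG x y u v xab e e0.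
have [d d0 Hd] := cG (x, y, u, v) xab e e0; exists d => // x' y' u' v' x'ab xd yd ud vd.
apply: (Hd (x', y', u', v') x'ab).
by split=> /=; [split=> /=; [split=> /=|]|]; rewrite /ball/= distrC.
Qed.

Lemma continuous4_comp G (Y U V : R -> R) : continuous4 a b G ->
  {within `[a, b], continuous Y} -> {within `[a, b], continuous U} ->
  {within `[a, b], continuous V} ->
  {within `[a, b], continuous (fun x => G x (Y x) (U x) (V x))}.
Proof.
move=> /continuous4_dist cG cY cU cV; apply/within_continuous_distP => x xab e e0.
have [d d0 Hd] := cG x (Y x) (U x) (V x) xab e e0.
have [d1 d10 H1] := (within_continuous_distP _ _).1 cY x xab d d0.
have [d2 d20 H2] := (within_continuous_distP _ _).1 cU x xab d d0.
have [d3 d30 H3] := (within_continuous_distP _ _).1 cV x xab d d0.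
exists (Num.min d (Num.min d1 (Num.min d2 d3))); first by rewrite !lt_min d0 d10 d20.
move=> z zab; rewrite !lt_min => /and4P[zd z1 z2 z3].
by apply: Hd => //; [exact: H1|exact: H2|exact: H3].
Qed.

Lemma three_term_bound (e g2 g3 g4 h2 h3 h4 p q r : R) :
  `|h2 - g2| <= e -> `|h3 - g3| <= e -> `|h4 - g4| <= e ->
  `|(h2 * p + h3 * q + h4 * r) - (g2 * p + g3 * q + g4 * r)| <=
  e * (`|p| + `|q| + `|r|).
Proof.
move=> H2 H3 H4.
have -> : (h2 * p + h3 * q + h4 * r) - (g2 * p + g3 * q + g4 * r) =
  (h2 - g2) * p + (h3 - g3) * q + (h4 - g4) * r by ring.
rewrite !mulrDr; apply: (le_trans (ler_normD _ _)); apply: lerD.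
  by apply: (le_trans (ler_normD _ _)); apply: lerD; rewrite normrM ler_wpM2r.
by rewrite normrM ler_wpM2r.
Qed.

Variables (Y U V : R -> R).
Hypotheses (cY : {within `[a, b], continuous Y}) (cU : {within `[a, b], continuous U})
  (cV : {within `[a, b], continuous V}).

(** The last three arguments are unbounded, but compactness of [a, b] makes continuity uniform near
    the curve x -> (x, Y x, U x, V x). *)
Lemma continuous4_tube G : continuous4 a b G -> forall e, 0 < e ->
  exists2 d, 0 < d & forall x p q r, x \in `[a, b] -> `|p| < d -> `|q| < d -> `|r| < d ->
    `|G x (Y x + p) (U x + q) (V x + r) - G x (Y x) (U x) (V x)| <= e.
Proof.
move=> cG e e0.
pose P (d x : R) := x \in `[a, b] -> forall p q r, `|p| < d -> `|q| < d -> `|r| < d ->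
    `|G x (Y x + p) (U x + q) (V x + r) - G x (Y x) (U x) (V x)| <= e.
have /compact_near_coveringP cov := @segment_compact R a b.
have : \forall d \near (0 : R)^'+, (`[a, b]%classic `<=` P d).
  apply: cov => x xab.
  have e20 : 0 < e / 2 by rewrite divr_gt0.
  have [d d0 Hd] := continuous4_dist cG (Y x) (U x) (V x) xab e20.
  have d20 : 0 < d / 2 by rewrite divr_gt0.
  have [d1 d10 H1] := (within_continuous_distP _ _).1 cY x xab _ d20.
  have [d2 d20' H2] := (within_continuous_distP _ _).1 cU x xab _ d20.
  have [d3 d30 H3] := (within_continuous_distP _ _).1 cV x xab _ d20.
  pose D := Num.min d (Num.min d1 (Num.min d2 d3)).
  have D0 : 0 < D by rewrite /D !lt_min d0 d10 d20'.
  (* A neighbourhood of x paired with a bound on the tube radius: the covering form of compactness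
     turns these into one radius for all of [a, b]. *)
  exists ([set z | `|z - x| < D], [set d' | d' < d / 2]) => /=.
    split.
      by apply/nbhs_ballP; exists D => //= z; rewrite /ball/= distrC.
    exact: nbhs_right_lt.
  move=> [z d'] /= [zx d'd] zab p q r pd qd rd.
  move: zx; rewrite !lt_min => /and4P[zd z1 z2 z3].
  have h1 := H1 z zab z1; have h2 := H2 z zab z2; have h3 := H3 z zab z3.
  have near2 (s s' w : R) : `|s - s'| < d / 2 -> `|w| < d' -> `|s + w - s'| < d.
    move=> s1 w1; have -> : s + w - s' = (s - s') + w by ring.
    by rewrite (le_lt_trans (ler_normD _ _))// (splitr d) ltrD// (lt_trans w1).
  have lt2 (s : R) : s < d / 2 -> s < d by lra.
  have g1 := Hd z _ _ _ zab zd (near2 _ _ _ h1 pd) (near2 _ _ _ h2 qd) (near2 _ _ _ h3 rd).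
  have g2 := Hd z _ _ _ zab zd (lt2 _ h1) (lt2 _ h2) (lt2 _ h3).
  rewrite (_ : _ - _ = (G z (Y z + p) (U z + q) (V z + r) - G x (Y x) (U x) (V x))
    - (G z (Y z) (U z) (V z) - G x (Y x) (U x) (V x))); last by ring.
  by rewrite (le_trans (ler_normB _ _))// (splitr e) lerD// ltW.
move=> H.
have /filter_ex[d [d0 Hd]] : \forall d \near (0 : R)^'+, 0 < d /\ (`[a, b]%classic `<=` P d).
  by apply: filterI; [exact: nbhs_right_gt|exact: H].
by exists d => // x p q r xab; exact: (Hd x).
Qed.

Variable F : R -> R -> R -> R -> R.
Hypothesis C1F : classC1 a b F.

Lemma first_order_pointwise e : 0 < e -> exists2 d, 0 < d &
  forall x p q r, x \in `[a, b] -> `|p| < d -> `|q| < d -> `|r| < d ->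
  `|F x (Y x + p) (U x + q) (V x + r) - F x (Y x) (U x) (V x) -
    (partial2 F x (Y x) (U x) (V x) * p + partial3 F x (Y x) (U x) (V x) * q +
     partial4 F x (Y x) (U x) (V x) * r)| <= e * (`|p| + `|q| + `|r|).
Proof.
move=> e0; have [dF _ [_ cF2 cF3 cF4]] := C1F.
have [d2 d20 H2] := continuous4_tube cF2 e0.
have [d3 d30 H3] := continuous4_tube cF3 e0.
have [d4 d40 H4] := continuous4_tube cF4 e0.
exists (Num.min d2 (Num.min d3 d4)); first by rewrite !lt_min d20 d30.
move=> x p q r xab; rewrite !lt_min => /and3P[p2 p3 p4] /and3P[q2 q3 q4] /and3P[r2 r3 r4].
have z2 : `|0 : R| < d2 by rewrite normr0.
have z3 : `|0 : R| < d3 by rewrite normr0.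
have z4 : `|0 : R| < d4 by rewrite normr0.
(* The increments are removed one variable at a time, each by the mean value theorem in that
   variable; the three differences telescope at the end. *)
have [k2 k2p E2] := @mean_value (fun s => F x s (U x + q) (V x + r)) (Y x) p
  (fun z => let: And4 _ h _ _ := dF x z (U x + q) (V x + r) xab in h).
have [k3 k3q E3] := @mean_value (fun s => F x (Y x) s (V x + r)) (U x) q
  (fun z => let: And4 _ _ h _ := dF x (Y x) z (V x + r) xab in h).
have [k4 k4r E4] := @mean_value (fun s => F x (Y x) (U x) s) (V x) r
  (fun z => let: And4 _ _ _ h := dF x (Y x) (U x) z xab in h).
have G2 := H2 x k2 q r xab (le_lt_trans k2p p2) q2 r2.
have G3 := H3 x 0 k3 r xab z3 (le_lt_trans k3q q3) r3.
have G4 := H4 x 0 0 k4 xab z4 z4 (le_lt_trans k4r r4).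
rewrite !addr0 in G3 G4.
have := three_term_bound p q r G2 G3 G4.
rewrite -[X in X + _ + _ - _]E2 -[X in _ + X + _ - _]E3 -[X in _ + _ + X - _]E4.
by rewrite subrKA subrKA.
Qed.

Variables (A B : R).
Hypotheses (aA : a <= A) (AB : A < B) (Bb : B <= b).

Let subAB : `[A, B]%classic `<=` `[a, b]%classic.
Proof.
by move=> x /=; rewrite !in_itv/= => /andP[/(le_trans aA) -> /le_trans]; exact.
Qed.

Let mab : measurable (`[a, b]%classic : set (measurableTypeR R)).
Proof. exact: measurable_itv. Qed.

Let mAB : measurable (`[A, B]%classic : set (measurableTypeR R)).
Proof. exact: measurable_itv. Qed.

Lemma within_integrable_sub f : {within `[a, b], continuous f} ->
  mu.-integrable `[A, B] (EFin \o f).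
Proof.
move=> cf; apply: (integrableS mab mAB subAB).
exact/bounded_measurable_integrable/within_continuous_bounded_measurable.
Qed.

Lemma first_order_integral e : 0 < e -> exists2 d, 0 < d &
  forall p q r s, {within `[a, b], continuous p} -> {within `[a, b], continuous q} ->
  {within `[a, b], continuous r} -> s < d ->
  (forall x, x \in `[a, b] -> `|p x| + `|q x| + `|r x| <= s) ->
  `|\int[mu]_(x in `[A, B]) F x (Y x + p x) (U x + q x) (V x + r x) -
    \int[mu]_(x in `[A, B]) F x (Y x) (U x) (V x) -
    \int[mu]_(x in `[A, B]) (partial2 F x (Y x) (U x) (V x) * p x +
     partial3 F x (Y x) (U x) (V x) * q x + partial4 F x (Y x) (U x) (V x) * r x)| <= e * s.
Proof.
move=> e0; have [_ cF [_ cF2 cF3 cF4]] := C1F.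
have BA0 : 0 < B - A by rewrite subr_gt0.
have eB0 : 0 < e / (B - A) by rewrite divr_gt0.
have [d d0 Hd] := first_order_pointwise eB0; exists d => // p q r s cp cq cr sd ps.
have i2 : mu.-integrable `[A, B] (EFin \o (fun x => F x (Y x) (U x) (V x))).
  exact/within_integrable_sub/continuous4_comp.
have i3 : mu.-integrable `[A, B] (EFin \o (fun x => partial2 F x (Y x) (U x) (V x) * p x +
     partial3 F x (Y x) (U x) (V x) * q x + partial4 F x (Y x) (U x) (V x) * r x)).
  apply: within_integrable_sub => x.
  apply: cvgD; first apply: cvgD.
  - by apply: cvgM; [exact: (continuous4_comp cF2)|exact: cp].
  - by apply: cvgM; [exact: (continuous4_comp cF3)|exact: cq].
  - by apply: cvgM; [exact: (continuous4_comp cF4)|exact: cr].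
have i1 : mu.-integrable `[A, B]
    (EFin \o (fun x => F x (Y x + p x) (U x + q x) (V x + r x))).
  apply: within_integrable_sub; apply: continuous4_comp => // x.
  - by apply: cvgD; [exact: cY|exact: cp].
  - by apply: cvgD; [exact: cU|exact: cq].
  - by apply: cvgD; [exact: cV|exact: cr].
have i12 := integrableB mAB i1 i2; have i123 := integrableB mAB i12 i3.
rewrite -RintegralB// -RintegralB//.
rewrite (le_trans (le_normr_Rintegral mAB i123))//.
have ic : mu.-integrable `[A, B] (EFin \o (cst (e / (B - A) * s))).
  by apply: within_integrable_sub; exact: cst_continuous.
have i123' := integrable_abse i123.
apply: (le_trans (le_Rintegral mAB i123' ic _)).
  move=> x /subAB xab; have ps' := ps x xab.
  have [px qx rx] : [/\ `|p x| < d, `|q x| < d & `|r x| < d].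
    have := normr_ge0 (p x); have := normr_ge0 (q x); have := normr_ge0 (r x).
    by move=> *; split; lra.
  apply: (le_trans (Hd x _ _ _ xab px qx rx)).
  by rewrite ler_pM2l.
have muAB : mu `[A, B]%classic = (B - A)%:E.
  by rewrite lebesgue_measure_itv/= lte_fin AB EFinB.
by rewrite Rintegral_cst// [X in fine X]muAB/= mulrAC divfK// gt_eqF.
Qed.

End first_order_expansion.

(** * The multiplier rule *)

Section two_parameter_descent.
Context {R : realType}.

Definition first_order_at (J : R -> R -> R) (j1 j2 : R) := forall e, 0 < e ->
  exists2 d, 0 < d & forall s t, `|s| + `|t| < d ->
    `|J s t - J 0 0 - (s * j1 + t * j2)| <= e * (`|s| + `|t|).

(* Moving by s in the first direction, chosen to decrease J, changes I only by
   o(s); the intermediate value theorem gives a t = O(s), with as small a constant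
   as desired, restoring the value of I. *)
Lemma two_parameter_descent (J I : R -> R -> R) (j1 j2 i2 : R) :
  first_order_at J j1 j2 -> first_order_at I 0 i2 ->
  (forall s p q, {within `[p, q], continuous (I s)}) ->
  j1 != 0 -> i2 != 0 -> forall d, 0 < d ->
  exists s t, [/\ `|s| + `|t| < d, I s t = I 0 0 & J s t < J 0 0].
Proof.
move=> EJ EI cI j10 i20 d d0.
have J1 : 0 < `|j1| by rewrite normr_gt0.
have I2 : 0 < `|i2| by rewrite normr_gt0.
have j21 : 0 < `|j2| + 1 by rewrite ltr_wpDl.
(* With |t| <= k h, the term t j2 is at most a quarter of the gain h |j1| obtained from s. *)
pose k := Num.min 1 (`|j1| / (4 * (`|j2| + 1))).
have k0 : 0 < k by rewrite lt_min ltr01 divr_gt0// mulr_gt0.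
have k1 : k <= 1 by rewrite ge_min lexx.
have kj2 : k * `|j2| <= `|j1| / 4.
  apply: (@le_trans _ _ (`|j1| / (4 * (`|j2| + 1)) * (`|j2| + 1))).
    by rewrite ler_pM ?(ltW k0)// ?ge_min ?lexx ?orbT// lerDl.
  by rewrite invfM mulrA divfK// gt_eqF.
(* The first bound makes the error of I at t = k h and t = - k h at most half of k h |i2|, so
   [I s t - I 0 0] changes sign in between. The second keeps the error of J within a quarter of h
   |j1|, leaving half of the gain. *)
pose e := Num.min (k * `|i2| / 4) (`|j1| / 8).
have e0 : 0 < e by rewrite lt_min !divr_gt0// mulr_gt0.
have ei : e <= k * `|i2| / 4 by rewrite ge_min lexx.
have ej : e <= `|j1| / 8 by rewrite ge_min lexx orbT.
have [dJ dJ0 HJ] := EJ e e0; have [dI dI0 HI] := EI e e0.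
clearbody k e.
pose m := Num.min d (Num.min dJ dI).
have m0 : 0 < m by rewrite !lt_min d0 dJ0.
pose h := m / 4.
have h0 : 0 < h by rewrite divr_gt0.
have [hd hJ hI] : [/\ 2 * h < d, 2 * h < dJ & 2 * h < dI].
  have : 2 * h < m by rewrite /h; lra.
  by rewrite !lt_min => /and3P[].
clearbody h.
pose s := - Num.sg j1 * h.
have sh : `|s| = h by rewrite normrM normrN normr_sg j10 mul1r gtr0_norm.
have sj : s * j1 = - h * `|j1|.
  by rewrite /s mulrAC [X in _ = - h * X]normrEsg; ring.
clearbody s.
have kh0 : 0 < k * h by rewrite mulr_gt0.
have small (t : R) : `|t| <= k * h -> `|s| + `|t| <= 2 * h.
  move=> tk; rewrite sh.
  have : k * h <= 1 * h by rewrite ler_pM2r.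
  by rewrite mul1r; lra.
have e2h : e * (2 * h) <= k * h * `|i2| / 2.
  have -> : k * h * `|i2| / 2 = k * `|i2| / 4 * (2 * h) by field.
  by rewrite ler_pM2r// mulr_gt0.
have bnd (t : R) : `|t| <= k * h -> `|I s t - I 0 0 - t * i2| <= k * h * `|i2| / 2.
  move=> tk; have := small t tk => st.
  have := HI s t (le_lt_trans st hI); rewrite mulr0 add0r => H.
  apply: (le_trans H); apply: le_trans e2h.
  by rewrite ler_pM2l.
have khi : 0 < k * h * `|i2| by rewrite mulr_gt0.
have Bp := bnd (k * h); rewrite ger0_norm ?(ltW kh0)// lexx in Bp.
have {}Bp := Bp isT.
have Bn := bnd (- (k * h)); rewrite normrN ger0_norm ?(ltW kh0)// lexx in Bn.
have {}Bn := Bn isT.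
have [t tk It] : exists2 t, t \in `[- (k * h), k * h] & I s t = I 0 0.
  apply: IVT; [lra|exact: cI|].
  move: Bp Bn; rewrite !ler_norml => /andP[b1 b2] /andP[b3 b4].
  rewrite ge_min le_max.
  have [i2p|i2n] := ltP 0 i2.
    rewrite gtr0_norm// in b1 b2 b3 b4 khi.
    by rewrite ?mulNr in b3 b4; clear -b1 b2 b3 b4 khi; apply/andP; split; apply/orP; [left|right]; lra.
  rewrite ler0_norm// in b1 b2 b3 b4 khi.
  rewrite ?mulNr ?mulrN in b1 b2 b3 b4 khi; clear -b1 b2 b3 b4 khi.
  by apply/andP; split; apply/orP; [right|left]; lra.
have tk' : `|t| <= k * h by move: tk; rewrite in_itv/= ler_norml.
exists s, t; split=> //; first exact: le_lt_trans (small t tk') hd.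
have := HJ s t (le_lt_trans (small t tk') hJ).
have E2 : e * (`|s| + `|t|) <= `|j1| / 4 * h.
  apply: (@le_trans _ _ (`|j1| / 8 * (2 * h))); last by lra.
  by rewrite ler_pM ?(ltW e0) ?addr_ge0// small.
have tj2 : t * j2 <= `|j1| / 4 * h.
  apply: (le_trans (ler_norm _)); rewrite normrM.
  apply: (@le_trans _ _ (k * h * `|j2|)); first by rewrite ler_wpM2r.
  by rewrite mulrAC ler_pM2r.
have jh : 0 < `|j1| * h by rewrite mulr_gt0.
rewrite sj ler_norml => /andP[_ H].
lra.
Qed.

End two_parameter_descent.

(** * Derivatives relative to an interval *)

Section deriv_within.
Context {R : realType}.
Implicit Types (S : set R) (F G : R -> R).

(** Carries existence and value together, whereas [deriv_within] is a [lim], informative only along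
    with [derivable_within]. *)
Definition has_deriv_within S F x l := forall e, 0 < e -> exists2 d, 0 < d &
  forall t, S t -> t != x -> `|t - x| < d -> `|(F t - F x) / (t - x) - l| < e.

Lemma has_deriv_withinP S F x l : has_deriv_within S F x l <->
  (F t - F x) / (t - x) @[t --> within S x^'] --> l.
Proof.
split=> H.
  apply/cvgrPdist_lt => e e0; have [d d0 Hd] := H e e0.
  rewrite near_withinE near_withinE; apply/nbhs_ballP; exists d => //= t.
  by rewrite /ball/= distrC => td tx St; rewrite distrC; exact: Hd.
move=> e e0; have /cvgrPdist_lt/(_ e e0) := H.
rewrite near_withinE near_withinE => /nbhs_ballP[d /= d0 Hd]; exists d => // t St tx td.
by rewrite distrC; apply: Hd => //; rewrite /ball/= distrC.
Qed.

Lemma derivable_within_has_deriv S F x : derivable_within S F x ->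
  has_deriv_within S F x (deriv_within S F x).
Proof. by move=> dF; apply/has_deriv_withinP. Qed.

(** Uniqueness of limits rests on this. A nondegenerate segment has points near x on at least one
    side, while for a single point the filter is improper, in keeping with the convention that the
    degenerate equations are void. *)
Lemma within_itv_proper (p q x : R) : p < q -> x \in `[p, q] ->
  ProperFilter (within `[p, q] x^').
Proof.
move=> pq; rewrite in_itv/= => /andP[px xq]; apply: Build_ProperFilter_ex => A HA.
have {HA}/nbhs_ballP[d /= d0 Hd] : \forall t \near x, t != x -> `[p, q]%classic t -> A t := HA.
have [xq'|qx] := ltP x q.
  pose t := Num.min (x + d / 2) q.
  exists t; apply: Hd => /=.
  - rewrite /ball/= distrC ltr_norml /t minEle.
    by case: ifPn; rewrite -?ltNge => ?; apply/andP; split; lra.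
  - by rewrite gt_eqF// lt_min xq' ltrDl divr_gt0.
  - rewrite in_itv/= /t ge_min lexx orbT andbT le_min (ltW pq) andbT.
    by rewrite (le_trans px)// lerDl ltW// divr_gt0.
pose t := Num.max (x - d / 2) p.
have xp : p < x by exact: lt_le_trans qx.
exists t; apply: Hd => /=.
- rewrite /ball/= distrC ltr_norml /t maxEle.
  by case: ifPn; rewrite -?ltNge => ?; apply/andP; split; lra.
- by rewrite lt_eqF// gt_max xp andbT ltrBlDr ltrDl divr_gt0.
- rewrite in_itv/= /t le_max lexx orbT/= ge_max (ltW pq) andbT.
  by rewrite (le_trans _ xq)// lerBlDr lerDl ltW// divr_gt0.
Qed.

Lemma has_deriv_derivable_within p q F x l : p < q -> x \in `[p, q] ->
  has_deriv_within `[p, q] F x l ->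
  derivable_within `[p, q] F x /\ deriv_within `[p, q] F x = l.
Proof.
move=> pq xpq /has_deriv_withinP H.
have PF := within_itv_proper pq xpq.
split; first by apply/cvg_ex; exists l.
exact: cvg_lim.
Qed.

Lemma has_deriv_within_unique p q F x l l' : p < q -> x \in `[p, q] ->
  has_deriv_within `[p, q] F x l -> has_deriv_within `[p, q] F x l' -> l = l'.
Proof.
move=> pq xpq H H'.
have [_ <-] := has_deriv_derivable_within pq xpq H.
by have [_ <-] := has_deriv_derivable_within pq xpq H'.
Qed.

Lemma has_deriv_withinS S S' F x l : S' `<=` S ->
  has_deriv_within S F x l -> has_deriv_within S' F x l.
Proof.
move=> SS H e e0; have [d d0 Hd] := H e e0.
by exists d => // t /SS St; exact: Hd.
Qed.

Lemma eq_has_deriv_within S F G x l : S x -> (forall t, S t -> F t = G t) ->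
  has_deriv_within S F x l -> has_deriv_within S G x l.
Proof.
move=> Sx FG H e e0; have [d d0 Hd] := H e e0.
by exists d => // t St tx td; rewrite -!FG//; exact: Hd.
Qed.

Lemma has_deriv_withinD S F G x l m : has_deriv_within S F x l ->
  has_deriv_within S G x m -> has_deriv_within S (fun t => F t + G t) x (l + m).
Proof.
move=> HF HG e e0; have e20 : 0 < e / 2 by rewrite divr_gt0.
have [d d0 Hd] := HF _ e20; have [d' d'0 Hd'] := HG _ e20.
exists (Num.min d d'); first by rewrite lt_min d0.
move=> t St tx; rewrite lt_min => /andP[td td'].
have -> : (F t + G t - (F x + G x)) / (t - x) - (l + m) =
  ((F t - F x) / (t - x) - l) + ((G t - G x) / (t - x) - m) by ring.
by rewrite (le_lt_trans (ler_normD _ _))// (splitr e) ltrD// ?Hd ?Hd'.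
Qed.

Lemma has_deriv_withinZ S F x k l : has_deriv_within S F x l ->
  has_deriv_within S (fun t => k * F t) x (k * l).
Proof.
move=> HF e e0; have k0 : 0 < `|k| + 1 by rewrite ltr_wpDl.
have ek0 : 0 < e / (`|k| + 1) by rewrite divr_gt0.
have [d d0 Hd] := HF _ ek0; exists d => // t St tx td.
have -> : (k * F t - k * F x) / (t - x) - k * l = k * ((F t - F x) / (t - x) - l) by ring.
have := Hd t St tx td; rewrite ltr_pdivlMr// mulrC normrM.
by apply: le_lt_trans; rewrite ler_wpM2r// lerDl.
Qed.

Lemma has_deriv_within_cst S x (k : R) : has_deriv_within S (cst k) x 0.
Proof. by move=> e e0; exists 1 => // t _ _ _; rewrite subrr mul0r subrr normr0. Qed.

End deriv_within.

Section continuous_square.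
Context {R : realType}.
Notation mu := (@lebesgue_measure R).
Variables (a b : R).
Hypothesis ab : a < b.

Lemma within_continuous_eq0 (f : R -> R) : {within `[a, b], continuous f} ->
  {in `]a, b[, forall x, f x = 0} -> {in `[a, b], forall x, f x = 0}.
Proof.
move=> /within_continuous_distP cf f0 x xab; apply/eqP; rewrite -normr_le0 leNgt.
apply/negP => fx; have [d d0 Hd] := cf x xab _ fx.
have /andP[ax xb] : a <= x <= b by rewrite in_itv in xab.
pose m := Num.min (d / 2) ((b - a) / 2).
have m0 : 0 < m by rewrite lt_min !divr_gt0// subr_gt0.
have m1 : m <= d / 2 by rewrite ge_min lexx.
have m2 : m <= (b - a) / 2 by rewrite ge_min lexx orbT.
clearbody m.
have [z [zab zx]] : exists z, (z \in `]a, b[) /\ (`|z - x| < d).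
  have [ax'|xa] := ltP a x; last first.
    by exists (a + m); rewrite in_itv/= ltr_norml; split; apply/andP; split; lra.
  have [xb'|bx] := ltP x b; last first.
    by exists (b - m); rewrite in_itv/= ltr_norml; split; apply/andP; split; lra.
  by exists x; rewrite in_itv/= ax' xb' subrr normr0.
by have := Hd z (subset_itv_oo_cc zab) zx; rewrite f0// sub0r normrN ltxx.
Qed.

(** The primitive of the square is nonnegative and at most its final value 0, hence vanishes
    identically; so does its derivative, the square itself, and continuity reaches the endpoints. *)
Lemma Rintegral_sqr_eq0 (f : R -> R) : {within `[a, b], continuous f} ->
  \int[mu]_(x in `[a, b]) (f x * f x) = 0 -> {in `[a, b], forall x, f x = 0}.
Proof.
move=> cf int0; apply: within_continuous_eq0 => // x xab.
have cff : {within `[a, b], continuous (fun x => f x * f x)}.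
  by move=> z; apply: cvgM; exact: cf.
pose Phi x := \int[mu]_(t in `[a, x]) (f t * f t).
have pe : primitive_of a b (fun x => f x * f x) Phi by [].
have bab : b \in `[a, b] by rewrite in_itv/= lexx ltW.
have Phi0 z : z \in `[a, b] -> Phi z = 0.
  move=> zab; apply/eqP; rewrite eq_le; apply/andP; split.
    rewrite -int0 -subr_ge0 Rintegral_itvB.
    - by apply: Rintegral_ge0 => t _; rewrite -expr2 sqr_ge0.
    - exact: (within_continuous_integrable cff bab).
    - by move: zab; rewrite in_itv/= bnd_simp => /andP[].
    - by move: zab; rewrite in_itv/= bnd_simp => /andP[].
  by apply: Rintegral_ge0 => t _; rewrite -expr2 sqr_ge0.
have D0 : is_derive x (1 : R) Phi 0.
  apply: near_eq_is_derive (is_derive_cst (0 : R) x (1 : R)).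
  have : \forall z \near x, z \in `]a, b[ by exact: near_in_itvoo.
  by apply: filterS => z /subset_itv_oo_cc/Phi0 ->.
have [_ E1] := primitive_is_derive ab pe xab; have [_ E2] := D0.
by apply/eqP; rewrite -[_ == 0]orbb -mulf_eq0 -E1 E2.
Qed.

End continuous_square.

Section right_integral.
Context {R : realType}.
Notation mu := (@lebesgue_measure R).

(** By the mean value theorem the difference quotient is the value of f at a point between x and t,
    which covers the one-sided derivatives at p and q as well. *)
Lemma left_integral_has_deriv (f : R -> R) p q x : p < q ->
  {within `[p, q], continuous f} -> x \in `[p, q] ->
  has_deriv_within `[p, q] (fun t => \int[mu]_(s in `[p, t]) f s) x (f x).
Proof.
move=> pq cf xpq; pose Phi t := \int[mu]_(s in `[p, t]) f s.
have pe : primitive_of p q f Phi by [].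
have cPhi : {within `[p, q], continuous Phi}.
  apply: (@eq_within_continuous _ (frac_left p q 0 f)).
    by move=> t tpq; rewrite (primitive_frac pq pe tpq).
  apply: frac_left_continuous => //.
  exact: within_continuous_bounded_measurable.
have MV s t : s \in `[p, q] -> t \in `[p, q] -> s <= t ->
    exists2 c, c \in `[s, t] & Phi t - Phi s = f c * (t - s).
  rewrite !in_itv/= => /andP[ps sq] /andP[pt tq] st.
  apply: MVT_segment => //.
    move=> z; rewrite in_itv/= => /andP[sz zt]; apply: (primitive_is_derive pq pe).
    by rewrite in_itv/= (le_lt_trans ps)// (lt_le_trans zt).
  apply: continuous_subspaceW cPhi => z /=; rewrite !in_itv/= => /andP[sz zt].
  by rewrite (le_trans ps)// (le_trans zt).
move=> e e0; have [d d0 Hd] := (within_continuous_distP _ _).1 cf x xpq e e0.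
exists d => // t tpq tx td.
have [c [cpq cx E]] : exists c, [/\ c \in `[p, q], `|c - x| < d & Phi t - Phi x = f c * (t - x)].
  have /andP[px xq] : p <= x <= q by rewrite in_itv in xpq.
  have /andP[pt tq] : p <= t <= q by move: tpq; rewrite /= in_itv.
  have [xt|/ltW tx'] := leP x t.
    have [c + E] := MV _ _ xpq tpq xt; rewrite in_itv/= => /andP[xc ct].
    exists c; split=> //; first by rewrite in_itv/= (le_trans px)// (le_trans ct).
    by apply: le_lt_trans td; rewrite !ger0_norm ?subr_ge0// lerD2r.
  have [c + E] := MV _ _ tpq xpq tx'; rewrite in_itv/= => /andP[tc cx].
  exists c; split.
  - by rewrite in_itv/= (le_trans pt)// (le_trans cx).
  - by apply: le_lt_trans td; rewrite !ler0_norm ?subr_le0// lerN2 lerD2r.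
  - by rewrite -opprB E -mulrN opprB.
rewrite -/(Phi t) -/(Phi x) E mulfK ?subr_eq0//.
exact: Hd.
Qed.

Lemma right_integral_has_deriv (f : R -> R) p q x : p < q ->
  {within `[p, q], continuous f} -> x \in `[p, q] ->
  has_deriv_within `[p, q] (fun t => \int[mu]_(s in `[t, q]) f s) x (- f x).
Proof.
move=> pq cf xpq.
have qpq : q \in `[p, q] by rewrite in_itv/= lexx ltW.
have fi := within_continuous_integrable cf qpq.
have H := has_deriv_withinD (has_deriv_within_cst `[p, q] x (\int[mu]_(s in `[p, q]) f s))
  (has_deriv_withinZ (-1) (left_integral_has_deriv pq cf xpq)).
rewrite add0r mulN1r in H; apply: (eq_has_deriv_within _ _ H) => // t /=.
rewrite in_itv/= => /andP[pt tq].
have [h1 h2] : (BLeft p <= BRight t)%O /\ (BRight t <= BRight q)%O by rewrite !bnd_simp.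
rewrite mulN1r (Rintegral_itvB fi h1 h2).
rewrite Rintegral_itv_obnd_cbnd//; apply: integrableS fi => //.
by move=> s /=; rewrite !in_itv/= => /andP[ts ->]; rewrite (le_trans pt)// ltW.
Qed.

End right_integral.

(** * Positivity of the Gamma function *)

Section gamma.
Context {R : realType}.
Notation mu := (@lebesgue_measure R).

Lemma integral_expRN : (\int[mu]_(t in `[0%R, +oo[) (expR (- t))%:E = 1)%E.
Proof.
rewrite (@ge0_continuous_FTC2y R (fun t => expR (- t)) (fun t => - expR (- t)) 0 0).
- by rewrite -EFinB oppr0 expR0 opprK add0r.
- by move=> x _; exact: expR_ge0.
- apply: continuous_subspaceT => x.
  by apply: continuous_comp; [exact: opp_continuous|exact: continuous_expR].
- rewrite -oppr0; apply: cvgN; exact: cvgr_expR.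
- by move=> x _; apply: ex_derive.
- apply: cvg_at_right_filter; apply: cvgN.
  by apply: continuous_comp; [exact: opp_continuous|exact: continuous_expR].
- by move=> x _; rewrite derive1E derive_val; ring.
Qed.

(** An infinite integral would be sent to 0 by [fine], so finiteness is part of the claim. The
    integrand is bounded below by a positive constant on [1, 2], and above by t^(-c) on ]0, 1] plus
    exp(-t). Positivity allows division by this factor in the equations on [a, A] and [B, b]. *)
Lemma Gamma_gt0 (c : R) : 0 <= c -> c < 1 -> 0 < Gamma (1 - c).
Proof.
move=> c0 c1; rewrite /Gamma /Rintegral.
pose g (t : R) : R := t `^ (- c) * expR (- t).
have -> : (\int[mu]_(t in `]0%R, +oo[) (t `^ (1 - c - 1) * expR (- t))%:E =
    \int[mu]_(t in `]0%R, +oo[) (g t)%:E)%E.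
  by apply: eq_integral => t _; rewrite /g; congr (_ `^ _ * _)%:E; ring.
have g0 t : 0 <= g t by rewrite mulr_ge0 ?powR_ge0 ?expR_ge0.
have mexp D : measurable_fun D (fun t : R => expR (- t)).
  apply: measurable_funTS; apply: measurableT_comp => //.
have mg D : measurable_fun D (EFin \o g).
  apply/measurable_EFinP; apply: measurable_funM => //.
  by apply: measurable_funTS; exact: measurable_powR.
apply: fine_gt0; apply/andP; split.
  apply: (@lt_le_trans _ _ (\int[mu]_(t in `[1%R, 2%R]) (2 `^ (- c) * expR (- 2))%:E)%E).
    rewrite integral_cst//= lebesgue_measure_itv/= lte_fin ltr1n -EFinD -EFinM lte_fin.
    by rewrite mulr_gt0 ?powR_gt0 ?expR_gt0//= ?mulr_gt0 ?powR_gt0 ?expR_gt0//; lra.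
  apply: (@le_trans _ _ (\int[mu]_(t in `[1%R, 2%R]) (g t)%:E)%E).
    apply: ge0_le_integral => //.
    - exact: mg.
    - move=> t /=; rewrite in_itv/= => /andP[t1 t2]; rewrite lee_fin /g.
      rewrite ler_pM ?powR_ge0 ?expR_ge0// ?ler_expR ?lerN2//.
      by rewrite ler_powRN// (lt_le_trans ltr01).
  apply: ge0_subset_integral => //; first exact: mg.
    by move=> t _; rewrite lee_fin.
  by move=> t /=; rewrite !in_itv/= andbT => /andP[t1 _]; rewrite (lt_le_trans ltr01).
pose h1 := (kern c) \_ `[0, 1]; pose h2 (t : R) := expR (- t).
have h10 t : 0 <= h1 t by rewrite /h1 patchE; case: ifPn => // _; exact: kern_ge0.
have mh1 D : measurable_fun D (EFin \o h1).
  apply/measurable_EFinP/measurable_funTS/(measurable_restrictT _ _).1 => //.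
  by apply: measurable_funTS; exact: measurable_kern.
have i1 : (\int[mu]_(t in `]0%R, +oo[) (h1 t)%:E <= ((1 - c)^-1)%:E)%E.
  apply: (@le_trans _ _ (\int[mu]_t (h1 t)%:E)%E).
    apply: ge0_subset_integral => //; first exact: mh1.
    by move=> t _; rewrite lee_fin.
  rewrite (_ : (\int[mu]_t (h1 t)%:E)%E = (\int[mu]_(t in `[0%R, 1%R]) (kern c (t - 0))%:E)%E).
    by rewrite integral_kern_right// subr0 powR1 mul1r.
  rewrite [RHS]integral_mkcond; apply: eq_integral => t _.
  by rewrite /h1 !patchE subr0; case: ifPn.
have i2 : (\int[mu]_(t in `]0%R, +oo[) (h2 t)%:E <= 1)%E.
  rewrite -integral_expRN; apply: ge0_subset_integral => //.
  - by apply/measurable_EFinP; exact: mexp.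
  - by move=> t _; rewrite lee_fin expR_ge0.
  - by move=> t /=; rewrite !in_itv/= !andbT; exact: ltW.
apply: (@le_lt_trans _ _ (\int[mu]_(t in `]0%R, +oo[) ((h1 t)%:E + (h2 t)%:E))%E).
  apply: ge0_le_integral => //.
  - by move=> t _; rewrite lee_fin.
  - exact: mg.
  - by apply: emeasurable_funD; [exact: mh1|by apply/measurable_EFinP; exact: mexp].
  - move=> t /=; rewrite in_itv/= andbT => t0; rewrite -EFinD lee_fin /g /h1 patchE.
    case: ifPn.
      rewrite /kern t0 => _; rewrite -[leLHS]addr0 lerD ?expR_ge0//.
      by rewrite ler_piMr ?powR_ge0// -expR0 ler_expR; lra.
    rewrite notin_setE/= in_itv/= (ltW t0)/= => /negP; rewrite -ltNge => t1.
    rewrite add0r ler_piMl ?expR_ge0//.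
    have E1 : (1 : R) `^ (- c) = 1 by rewrite powR1.
    by rewrite -[leRHS]E1 ler_powRN// ltW.
rewrite ge0_integralD//=.
- by rewrite (le_lt_trans (leeD i1 i2))// ltry.
- by move=> t _; rewrite lee_fin.
- exact: mh1.
- by move=> t _; rewrite lee_fin expR_ge0.
- by apply/measurable_EFinP; exact: mexp.
Qed.

End gamma.

(** * The Euler-Lagrange system *)

Section truncation.
Context {R : realType}.
Notation mu := (@lebesgue_measure R).
Variables (a b A B c : R) (K : R -> R).
Hypotheses (aA : a <= A) (AB : A < B) (Bb : B <= b).

Lemma RL_right_integral_patch (S : set R) t :
  RL_right_integral c b (K \_ S) t =
  \int[mu]_(s in `[t, b] `&` S) RL_right_integrand c K t s.
Proof.
rewrite /RL_right_integral Rintegral_mkcondr; apply: eq_Rintegral => s _.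
by rewrite /RL_right_integrand !patchE; case: ifPn => // _; rewrite mulr0.
Qed.

Lemma RL_left_integral_patch (S : set R) t :
  RL_left_integral c a (K \_ S) t =
  \int[mu]_(s in `[a, t] `&` S) RL_left_integrand c K t s.
Proof.
rewrite /RL_left_integral Rintegral_mkcondr; apply: eq_Rintegral => s _.
by rewrite /RL_left_integrand !patchE; case: ifPn => // _; rewrite mulr0.
Qed.

(** Inside the window [A, B], truncation amounts to moving the base point from b to B. To the left
    of A the whole window is integrated; to the right of B at most the null set {B} remains. The
    left operators behave symmetrically. *)
Lemma RL_right_trunc_mid t : t \in `[A, B] ->
  RL_right_integral c b (K \_ `[A, B]) t = RL_right_integral c B K t.
Proof.
rewrite in_itv/= => /andP[At tB]; rewrite RL_right_integral_patch.
congr (Rintegral _ _ _); apply/seteqP; split=> s /=; rewrite !in_itv/=.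
  by move=> [/andP[ts sb] /andP[As sB]]; rewrite ts.
by move=> /andP[ts sB]; rewrite ts sB (le_trans sB)// (le_trans At).
Qed.

Lemma RL_right_trunc_left t : t \in `[a, A] ->
  RL_right_integral c b (K \_ `[A, B]) t =
  \int[mu]_(s in `[A, B]) RL_right_integrand c K t s.
Proof.
rewrite in_itv/= => /andP[at_ tA]; rewrite RL_right_integral_patch.
congr (Rintegral _ _ _); apply/seteqP; split=> s /=; rewrite !in_itv/=.
  by move=> [].
by move=> /andP[As sB]; rewrite As sB (le_trans sB)// (le_trans tA).
Qed.

Lemma RL_right_trunc_right t : t \in `[B, b] ->
  RL_right_integral c b (K \_ `[A, B]) t = 0.
Proof.
rewrite in_itv/= => /andP[Bt tb]; rewrite RL_right_integral_patch.
have sub : `[t, b]%classic `&` `[A, B]%classic `<=` [set B].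
  move=> s /=; rewrite !in_itv/= => -[/andP[ts _] /andP[_ sB]].
  by apply/eqP; rewrite eq_le sB (le_trans Bt).
have [->|/set0P[s Ss]] := eqVneq (`[t, b]%classic `&` `[A, B]%classic) set0.
  exact: Rintegral_set0.
have -> : `[t, b]%classic `&` `[A, B]%classic = [set B].
  by apply/seteqP; split=> // z ->; move: (Ss); rewrite (sub _ Ss).
exact: Rintegral_set1.
Qed.

Lemma RL_left_trunc_mid t : t \in `[A, B] ->
  RL_left_integral c a (K \_ `[A, B]) t = RL_left_integral c A K t.
Proof.
rewrite in_itv/= => /andP[At tB]; rewrite RL_left_integral_patch.
congr (Rintegral _ _ _); apply/seteqP; split=> s /=; rewrite !in_itv/=.
  by move=> [/andP[_ st] /andP[As sB]]; rewrite As.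
by move=> /andP[As st]; rewrite As st (le_trans aA)// (le_trans st).
Qed.

Lemma RL_left_trunc_right t : t \in `[B, b] ->
  RL_left_integral c a (K \_ `[A, B]) t =
  \int[mu]_(s in `[A, B]) RL_left_integrand c K t s.
Proof.
rewrite in_itv/= => /andP[Bt tb]; rewrite RL_left_integral_patch.
congr (Rintegral _ _ _); apply/seteqP; split=> s /=; rewrite !in_itv/=.
  by move=> [].
by move=> /andP[As sB]; rewrite As sB (le_trans aA)// (le_trans sB).
Qed.

Lemma RL_left_trunc_left t : t \in `[a, A] ->
  RL_left_integral c a (K \_ `[A, B]) t = 0.
Proof.
rewrite in_itv/= => /andP[at_ tA]; rewrite RL_left_integral_patch.
have sub : `[a, t]%classic `&` `[A, B]%classic `<=` [set A].
  move=> s /=; rewrite !in_itv/= => -[/andP[_ st] /andP[As _]].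
  by apply/eqP; rewrite eq_le As (le_trans st).
have [->|/set0P[s Ss]] := eqVneq (`[a, t]%classic `&` `[A, B]%classic) set0.
  exact: Rintegral_set0.
have -> : `[a, t]%classic `&` `[A, B]%classic = [set A].
  by apply/seteqP; split=> // z ->; move: (Ss); rewrite (sub _ Ss).
exact: Rintegral_set1.
Qed.

Hypotheses (c0 : 0 <= c) (c1 : c < 1).
Hypothesis cK : {within `[a, b], continuous K}.

(** The window is [t, B] with [t, A] removed, which produces the two base points of the second
    equation. *)
Lemma RL_right_split t : t \in `[a, A] ->
  \int[mu]_(s in `[A, B]) RL_right_integrand c K t s =
  RL_right_integral c B K t - RL_right_integral c A K t.
Proof.
rewrite in_itv/= => /andP[at_ tA].
have aB : a < B by exact: le_lt_trans AB.
have cK' : {within `[a, B], continuous K}.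
  apply: continuous_subspaceW cK => s /=; rewrite !in_itv/= => /andP[-> sB].
  exact: le_trans Bb.
have taB : t \in `[a, B] by rewrite in_itv/= at_ (le_trans tA)// ltW.
have [i _] := RL_rightE aB c0 c1 (within_continuous_bounded_measurable cK') taB.
have [h1 h2] : (BLeft t <= BRight A)%O /\ (BRight A <= BRight B)%O by rewrite !bnd_simp tA ltW.
rewrite /RL_right_integral (Rintegral_itvB i h1 h2) Rintegral_itv_obnd_cbnd//.
apply: integrableS i => // s /=; rewrite !in_itv/= => /andP[As ->].
by rewrite (le_trans tA)// ltW.
Qed.

Lemma RL_left_split t : t \in `[B, b] ->
  \int[mu]_(s in `[A, B]) RL_left_integrand c K t s =
  RL_left_integral c A K t - RL_left_integral c B K t.
Proof.
rewrite in_itv/= => /andP[Bt tb].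
have Ab : A < b by exact: lt_le_trans Bb.
have cK' : {within `[A, b], continuous K}.
  apply: continuous_subspaceW cK => s /=; rewrite !in_itv/= => /andP[As ->].
  by rewrite (le_trans aA).
have tAb : t \in `[A, b] by rewrite in_itv/= tb (le_trans (ltW AB)).
have [i _] := RL_leftE Ab c0 c1 (within_continuous_bounded_measurable cK') tAb.
have [h1 h2] : (BLeft A <= BRight B)%O /\ (BRight B <= BRight t)%O by rewrite !bnd_simp Bt ltW.
have i2 : mu.-integrable `]B, t] (EFin \o RL_left_integrand c K t).
  apply: integrableS i => // s /=; rewrite !in_itv/= => /andP[Bs ->].
  by rewrite andbT ltW// (lt_trans AB).
rewrite /RL_left_integral -(Rintegral_itv_obnd_cbnd i2) -(Rintegral_itvB i h1 h2).
by rewrite opprB addrC subrK.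
Qed.

End truncation.

Section kernel_linearity.
Context {R : realType}.
Notation mu := (@lebesgue_measure R).
Variables (a b c : R).
Hypotheses (ab : a < b) (c0 : 0 <= c) (c1 : c < 1).

Let mab : measurable (`[a, b]%classic : set (measurableTypeR R)).
Proof. exact: measurable_itv. Qed.

Let kernel_integral_lin (k : R -> R) (f g : R -> R) (s t : R) :
  mu.-integrable `[a, b] (EFin \o (fun x => k x * f x)) ->
  mu.-integrable `[a, b] (EFin \o (fun x => k x * g x)) ->
  \int[mu]_(x in `[a, b]) (k x * (s * f x + t * g x)) =
  s * \int[mu]_(x in `[a, b]) (k x * f x) + t * \int[mu]_(x in `[a, b]) (k x * g x).
Proof.
move=> i1 i2; rewrite -!RintegralZl// -RintegralD//.
- by apply: eq_Rintegral => x _; ring.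
- by have := integrableZl mab s i1; apply: eq_integrable.
- by have := integrableZl mab t i2; apply: eq_integrable.
Qed.

Lemma frac_left_lin f g s t x : bounded_measurable a b f -> bounded_measurable a b g ->
  x \in `[a, b] ->
  frac_left a b c (fun z => s * f z + t * g z) x =
  s * frac_left a b c f x + t * frac_left a b c g x.
Proof.
move=> bf bg xab; apply: (@kernel_integral_lin (fun z => kern c (x - z))).
  exact: frac_left_integrable.
exact: frac_left_integrable.
Qed.

Lemma frac_right_lin f g s t x : bounded_measurable a b f -> bounded_measurable a b g ->
  x \in `[a, b] ->
  frac_right a b c (fun z => s * f z + t * g z) x =
  s * frac_right a b c f x + t * frac_right a b c g x.
Proof.
move=> bf bg xab; apply: (@kernel_integral_lin (fun z => kern c (z - x))).
  exact: frac_right_integrable.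
exact: frac_right_integrable.
Qed.

End kernel_linearity.

Section first_variation.
Context {R : realType}.
Notation mu := (@lebesgue_measure R).
Variables (a b A B alpha beta : R).
Hypotheses (ab : a < b) (aA : a <= A) (AB : A < B) (Bb : B <= b).
Hypotheses (al0 : 0 < alpha) (al1 : alpha < 1) (be0 : 0 < beta) (be1 : beta < 1).

Let mAB : measurable (`[A, B]%classic : set (measurableTypeR R)).
Proof. exact: measurable_itv. Qed.

Let mab : measurable (`[a, b]%classic : set (measurableTypeR R)).
Proof. exact: measurable_itv. Qed.

Let ga : R := (Gamma (1 - alpha))^-1.
Let gb : R := - (Gamma (1 - beta))^-1.

(* After fractional integration by parts, the derivative of the functional at y in
   the direction of the primitive of phi is the integral of phi times this function
   ([first_variationE], [functional_expansion]). The term of order c = 0 is the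
   primitive of the second partial derivative. *)
Definition first_variation (F : R -> R -> R -> R -> R) (y : R -> R) (x : R) : R :=
  frac_right a b 0 (along alpha beta a b (partial2 F) y \_ `[A, B]) x +
  ga * frac_right a b alpha (along alpha beta a b (partial3 F) y \_ `[A, B]) x +
  gb * frac_left a b beta (along alpha beta a b (partial4 F) y \_ `[A, B]) x.

Lemma along_continuous G y : fracE alpha beta a b y -> continuous4 a b G ->
  {within `[a, b], continuous (along alpha beta a b G y)}.
Proof.
move=> [acy _ cl _ cr] cG; apply: continuous4_comp => //.
exact: abs_continuous_continuous.
Qed.

Lemma along_trunc_bounded G y : fracE alpha beta a b y -> continuous4 a b G ->
  bounded_measurable a b (along alpha beta a b G y \_ `[A, B]).
Proof.
move=> Ey cG; apply: bounded_measurable_indic; first exact: measurable_itv.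
apply: within_continuous_bounded_measurable; exact: along_continuous.
Qed.

Lemma first_variation_continuous F y : fracE alpha beta a b y -> classC1 a b F ->
  {within `[a, b], continuous (first_variation F y)}.
Proof.
move=> Ey [_ _ [_ cF2 cF3 cF4]].
have c2 := frac_right_continuous ab (lexx 0) ltr01 (along_trunc_bounded Ey cF2).
have c3 := frac_right_continuous ab (ltW al0) al1 (along_trunc_bounded Ey cF3).
have c4 := frac_left_continuous ab (ltW be0) be1 (along_trunc_bounded Ey cF4).
move=> x; apply: cvgD; first apply: cvgD.
- exact: c2.
- by apply: cvgM; [exact: cvg_cst|exact: c3].
- by apply: cvgM; [exact: cvg_cst|exact: c4].
Qed.

Lemma patch_lin3 (S : set R) (h2 h3 h4 u v w : R -> R) (g g' x : R) :
  ((fun x => h2 x * u x + h3 x * (g * v x) + h4 x * (g' * w x)) \_ S) x =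
  (h2 \_ S) x * u x + g * ((h3 \_ S) x * v x) + g' * ((h4 \_ S) x * w x).
Proof.
rewrite !patchE; case: ifPn => _; first by rewrite (mulrCA g) (mulrCA g').
by rewrite !mul0r !mulr0 !addr0.
Qed.

Lemma Rintegral_lin3 (h2 h3 h4 : R -> R) (g g' : R) :
  mu.-integrable `[a, b] (EFin \o h2) -> mu.-integrable `[a, b] (EFin \o h3) ->
  mu.-integrable `[a, b] (EFin \o h4) ->
  \int[mu]_(x in `[a, b]) (h2 x + g * h3 x + g' * h4 x) =
  \int[mu]_(x in `[a, b]) h2 x + g * \int[mu]_(x in `[a, b]) h3 x +
  g' * \int[mu]_(x in `[a, b]) h4 x.
Proof.
move=> i2 i3 i4.
have i3' : mu.-integrable `[a, b] (EFin \o (fun x => g * h3 x)).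
  by have := integrableZl mab g i3; apply: eq_integrable.
have i4' : mu.-integrable `[a, b] (EFin \o (fun x => g' * h4 x)).
  by have := integrableZl mab g' i4; apply: eq_integrable.
have i23 : mu.-integrable `[a, b] (EFin \o (fun x => h2 x + g * h3 x)).
  by have := integrableD mab i2 i3'; apply: eq_integrable.
rewrite (RintegralD mab i23 i4') (RintegralD mab i2 i3').
by rewrite (RintegralZl _ mab i3) (RintegralZl _ mab i4).
Qed.

Lemma by_parts3 (f2 f3 f4 phi : R -> R) :
  bounded_measurable a b f2 -> bounded_measurable a b f3 ->
  bounded_measurable a b f4 -> bounded_measurable a b phi ->
  \int[mu]_(x in `[a, b]) (f2 x * frac_left a b 0 phi x +
    ga * (f3 x * frac_left a b alpha phi x) + gb * (f4 x * frac_right a b beta phi x)) =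
  \int[mu]_(x in `[a, b]) (phi x * (frac_right a b 0 f2 x +
    ga * frac_right a b alpha f3 x + gb * frac_left a b beta f4 x)).
Proof.
move=> b2 b3 b4 bphi.
have int f g : bounded_measurable a b f -> {within `[a, b], continuous g} ->
    mu.-integrable `[a, b] (EFin \o (fun x => f x * g x)).
  move=> bf cg; apply: bounded_measurable_integrable; apply: bounded_measurableM => //.
  exact: within_continuous_bounded_measurable.
have lin3 (u v w u' v' w' : R) : u = u' -> v = v' -> w = w' ->
    u + ga * v + gb * w = u' + ga * v' + gb * w' by move=> -> -> ->.
have cl0 := frac_left_continuous ab (lexx 0) ltr01 bphi.
have cl3 := frac_left_continuous ab (ltW al0) al1 bphi.
have cr4 := frac_right_continuous ab (ltW be0) be1 bphi.
have cr0 := frac_right_continuous ab (lexx 0) ltr01 b2.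
have cr3 := frac_right_continuous ab (ltW al0) al1 b3.
have cl4 := frac_left_continuous ab (ltW be0) be1 b4.
have L1 := Rintegral_lin3 ga gb (int _ _ b2 cl0) (int _ _ b3 cl3) (int _ _ b4 cr4).
have L2 := Rintegral_lin3 ga gb (int _ _ bphi cr0) (int _ _ bphi cr3) (int _ _ bphi cl4).
have E2 := frac_integration_by_parts ab (lexx 0) ltr01 b2 bphi.
have E3 := frac_integration_by_parts ab (ltW al0) al1 b3 bphi.
have E4 := esym (frac_integration_by_parts ab (ltW be0) be1 bphi b4).
apply: (etrans L1); apply: (etrans (lin3 _ _ _ _ _ _ E2 E3 E4)); apply: (etrans (esym L2)).
apply: eq_Rintegral => x _; rewrite [in RHS]mulrDr [in RHS]mulrDr.
by rewrite (mulrCA (phi x) ga) (mulrCA (phi x) gb).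
Qed.

Lemma first_variationE F y phi eta : fracE alpha beta a b y -> classC1 a b F ->
  primitive_of a b phi eta ->
  \int[mu]_(x in `[A, B]) (along alpha beta a b (partial2 F) y x * eta x +
    along alpha beta a b (partial3 F) y x * (ga * frac_left a b alpha phi x) +
    along alpha beta a b (partial4 F) y x * (gb * frac_right a b beta phi x)) =
  \int[mu]_(x in `[a, b]) (phi x * first_variation F y x).
Proof.
move=> Ey [_ _ [_ cF2 cF3 cF4]] pe.
have bphi : bounded_measurable a b phi.
  by apply: within_continuous_bounded_measurable; case: pe.
have b2 := along_trunc_bounded Ey cF2.
have b3 := along_trunc_bounded Ey cF3.
have b4 := along_trunc_bounded Ey cF4.
have ABab : `[A, B]%classic = `[a, b]%classic `&` `[A, B]%classic.
  rewrite setIidr// => s /=; rewrite !in_itv/= => /andP[As sB].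
  by rewrite (le_trans aA)// (le_trans sB).
(* The restriction to [A, B] is moved into the partial derivatives, so that integration by parts
   takes place on [a, b], where the fractional integrals of phi live. *)
rewrite [in LHS]ABab Rintegral_mkcondr.
rewrite /first_variation -(by_parts3 b2 b3 b4 bphi).
apply: eq_Rintegral => x; rewrite inE/= => xab.
by rewrite patch_lin3 (primitive_frac ab pe xab).
Qed.

(** Factor in a supremum bound: a fractional integral vanishes at one endpoint, so the Hoelder
    estimate from there over a length at most [b - a] bounds it. *)
Let kb (c : R) := kern_bound a b c * (b - a) `^ (1 - c).

Let kern_bound_ge0 c : c < 1 -> 0 <= kern_bound a b c.
Proof.
move=> c1; apply: divr_ge0; last by rewrite subr_ge0 ltW.
by apply: mulr_ge0 => //; rewrite addr_ge0// powR_ge0.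
Qed.

Let kb_ge0 c : c < 1 -> 0 <= kb c.
Proof. by move=> c1; apply: mulr_ge0; [exact: kern_bound_ge0|exact: powR_ge0]. Qed.

Let frac_left_bound (c : R) (phi : R -> R) s x : 0 <= c -> c < 1 -> measurable_fun `[a, b] phi ->
  (forall t, t \in `[a, b] -> `|phi t| <= s) -> x \in `[a, b] ->
  `|frac_left a b c phi x| <= s * kb c.
Proof.
move=> c0 c1 mphi ps xab.
have aab : a \in `[a, b] by rewrite in_itv/= lexx ltW.
have := frac_left_dist ab c0 c1 mphi ps aab xab.
rewrite frac_left_a subr0 => /le_trans; apply.
have s0 : 0 <= s by rewrite (le_trans _ (ps a aab)).
apply: ler_wpM2l => //; apply: ler_wpM2l; first exact: kern_bound_ge0.
move: xab; rewrite in_itv/= => /andP[ax xb].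
rewrite ge0_ler_powR ?nnegrE ?subr_ge0 ?(ltW c1) ?(ltW ab)//.
by rewrite ger0_norm ?subr_ge0// lerD2r.
Qed.

Let frac_right_bound (c : R) (phi : R -> R) s x : 0 <= c -> c < 1 -> measurable_fun `[a, b] phi ->
  (forall t, t \in `[a, b] -> `|phi t| <= s) -> x \in `[a, b] ->
  `|frac_right a b c phi x| <= s * kb c.
Proof.
move=> c0 c1 mphi ps xab.
have bab : b \in `[a, b] by rewrite in_itv/= lexx ltW.
have := frac_right_dist ab c0 c1 mphi ps bab xab.
rewrite frac_right_b subr0 => /le_trans; apply.
have s0 : 0 <= s by rewrite (le_trans _ (ps b bab)).
apply: ler_wpM2l => //; apply: ler_wpM2l; first exact: kern_bound_ge0.
move: xab; rewrite in_itv/= => /andP[ax xb].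
rewrite ge0_ler_powR ?nnegrE ?subr_ge0 ?(ltW c1) ?(ltW ab)//.
by rewrite ler0_norm ?subr_le0// opprB lerD2l lerN2.
Qed.

(** The estimate is uniform over densities bounded by s, hence usable for combinations of several
    directions with varying coefficients. *)
Lemma functional_expansion F y : fracE alpha beta a b y -> classC1 a b F ->
  forall e, 0 < e -> exists2 d, 0 < d &
  forall phi eta s, primitive_of a b phi eta ->
    (forall x, x \in `[a, b] -> `|phi x| <= s) -> s < d ->
  `|functional alpha beta a b A B F (y \+ eta) - functional alpha beta a b A B F y -
    \int[mu]_(x in `[a, b]) (phi x * first_variation F y x)| <= e * s.
Proof.
move=> Ey C1F e e0; have [acy cly cl cry cr] := Ey.
(* [s * K] bounds the sum of the perturbations of y and of its two Caputo derivatives. *)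
pose K := kb 0 + `|ga| * kb alpha + `|gb| * kb beta.
have K0 : 0 <= K.
  have gk (g c : R) : c < 1 -> 0 <= `|g| * kb c.
    by move=> c1; apply: mulr_ge0 => //; exact: kb_ge0.
  by apply: addr_ge0; [apply: addr_ge0; [exact: kb_ge0|exact: gk]|exact: gk].
have K1 : 0 < K + 1 by rewrite ltr_wpDl.
have eK : 0 < e / (K + 1) by rewrite divr_gt0.
have cy := abs_continuous_continuous acy.
have [d d0 Hd] := first_order_integral cy cl cr C1F aA AB Bb eK.
exists (d / (K + 1)); first by rewrite divr_gt0.
move=> phi eta s pe ps; rewrite ltr_pdivlMr// => sd.
have aab : a \in `[a, b] by rewrite in_itv/= lexx ltW.
have s0 : 0 <= s by rewrite (le_trans _ (ps a aab)).
have bphi : bounded_measurable a b phi.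
  by apply: within_continuous_bounded_measurable; case: pe.
have [mphi _] := bphi.
have [_ clE] := caputo_left_add_primitive ab acy pe al0 al1 cly.
have [_ crE] := caputo_right_add_primitive ab acy pe be0 be1 cry.
rewrite -(first_variationE Ey C1F pe).
have -> : functional alpha beta a b A B F (y \+ eta) =
  \int[mu]_(x in `[A, B]) F x (y x + eta x)
    (caputo_left alpha a y x + ga * frac_left a b alpha phi x)
    (caputo_right beta b y x + gb * frac_right a b beta phi x).
  apply: eq_Rintegral => x; rewrite inE/= in_itv/= => /andP[Ax xB].
  have xab : x \in `[a, b] by rewrite in_itv/= (le_trans aA)// (le_trans xB).
  by rewrite /along clE// crE.
have := Hd eta (fun x => ga * frac_left a b alpha phi x)
  (fun x => gb * frac_right a b beta phi x) (s * K).
have c1 : {within `[a, b], continuous eta}.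
  apply: (@eq_within_continuous _ (frac_left a b 0 phi)).
    by move=> t tab; rewrite (primitive_frac ab pe tab).
  exact: frac_left_continuous.
have c2 : {within `[a, b], continuous (fun x => ga * frac_left a b alpha phi x)}.
  have := frac_left_continuous ab (ltW al0) al1 bphi => H x.
  by apply: cvgM; [exact: cvg_cst|exact: H].
have c3 : {within `[a, b], continuous (fun x => gb * frac_right a b beta phi x)}.
  have := frac_right_continuous ab (ltW be0) be1 bphi => H x.
  by apply: cvgM; [exact: cvg_cst|exact: H].
move=> /(_ c1 c2 c3).
have sK : s * K <= s * (K + 1) by rewrite ler_wpM2l// lerDl.
move=> /(_ (le_lt_trans sK sd)) H.
have {}H := H _; apply: le_trans (H _) _; last first.
  apply: (@le_trans _ _ (e / (K + 1) * (s * (K + 1)))); first by rewrite ler_pM2l.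
  by rewrite [s * _]mulrC mulrA divfK ?gt_eqF.
move=> x xab; rewrite /K !mulrDr; apply: lerD; first apply: lerD.
- rewrite (primitive_frac ab pe xab); exact: frac_left_bound.
- rewrite normrM mulrCA ler_wpM2l//; apply: frac_left_bound => //; exact: ltW.
- rewrite normrM mulrCA ler_wpM2l//; apply: frac_right_bound => //; exact: ltW.
Qed.

End first_variation.

(** * Existence of multipliers *)

Section multipliers.
Context {R : realType}.
Notation mu := (@lebesgue_measure R).
Variables (a b A B alpha beta : R).
Hypotheses (ab : a < b) (aA : a <= A) (AB : A < B) (Bb : B <= b).
Hypotheses (al0 : 0 < alpha) (al1 : alpha < 1) (be0 : 0 < beta) (be1 : beta < 1).

Notation E := (fracE alpha beta a b).
Notation fv := (first_variation a b A B alpha beta).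
Notation Fn := (functional alpha beta a b A B).
Notation ip f g := (\int[mu]_(x in `[a, b]) (f x * g x)).

Let mab : measurable (`[a, b]%classic : set (measurableTypeR R)).
Proof. exact: measurable_itv. Qed.

Let integrable_mul (f g : R -> R) : {within `[a, b], continuous f} ->
  {within `[a, b], continuous g} ->
  mu.-integrable `[a, b] (EFin \o (fun x => f x * g x)).
Proof.
move=> cf cg; apply: bounded_measurable_integrable; apply: bounded_measurableM;
exact: within_continuous_bounded_measurable.
Qed.

Let ip_lin (f g h : R -> R) s t : {within `[a, b], continuous f} ->
  {within `[a, b], continuous g} -> {within `[a, b], continuous h} ->
  ip (fun x => s * f x + t * g x) h = s * ip f h + t * ip g h.
Proof.
move=> cf cg ch.
have i1 := integrable_mul cf ch; have i2 := integrable_mul cg ch.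
have i1' : mu.-integrable `[a, b] (EFin \o (fun x => s * (f x * h x))).
  by have := integrableZl mab s i1; apply: eq_integrable.
have i2' : mu.-integrable `[a, b] (EFin \o (fun x => t * (g x * h x))).
  by have := integrableZl mab t i2; apply: eq_integrable.
rewrite -(RintegralZl _ mab i1) -(RintegralZl _ mab i2) -(RintegralD mab i1' i2').
by apply: eq_Rintegral => x _; rewrite mulrDl !mulrA.
Qed.

(** The expansion is applied at the moving point [y \+ t0 \*: eta], which again lies in the space:
    differentiability along the line at t0 gives continuity there. An expansion at y alone would
    give continuity at a single point, too little for the intermediate value theorem. *)
Lemma functional_continuous_line F y phi eta : E y -> classC1 a b F ->
  primitive_of a b phi eta -> forall p q,
  {within `[p, q], continuous (fun t => Fn F (y \+ t \*: eta))}.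
Proof.
move=> Ey C1F pe p q; apply/within_continuous_distP => t0 _ e e0.
have pt0 := primitive_ofZ t0 pe.
have Ey0 := fracE_add_primitive ab al0 al1 be0 be1 Ey pt0.
have [d d0 Hd] := functional_expansion ab aA AB Bb al0 al1 be0 be1 Ey0 C1F ltr01.
have cphi := pe.1; have [_ [K0 phiK]] := within_continuous_bounded_measurable cphi.
have cfv : {within `[a, b], continuous (fv F (y \+ t0 \*: eta))} := first_variation_continuous ab al0 al1 be0 be1 Ey0 C1F.
set D := ip phi (fv F (y \+ t0 \*: eta)).
pose K := `|K0| + 1; have Kpos : 0 < K by rewrite ltr_wpDl.
have DK : 0 < `|D| + K by rewrite ltr_wpDl.
exists (Num.min (d / K) (e / (`|D| + K))); first by rewrite lt_min !divr_gt0.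
move=> t _; rewrite lt_min !ltr_pdivlMr// => /andP[td te].
have := Hd _ _ (`|t - t0| * K) (primitive_ofZ (t - t0) pe) _ td.
have -> : (y \+ t0 \*: eta) \+ (t - t0) \*: eta = y \+ t \*: eta.
  by apply/funext => x /=; rewrite -addrA -scalerDl addrCA subrr addr0.
have -> : ip (fun x => (t - t0) * phi x) (fv F (y \+ t0 \*: eta)) = (t - t0) * D.
  have := @ip_lin phi phi (fv F (y \+ t0 \*: eta)) (t - t0) 0 cphi cphi cfv.
  rewrite mul0r addr0 => <-; apply: eq_Rintegral => x _.
  by rewrite mul0r addr0.
rewrite mul1r => H; have {}H := H _.
apply: (le_lt_trans _ te).
have -> : Fn F (y \+ t \*: eta) - Fn F (y \+ t0 \*: eta) =
  (t - t0) * D + (Fn F (y \+ t \*: eta) - Fn F (y \+ t0 \*: eta) - (t - t0) * D).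
  by rewrite [RHS]addrC subrK.
rewrite (le_trans (ler_normD _ _))// mulrDr lerD//.
  by rewrite normrM.
apply: H => x xab; rewrite normrM ler_wpM2l//.
by rewrite (le_trans (phiK x xab))// (le_trans (ler_norm _))// lerDl.
Qed.

Let add3 (y e1 e2 : R -> R) s t :
  (y \+ s \*: e1) \+ t \*: e2 = y \+ (s \*: e1 \+ t \*: e2).
Proof. by apply/funext => x /=; rewrite addrA. Qed.

Lemma functional_first_order F y phi1 eta1 phi2 eta2 : E y -> classC1 a b F ->
  primitive_of a b phi1 eta1 -> primitive_of a b phi2 eta2 ->
  first_order_at (fun s t => Fn F (y \+ (s \*: eta1 \+ t \*: eta2)))
    (ip phi1 (fv F y)) (ip phi2 (fv F y)).
Proof.
move=> Ey C1F pe1 pe2 e e0.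
have c1 := pe1.1; have [_ [K1 phiK1]] := within_continuous_bounded_measurable c1.
have c2 := pe2.1; have [_ [K2 phiK2]] := within_continuous_bounded_measurable c2.
have cfv : {within `[a, b], continuous (fv F y)} := first_variation_continuous ab al0 al1 be0 be1 Ey C1F.
pose K := `|K1| + `|K2| + 1; have Kpos : 0 < K by rewrite ltr_wpDl// addr_ge0.
have eK : 0 < e / K by rewrite divr_gt0.
have [d d0 Hd] := functional_expansion ab aA AB Bb al0 al1 be0 be1 Ey C1F eK.
exists (d / K); first by rewrite divr_gt0.
move=> s t; rewrite ltr_pdivlMr// => std.
have := Hd _ _ ((`|s| + `|t|) * K)
  (primitive_ofD (primitive_ofZ s pe1) (primitive_ofZ t pe2)) _ std.
rewrite ip_lin//.
have -> : y \+ (0 \*: eta1 \+ 0 \*: eta2) = y.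
  by apply/funext => x /=; rewrite !scale0r !addr0.
have -> : e / K * ((`|s| + `|t|) * K) = e * (`|s| + `|t|).
  by rewrite [(_ + _) * K]mulrC mulrA divfK// gt_eqF.
apply => x xab; rewrite (le_trans (ler_normD _ _))// mulrDl !normrM lerD// ler_wpM2l//.
  rewrite (le_trans (phiK1 x xab))// (le_trans (ler_norm _))// /K -addrA lerDl.
  by rewrite addr_ge0.
rewrite (le_trans (phiK2 x xab))// (le_trans (ler_norm _))// /K addrAC lerDr.
by rewrite addr_ge0.
Qed.

Let weighted_sum_lt (u v n1 n2 d : R) : 0 <= u -> 0 <= v -> 0 <= n1 -> 0 <= n2 ->
  u + v < d / (n1 + n2 + 1) -> u * n1 + v * n2 < d.
Proof.
move=> u0 v0 n10 n20; rewrite ltr_pdivlMr ?ltr_wpDl ?addr_ge0//; apply: le_lt_trans.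
by nra.
Qed.

Let ipC (f h : R -> R) : ip f h = ip h f.
Proof. by apply: eq_Rintegral => x _; rewrite mulrC. Qed.

Let ip1 (f : R -> R) : \int[mu]_(x in `[a, b]) f x = ip f (cst 1).
Proof. by apply: eq_Rintegral => x _; rewrite /= mulr1. Qed.

Let ipB (f g h : R -> R) c : {within `[a, b], continuous f} ->
  {within `[a, b], continuous g} -> {within `[a, b], continuous h} ->
  ip (fun x => f x - c * g x) h = ip f h - c * ip g h.
Proof.
move=> cf cg ch; rewrite -mulNr -[ip f h]mul1r -ip_lin//.
by apply: eq_Rintegral => x _; rewrite mul1r mulNr.
Qed.

Let continuousB (f h : R -> R) c : {within `[a, b], continuous f} ->
  {within `[a, b], continuous h} ->
  {within `[a, b], continuous (fun x => f x - c * h x)}.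
Proof.
move=> cf ch x; apply: cvgB; first exact: cf.
by apply: cvgM; [exact: cvg_cst|exact: ch].
Qed.

Let continuous1 : {within `[a, b], continuous (cst 1 : R -> R)}.
Proof. by move=> x; exact: cvg_cst. Qed.

(** Removing the mean projects orthogonally to the constants: densities of mean zero pair alike with
    f and with its centered part, and the centered part is itself such a density. *)
Let mean (f : R -> R) := ip f (cst 1) / (b - a).
Let center (f : R -> R) x := f x - mean f * (cst 1 : R -> R) x.

Let continuous_center (f : R -> R) : {within `[a, b], continuous f} ->
  {within `[a, b], continuous (center f)}.
Proof. by move=> cf; exact: continuousB. Qed.

Let ip_center1 (f : R -> R) : {within `[a, b], continuous f} ->
  ip (center f) (cst 1) = 0.
Proof.
move=> cf; rewrite /center ipB// -[ip (cst 1) _]ip1 Rintegral_cst//=.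
rewrite lebesgue_measure_itv/= lte_fin ab/= mul1r /mean divfK ?subrr//.
by rewrite subr_eq0 gt_eqF.
Qed.

Let ip_center (f h : R -> R) : {within `[a, b], continuous f} ->
  {within `[a, b], continuous h} -> ip h (cst 1) = 0 -> ip h (center f) = ip h f.
Proof.
by move=> cf ch h0; rewrite ipC /center ipB// [X in _ * X]ipC h0 mulr0 subr0 ipC.
Qed.

(* If g is not zero, the component of f orthogonal to g is a direction along which
   the constraint is stationary. *)
Let centered_multipliers (f g : R -> R) : {within `[a, b], continuous f} ->
  {within `[a, b], continuous g} -> ip f (cst 1) = 0 -> ip g (cst 1) = 0 ->
  (forall phi1 phi2 : R -> R, {within `[a, b], continuous phi1} ->
    {within `[a, b], continuous phi2} -> ip phi1 (cst 1) = 0 ->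
    ip phi2 (cst 1) = 0 -> ip phi1 g = 0 -> ip phi2 g != 0 -> ip phi1 f = 0) ->
  exists s t : R, ~ (s = 0 /\ t = 0) /\
    forall x, x \in `[a, b] -> s * f x + t * g x = 0.
Proof.
move=> cf cg f1 g1 H.
have [gg0|gg0] := eqVneq (ip g g) 0.
  (* Abnormal case: g vanishes identically, and the multiplier of f is 0. *)
  exists 0, 1; split; first by case=> _ /eqP; rewrite oner_eq0.
  by move=> x xab; rewrite mul0r add0r mul1r (Rintegral_sqr_eq0 ab cg gg0).
pose c := ip f g / ip g g.
pose w x := f x - c * g x.
have cw : {within `[a, b], continuous w} := @continuousB f g c cf cg.
have w1 : ip w (cst 1) = 0 by rewrite /w ipB// f1 g1 mulr0 subrr.
have wg : ip w g = 0 by rewrite /w ipB// /c divfK// subrr.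
(* Here w is the first density and g the second, admissible because its pairing with itself is
   nonzero. *)
have wf : ip w f = 0 := H _ _ cw cg w1 g1 wg gg0.
have ww : ip w w = 0.
  by rewrite {1}/w ipB// [ip f w]ipC [ip g w]ipC wf wg mulr0 subrr.
exists 1, (- c); split; first by case=> /eqP; rewrite oner_eq0.
by move=> x xab; rewrite mul1r mulNr; exact: (Rintegral_sqr_eq0 ab cw ww xab).
Qed.

Let uncenter (s t u v m n : R) :
  s * (u - m * 1) + t * (v - n * 1) = 0 -> s * u + t * v = s * m + t * n.
Proof. by move=> ?; lra. Qed.

Variables (ya yb l : R) (L g : R -> R -> R -> R -> R) (N : (R -> R) -> R) (y : R -> R).
Hypotheses (hL : classC1 a b L) (hg : classC1 a b g) (hN : is_norm_on a b E N)
  (hmin : local_min E N (Fn L)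
       [set z | [/\ z a = ya, z b = yb & Fn g z = l]] y).

Let Ey : E y. Proof. by case: hmin. Qed.

Let cL : {within `[a, b], continuous (fv L y)}.
Proof. exact: first_variation_continuous. Qed.

Let cg : {within `[a, b], continuous (fv g y)}.
Proof. exact: first_variation_continuous. Qed.

(** Primitives of densities of mean zero vanish at a and b, so the whole plane of competitors meets
    the boundary conditions. Only the integral constraint has to be restored, by means of the second
    direction. *)
Lemma no_descent_direction phi1 phi2 :
  {within `[a, b], continuous phi1} -> {within `[a, b], continuous phi2} ->
  \int[mu]_(x in `[a, b]) phi1 x = 0 -> \int[mu]_(x in `[a, b]) phi2 x = 0 ->
  ip phi1 (fv g y) = 0 -> ip phi2 (fv g y) != 0 -> ip phi1 (fv L y) = 0.
Proof.
move=> c1 c2 int1 int2 i1 i20; apply/eqP/negP => /negP j10.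
pose eta1 x := \int[mu]_(t in `[a, x]) phi1 t.
pose eta2 x := \int[mu]_(t in `[a, x]) phi2 t.
have pe1 : primitive_of a b phi1 eta1 by [].
have pe2 : primitive_of a b phi2 eta2 by [].
have E1 := fracE_primitive ab al0 al1 be0 be1 pe1.
have E2 := fracE_primitive ab al0 al1 be0 be1 pe2.
have [N0 _ NZ ND] := hN.
have [_ [yae ybe yl] [d d0 Hd]] := hmin.
have M0 : 0 < N eta1 + N eta2 + 1 by rewrite ltr_wpDl// addr_ge0 ?N0.
have FI := functional_first_order Ey hg pe1 pe2; rewrite i1 in FI.
have FJ := functional_first_order Ey hL pe1 pe2.
have cI s p q : {within `[p, q], continuous
    (fun t => Fn g (y \+ (s \*: eta1 \+ t \*: eta2)))}.
  have Es := fracE_add_primitive ab al0 al1 be0 be1 Ey (primitive_ofZ s pe1).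
  have lineE : (fun t => Fn g ((y \+ s \*: eta1) \+ t \*: eta2)) =
      (fun t => Fn g (y \+ (s \*: eta1 \+ t \*: eta2))).
    by apply/funext => t; rewrite add3.
  rewrite -lineE; exact: (@functional_continuous_line g _ phi2 eta2 Es hg pe2 p q).
(* If |s| + |t| is below this radius, then |s| N eta1 + |t| N eta2 is below d; the summand 1 keeps
   the denominator positive. *)
have dM : 0 < d / (N eta1 + N eta2 + 1) by rewrite divr_gt0.
have [s [t [st Ist Jst]]] := two_parameter_descent FJ FI cI j10 i20 dM.
have y0E : y \+ (0 \*: eta1 \+ 0 \*: eta2) = y.
  by apply/funext => x /=; rewrite !scale0r !addr0.
rewrite y0E in Ist Jst.
pose y1 := y \+ (s \*: eta1 \+ t \*: eta2).
have Ey1 : E y1 := fracE_add_primitive ab al0 al1 be0 be1 Ey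
  (primitive_ofD (primitive_ofZ s pe1) (primitive_ofZ t pe2)).
have Cy1 : [/\ y1 a = ya, y1 b = yb & Fn g y1 = l].
  split; last by rewrite Ist.
  - rewrite /y1 /= (primitive_left ab pe1) (primitive_left ab pe2) !scaler0 !addr0.
    exact: yae.
  - by rewrite /y1 /= /eta1 /eta2 int1 int2 !scaler0 !addr0.
have : N (y \- y1) < d.
  have -> : y \- y1 = (- s) \*: eta1 \+ (- t) \*: eta2.
    by apply/funext => x; rewrite /y1 /= opprD addrA subrr sub0r opprD !scaleNr.
  have Es := fracE_primitive ab al0 al1 be0 be1 (primitive_ofZ (- s) pe1).
  have Et := fracE_primitive ab al0 al1 be0 be1 (primitive_ofZ (- t) pe2).
  have NDst : N ((- s) \*: eta1 \+ (- t) \*: eta2) <=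
      N ((- s) \*: eta1) + N ((- t) \*: eta2) := ND _ _ Es Et.
  rewrite (NZ _ _ E1) (NZ _ _ E2) !normrN in NDst.
  apply: (le_lt_trans NDst).
  exact: (weighted_sum_lt (normr_ge0 s) (normr_ge0 t) (N0 _ E1) (N0 _ E2) st).
by move=> /(Hd y1 Ey1 Cy1); rewrite leNgt Jst.
Qed.

Lemma multipliers : exists lam0 lam : R, ~ (lam0 = 0 /\ lam = 0) /\
  exists C, forall x, x \in `[a, b] -> lam0 * fv L y x + lam * fv g y x = C.
Proof.
have [s [t [st Hst]]] := centered_multipliers (continuous_center cL)
  (continuous_center cg) (ip_center1 cL) (ip_center1 cg)
  (fun phi1 phi2 cp1 cp2 i1 i2 o1 o2 => etrans (ip_center cL cp1 i1)
    (no_descent_direction cp1 cp2 (etrans (ip1 phi1) i1) (etrans (ip1 phi2) i2)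
      (etrans (esym (ip_center cg cp1 i1)) o1)
      (etrans (congr1 (fun r => r != 0) (esym (ip_center cg cp2 i2))) o2))).
(* Undoing the centering turns a vanishing combination into a constant one, the means supplying the
   constant. *)
exists s, t; split=> //; exists (s * mean (fv L y) + t * mean (fv g y)) => x xab.
exact: uncenter (Hst x xab).
Qed.

End multipliers.

Section euler_lagrange.
Context {R : realType}.
Notation mu := (@lebesgue_measure R).

Lemma RL_right_integral0 (q : R) (f : R -> R) x :
  RL_right_integral 0 q f x = \int[mu]_(t in `[x, q]) f t.
Proof.
by apply: eq_Rintegral => t _; rewrite /RL_right_integrand oppr0 powRr0 mul1r.
Qed.

Lemma RL_right_integral_lin (c q s t x : R) (f g h : R -> R) :
  mu.-integrable `[x, q] (EFin \o RL_right_integrand c f x) ->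
  mu.-integrable `[x, q] (EFin \o RL_right_integrand c g x) ->
  (forall z, z \in `[x, q] -> h z = s * f z + t * g z) ->
  RL_right_integral c q h x =
  s * RL_right_integral c q f x + t * RL_right_integral c q g x.
Proof.
move=> i1 i2 hE.
have mxq : measurable (`[x, q]%classic : set (measurableTypeR R)) by exact: measurable_itv.
have j1 : mu.-integrable `[x, q] (EFin \o (fun z => s * RL_right_integrand c f x z)).
  by have := integrableZl mxq s i1; apply: eq_integrable.
have j2 : mu.-integrable `[x, q] (EFin \o (fun z => t * RL_right_integrand c g x z)).
  by have := integrableZl mxq t i2; apply: eq_integrable.
rewrite /RL_right_integral -(RintegralZl _ mxq i1) -(RintegralZl _ mxq i2).
rewrite -(RintegralD mxq j1 j2); apply: eq_Rintegral => z; rewrite inE/= => zxq.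
by rewrite /RL_right_integrand hE// mulrDr (mulrCA s) (mulrCA t).
Qed.

Lemma RL_left_integral_lin (c p s t x : R) (f g h : R -> R) :
  mu.-integrable `[p, x] (EFin \o RL_left_integrand c f x) ->
  mu.-integrable `[p, x] (EFin \o RL_left_integrand c g x) ->
  (forall z, z \in `[p, x] -> h z = s * f z + t * g z) ->
  RL_left_integral c p h x =
  s * RL_left_integral c p f x + t * RL_left_integral c p g x.
Proof.
move=> i1 i2 hE.
have mxq : measurable (`[p, x]%classic : set (measurableTypeR R)) by exact: measurable_itv.
have j1 : mu.-integrable `[p, x] (EFin \o (fun z => s * RL_left_integrand c f x z)).
  by have := integrableZl mxq s i1; apply: eq_integrable.
have j2 : mu.-integrable `[p, x] (EFin \o (fun z => t * RL_left_integrand c g x z)).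
  by have := integrableZl mxq t i2; apply: eq_integrable.
rewrite /RL_left_integral -(RintegralZl _ mxq i1) -(RintegralZl _ mxq i2).
rewrite -(RintegralD mxq j1 j2); apply: eq_Rintegral => z; rewrite inE/= => zxq.
by rewrite /RL_left_integrand hE// mulrDr (mulrCA s) (mulrCA t).
Qed.

Lemma derivable_within_RL_right_lin (c p q s t : R) (f g h : R -> R) :
  p < q -> (forall x, x \in `[p, q] -> RL_right_ex c p q f x) ->
  (forall x, x \in `[p, q] -> RL_right_ex c p q g x) ->
  (forall z, z \in `[p, q] -> h z = s * f z + t * g z) ->
  forall x, x \in `[p, q] -> derivable_within `[p, q] (RL_right_integral c q h) x.
Proof.
move=> pq exf exg hE x xpq.
have D1 := derivable_within_has_deriv (exf x xpq).2.
have D2 := derivable_within_has_deriv (exg x xpq).2.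
have D12 := has_deriv_withinD (has_deriv_withinZ s D1) (has_deriv_withinZ t D2).
have E z : z \in `[p, q] -> s * RL_right_integral c q f z + t * RL_right_integral c q g z =
    RL_right_integral c q h z.
  move=> zpq; apply: esym; apply: RL_right_integral_lin.
  - exact: (exf z zpq).1.
  - exact: (exg z zpq).1.
  - move=> w; rewrite in_itv/= => /andP[zw wq]; apply: hE.
    by move: zpq; rewrite !in_itv/= => /andP[pz _]; rewrite (le_trans pz).
exact: (has_deriv_derivable_within pq xpq (eq_has_deriv_within xpq E D12)).1.
Qed.

Lemma derivable_within_RL_left_lin (c p q s t : R) (f g h : R -> R) :
  p < q -> (forall x, x \in `[p, q] -> RL_left_ex c p q f x) ->
  (forall x, x \in `[p, q] -> RL_left_ex c p q g x) ->
  (forall z, z \in `[p, q] -> h z = s * f z + t * g z) ->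
  forall x, x \in `[p, q] -> derivable_within `[p, q] (RL_left_integral c p h) x.
Proof.
move=> pq exf exg hE x xpq.
have D1 := derivable_within_has_deriv (exf x xpq).2.
have D2 := derivable_within_has_deriv (exg x xpq).2.
have D12 := has_deriv_withinD (has_deriv_withinZ s D1) (has_deriv_withinZ t D2).
have E z : z \in `[p, q] -> s * RL_left_integral c p f z + t * RL_left_integral c p g z =
    RL_left_integral c p h z.
  move=> zpq; apply: esym; apply: RL_left_integral_lin.
  - exact: (exf z zpq).1.
  - exact: (exg z zpq).1.
  - move=> w; rewrite in_itv/= => /andP[pw wz]; apply: hE.
    by move: zpq; rewrite !in_itv/= => /andP[_ zq]; rewrite pw (le_trans wz).
exact: (has_deriv_derivable_within pq xpq (eq_has_deriv_within xpq E D12)).1.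
Qed.

Let lin3_eq (k k' : R) u v w u' v' w' C : u = u' -> v = v' -> w = w' ->
  u + k * v + k' * w = C -> u' + k * v' + k' * w' = C.
Proof. by move=> -> -> ->. Qed.

Let solve_right (k u v w d : R) : k != 0 -> u + k * (v - w) = d ->
  w = v + (u - d) / k.
Proof. by move=> k0 <-; field. Qed.

Let oppr_lin3_eq0 (k k' u v w : R) : - u + k * v + - k' * w = 0 ->
  u + - k * v + k' * w = 0.
Proof. by move=> ?; lra. Qed.

Variables (a b A B alpha beta C : R) (K2 K3 K4 : R -> R).
Hypotheses (ab : a < b) (aA : a <= A) (AB : A < B) (Bb : B <= b).
Hypotheses (al0 : 0 < alpha) (al1 : alpha < 1) (be0 : 0 < beta) (be1 : beta < 1).
Hypotheses (cK2 : {within `[a, b], continuous K2})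
  (cK3 : {within `[a, b], continuous K3}) (cK4 : {within `[a, b], continuous K4}).
Let ga : R := (Gamma (1 - alpha))^-1.
Let gb : R := - (Gamma (1 - beta))^-1.
Hypothesis constE : forall t, t \in `[a, b] ->
  frac_right a b 0 (K2 \_ `[A, B]) t + ga * frac_right a b alpha (K3 \_ `[A, B]) t +
  gb * frac_left a b beta (K4 \_ `[A, B]) t = C.
Hypothesis dK3 : forall x, x \in `[a, B] ->
  derivable_within `[a, B] (RL_right_integral alpha B K3) x.
Hypothesis dK4 : forall x, x \in `[A, b] ->
  derivable_within `[A, b] (RL_left_integral beta A K4) x.

Let trunc_bounded (f : R -> R) : {within `[a, b], continuous f} ->
  bounded_measurable a b (f \_ `[A, B]).
Proof.
move=> cf; apply: bounded_measurable_indic; first exact: measurable_itv.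
exact: within_continuous_bounded_measurable.
Qed.

Let constRL t : t \in `[a, b] ->
  RL_right_integral 0 b (K2 \_ `[A, B]) t +
  ga * RL_right_integral alpha b (K3 \_ `[A, B]) t +
  gb * RL_left_integral beta a (K4 \_ `[A, B]) t = C.
Proof.
move=> tab; apply: lin3_eq (constE tab).
- exact: esym (RL_rightE ab (lexx 0) ltr01 (trunc_bounded cK2) tab).2.
- exact: esym (RL_rightE ab (ltW al0) al1 (trunc_bounded cK3) tab).2.
- exact: esym (RL_leftE ab (ltW be0) be1 (trunc_bounded cK4) tab).2.
Qed.

Let RL_right_exP q x : a < q -> q <= b -> x \in `[a, q] ->
  derivable_within `[a, q] (RL_right_integral alpha q K3) x ->
  RL_right_ex alpha a q K3 x.
Proof.
move=> aq qb xaq dx; split=> // z zaq.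
have cK : {within `[a, q], continuous K3}.
  apply: continuous_subspaceW cK3 => s /=; rewrite !in_itv/= => /andP[-> sq].
  exact: le_trans qb.
exact: (RL_rightE aq (ltW al0) al1 (within_continuous_bounded_measurable cK) zaq).1.
Qed.

Let RL_left_exP p x : a <= p -> p < b -> x \in `[p, b] ->
  derivable_within `[p, b] (RL_left_integral beta p K4) x ->
  RL_left_ex beta p b K4 x.
Proof.
move=> ap pb xpb dx; split=> // z zpb.
have cK : {within `[p, b], continuous K4}.
  apply: continuous_subspaceW cK4 => s /=; rewrite !in_itv/= => /andP[ps ->].
  by rewrite (le_trans ap).
exact: (RL_leftE pb (ltW be0) be1 (within_continuous_bounded_measurable cK) zpb).1.
Qed.

Let sub_aB : `[A, B]%classic `<=` `[a, B]%classic.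
Proof. by move=> s /=; rewrite !in_itv/= => /andP[As ->]; rewrite (le_trans aA). Qed.

Let sub_Ab : `[A, B]%classic `<=` `[A, b]%classic.
Proof. by move=> s /=; rewrite !in_itv/= => /andP[-> sB]; rewrite (le_trans sB). Qed.

(** The operators of the statement differentiate relative to the larger intervals [a, B] and [A, b].
    These derivatives restrict to [A, B] with the same values, also at A and B, so the constant
    identity can be differentiated there. *)
Lemma euler_lagrange_mid x : x \in `[A, B] ->
  [/\ RL_right_ex alpha a B K3 x, RL_left_ex beta A b K4 x &
      K2 x + RL_right alpha a B K3 x + RL_left beta A b K4 x = 0].
Proof.
move=> xAB; have xaB : x \in `[a, B] by exact: sub_aB.
have xAb : x \in `[A, b] by exact: sub_Ab.
have aB : a < B := le_lt_trans aA AB; have Ab : A < b := lt_le_trans AB Bb.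
split; [exact: (RL_right_exP aB Bb xaB (dK3 xaB))|
        exact: (RL_left_exP aA Ab xAb (dK4 xAb))|].
have D3 := has_deriv_withinS sub_aB (derivable_within_has_deriv (dK3 xaB)).
have D4 := has_deriv_withinS sub_Ab (derivable_within_has_deriv (dK4 xAb)).
have cK : {within `[A, B], continuous K2}.
  apply: continuous_subspaceW cK2 => s /=; rewrite !in_itv/= => /andP[As sB].
  by rewrite (le_trans aA)// (le_trans sB).
have D2 := right_integral_has_deriv AB cK xAB.
have D := has_deriv_withinD (has_deriv_withinD D2 (has_deriv_withinZ ga D3))
  (has_deriv_withinZ gb D4).
have E t : t \in `[A, B] -> \int[mu]_(s in `[t, B]) K2 s +
    ga * RL_right_integral alpha B K3 t + gb * RL_left_integral beta A K4 t = C.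
  move=> tAB; have tab : t \in `[a, b].
    move: tAB; rewrite !in_itv/= => /andP[At tB].
    by rewrite (le_trans aA)// (le_trans tB).
  apply: lin3_eq (constRL tab).
  - by rewrite RL_right_trunc_mid// RL_right_integral0.
  - by rewrite RL_right_trunc_mid.
  - by rewrite RL_left_trunc_mid.
have := has_deriv_within_unique AB xAB (eq_has_deriv_within xAB E D)
  (@has_deriv_within_cst R `[A, B] x C).
(* Differentiating in the lower limit gives [- K2 x]; negating the identity restores the signs in
   [RL_right] and [RL_left]. *)
exact: oppr_lin3_eq0.
Qed.

(** To the left of A the K4 term vanishes and the K2 term is the full integral over [A, B], so the
    two right integrals of K3 differ by the constant k. Existence of the derivative of the one based
    at A is thus deduced from the one based at B. *)
Lemma euler_lagrange_left x : a < A -> x \in `[a, A] ->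
  [/\ RL_right_ex alpha a B K3 x, RL_right_ex alpha a A K3 x &
      RL_right alpha a B K3 x - RL_right alpha a A K3 x = 0].
Proof.
move=> ltaA xaA; have aB : a < B := le_lt_trans aA AB.
have sub : `[a, A]%classic `<=` `[a, B]%classic.
  by move=> s /=; rewrite !in_itv/= => /andP[-> sA]; rewrite (le_trans sA)// ltW.
have xaB : x \in `[a, B] by exact: sub.
have Ab : A <= b := ltW (lt_le_trans AB Bb).
have ga0 : ga != 0 by rewrite invr_eq0 gt_eqF// Gamma_gt0// ltW.
pose k := (\int[mu]_(s in `[A, B]) K2 s - C) / ga.
have E t : t \in `[a, A] -> RL_right_integral alpha B K3 t + k =
    RL_right_integral alpha A K3 t.
  move=> taA; apply: esym; apply: solve_right => //.
  have tab : t \in `[a, b].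
    by move: taA; rewrite !in_itv/= => /andP[-> tA]; rewrite (le_trans tA).
  rewrite -[RHS](constRL tab) RL_left_trunc_left// mulr0 addr0.
  rewrite !(RL_right_trunc_left _ _ Bb taA) (RL_right_split aA AB Bb (ltW al0) al1 cK3 taA).
  congr (_ + _); apply: eq_Rintegral => s _.
  by rewrite /RL_right_integrand oppr0 powRr0 mul1r.
have D3 := has_deriv_withinS sub (derivable_within_has_deriv (dK3 xaB)).
have D := has_deriv_withinD D3 (@has_deriv_within_cst R `[a, A] x k).
have [dA eA] := has_deriv_derivable_within ltaA xaA (eq_has_deriv_within xaA E D).
split; [exact: (RL_right_exP aB Bb xaB (dK3 xaB))|exact: (RL_right_exP ltaA Ab xaA dA)|].
by rewrite /RL_right eA addr0 subrr.
Qed.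

Lemma euler_lagrange_right x : B < b -> x \in `[B, b] ->
  [/\ RL_left_ex beta A b K4 x, RL_left_ex beta B b K4 x &
      RL_left beta A b K4 x - RL_left beta B b K4 x = 0].
Proof.
move=> ltBb xBb; have Ab : A < b := lt_le_trans AB Bb.
have sub : `[B, b]%classic `<=` `[A, b]%classic.
  by move=> s /=; rewrite !in_itv/= => /andP[Bs ->]; rewrite (le_trans _ Bs)// ltW.
have xAb : x \in `[A, b] by exact: sub.
have aB : a <= B := ltW (le_lt_trans aA AB).
have gb0 : gb != 0 by rewrite oppr_eq0 invr_eq0 gt_eqF// Gamma_gt0// ltW.
(* The [0] is the K2 term, which vanishes to the right of B together with the K3 term. *)
pose k := (0 - C) / gb.
have E t : t \in `[B, b] -> RL_left_integral beta A K4 t + k =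
    RL_left_integral beta B K4 t.
  move=> tBb; apply: esym; apply: solve_right => //.
  have tab : t \in `[a, b].
    by move: tBb; rewrite !in_itv/= => /andP[Bt ->]; rewrite (le_trans aB).
  rewrite -[RHS](constRL tab) !RL_right_trunc_right// mulr0 addr0.
  by rewrite (RL_left_trunc_right _ _ aA tBb) (RL_left_split aA AB Bb (ltW be0) be1 cK4 tBb).
have D4 := has_deriv_withinS sub (derivable_within_has_deriv (dK4 xAb)).
have D := has_deriv_withinD D4 (@has_deriv_within_cst R `[B, b] x k).
have [dA eA] := has_deriv_derivable_within ltBb xBb (eq_has_deriv_within xBb E D).
split; [exact: (RL_left_exP aA Ab xAb (dK4 xAb))|exact: (RL_left_exP aB ltBb xBb dA)|].
by rewrite /RL_left eA addr0 subrr.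
Qed.

End euler_lagrange.

Lemma derive1_lin (R : realType) (f h : R -> R) (s t x : R) :
  derivable f x 1 -> derivable h x 1 ->
  derive1 (fun z => s * f z + t * h z) x = s * derive1 f x + t * derive1 h x.
Proof.
move=> df dh; rewrite !derive1E.
have /derivableP Hf := df; have /derivableP Hh := dh.
have H1 : is_derive x (1 : R) (s \*: f) (s *: 'D_1 f x) := is_deriveZ s Hf.
have H2 : is_derive x (1 : R) (t \*: h) (t *: 'D_1 h x) := is_deriveZ t Hh.
have H3 : is_derive x (1 : R) (s \*: f + t \*: h) (s *: 'D_1 f x + t *: 'D_1 h x).
  exact: is_deriveD.
exact: (@derive_val _ _ _ _ _ _ _ H3).
Qed.

Section partials.
Context {R : realType}.
Variables (a b s t : R) (L g : R -> R -> R -> R -> R).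
Hypotheses (hL : classC1 a b L) (hg : classC1 a b g).
Let K x y u v := s * L x y u v + t * g x y u v.

Lemma partial2_lin x y u v : x \in `[a, b] ->
  partial2 K x y u v = s * partial2 L x y u v + t * partial2 g x y u v.
Proof.
move=> xab; case: hL => /(_ x y u v xab)[_ dL _ _] _ _.
by case: hg => /(_ x y u v xab)[_ dg _ _] _ _; exact: (derive1_lin s t dL dg).
Qed.

Lemma partial3_lin x y u v : x \in `[a, b] ->
  partial3 K x y u v = s * partial3 L x y u v + t * partial3 g x y u v.
Proof.
move=> xab; case: hL => /(_ x y u v xab)[_ _ dL _] _ _.
by case: hg => /(_ x y u v xab)[_ _ dg _] _ _; exact: (derive1_lin s t dL dg).
Qed.

Lemma partial4_lin x y u v : x \in `[a, b] ->
  partial4 K x y u v = s * partial4 L x y u v + t * partial4 g x y u v.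
Proof.
move=> xab; case: hL => /(_ x y u v xab)[_ _ _ dL] _ _.
by case: hg => /(_ x y u v xab)[_ _ _ dg] _ _; exact: (derive1_lin s t dL dg).
Qed.

End partials.

Lemma patch_lin (R : realType) (S S' : set R) (f g h : R -> R) (s t : R) :
  S `<=` S' -> (forall x, S' x -> h x = s * f x + t * g x) ->
  h \_ S = (fun x => s * (f \_ S) x + t * (g \_ S) x).
Proof.
move=> SS hE; apply/funext => x; rewrite !patchE.
case: ifPn => [|_]; last by rewrite !mulr0 addr0.
by rewrite inE => /SS; exact: hE.
Qed.

Lemma within_continuous_lin (R : realType) (p q s t : R) (f g h : R -> R) :
  {within `[p, q], continuous f} -> {within `[p, q], continuous g} ->
  (forall x, x \in `[p, q] -> h x = s * f x + t * g x) ->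
  {within `[p, q], continuous h}.
Proof.
move=> cf cg hE; apply: (@eq_within_continuous _ (fun x => s * f x + t * g x)).
  by move=> x xpq; rewrite hE.
move=> x; apply: cvgD.
  by apply: cvgM; [exact: cvg_cst|exact: cf].
by apply: cvgM; [exact: cvg_cst|exact: cg].
Qed.

Lemma sum_lin3 (R : realType) (s t k k' u v w u' v' w' : R) :
  (s * u + t * u') + k * (s * v + t * v') + k' * (s * w + t * w') =
  s * (u + k * v + k' * w) + t * (u' + k * v' + k' * w').
Proof. by ring. Qed.

Lemma first_variation_lin (R : realType) (a b A B alpha beta s t : R)
    (L g K : R -> R -> R -> R -> R) (y : R -> R) x :
  a < b -> a <= A -> B <= b -> 0 < alpha -> alpha < 1 -> 0 < beta -> beta < 1 ->
  classC1 a b L -> classC1 a b g -> fracE alpha beta a b y ->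
  K = (fun x y u v => s * L x y u v + t * g x y u v) -> x \in `[a, b] ->
  first_variation a b A B alpha beta K y x =
  s * first_variation a b A B alpha beta L y x +
  t * first_variation a b A B alpha beta g y x.
Proof.
move=> ab aA Bb al0 al1 be0 be1 hL hg Ey -> xab.
have [_ _ [_ cL2 cL3 cL4]] := hL; have [_ _ [_ cg2 cg3 cg4]] := hg.
have sub : `[A, B]%classic `<=` `[a, b]%classic.
  move=> z /=; rewrite !in_itv/= => /andP[Az zB].
  by rewrite (le_trans aA)// (le_trans zB).
rewrite /first_variation.
have -> := patch_lin sub (fun z => @partial2_lin _ _ _ s t _ _ hL hg z (y z)
  (caputo_left alpha a y z) (caputo_right beta b y z)).
have -> := patch_lin sub (fun z => @partial3_lin _ _ _ s t _ _ hL hg z (y z)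
  (caputo_left alpha a y z) (caputo_right beta b y z)).
have -> := patch_lin sub (fun z => @partial4_lin _ _ _ s t _ _ hL hg z (y z)
  (caputo_left alpha a y z) (caputo_right beta b y z)).
have bm G : continuous4 a b G -> bounded_measurable a b (along alpha beta a b G y \_ `[A, B]).
  exact: along_trunc_bounded.
rewrite (frac_right_lin ab (lexx 0) ltr01 s t (bm _ cL2) (bm _ cg2) xab).
rewrite (frac_right_lin ab (ltW al0) al1 s t (bm _ cL3) (bm _ cg3) xab).
rewrite (frac_left_lin ab (ltW be0) be1 s t (bm _ cL4) (bm _ cg4) xab).
exact: sum_lin3.
Qed.
Theorem theorem3p7 (R : realType) (a b A B alpha beta ya yb l : R)
    (L g : R -> R -> R -> R -> R) (N : (R -> R) -> R) (y : R -> R)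
    (hab : a < b) (haA : a <= A) (hAB : A < B) (hBb : B <= b)
    (halpha : 0 < alpha < 1) (hbeta : 0 < beta < 1)
    (hL : classC1 a b L) (hg : classC1 a b g)
    (hN : is_norm_on a b (fracE alpha beta a b) N)
    (hmin : local_min (fracE alpha beta a b) N
       (functional alpha beta a b A B L)
       [set z | [/\ z a = ya, z b = yb &
                    functional alpha beta a b A B g z = l]] y)
    (hL3 : has_continuous_RL_right alpha a B
             (along alpha beta a b (partial3 L) y))
    (hg3 : has_continuous_RL_right alpha a B
             (along alpha beta a b (partial3 g) y))
    (hL4 : has_continuous_RL_left beta A b
             (along alpha beta a b (partial4 L) y))
    (hg4 : has_continuous_RL_left beta A b
             (along alpha beta a b (partial4 g) y)) :
  exists lam0 lam : R, ~ (lam0 = 0 /\ lam = 0) /\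
    let K := fun x s u v : R => lam0 * L x s u v + lam * g x s u v in
    let K2 := along alpha beta a b (partial2 K) y in
    let K3 := along alpha beta a b (partial3 K) y in
    let K4 := along alpha beta a b (partial4 K) y in
    [/\ (forall x, x \in `[A, B] ->
           [/\ RL_right_ex alpha a B K3 x, RL_left_ex beta A b K4 x &
               K2 x + RL_right alpha a B K3 x + RL_left beta A b K4 x = 0]),
        (a < A -> forall x, x \in `[a, A] ->
           [/\ RL_right_ex alpha a B K3 x, RL_right_ex alpha a A K3 x &
               RL_right alpha a B K3 x - RL_right alpha a A K3 x = 0]) &
        (B < b -> forall x, x \in `[B, b] ->
           [/\ RL_left_ex beta A b K4 x, RL_left_ex beta B b K4 x &
               RL_left beta A b K4 x - RL_left beta B b K4 x = 0])].
Proof.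
have [[al0 al1] [be0 be1]] := (andP halpha, andP hbeta).
have [Ey _ _] := hmin.
have [s [t [st [C HC]]]] := multipliers hab haA hAB hBb al0 al1 be0 be1 hL hg hN hmin.
exists s, t; split; first exact: st.
move=> K K2 K3 K4.
have [_ _ [_ cL2 cL3 cL4]] := hL; have [_ _ [_ cg2 cg3 cg4]] := hg.
have ca G := @along_continuous R a b alpha beta G y Ey.
have E3 x : x \in `[a, b] -> K3 x = s * along alpha beta a b (partial3 L) y x +
  t * along alpha beta a b (partial3 g) y x := fun xab => partial3_lin s t hL hg _ _ _ xab.
have E4 x : x \in `[a, b] -> K4 x = s * along alpha beta a b (partial4 L) y x +
  t * along alpha beta a b (partial4 g) y x := fun xab => partial4_lin s t hL hg _ _ _ xab.
have cK2 := within_continuous_lin (ca _ cL2) (ca _ cg2)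
  (fun x => partial2_lin s t hL hg _ _ _).
have cK3 := within_continuous_lin (ca _ cL3) (ca _ cg3) E3.
have cK4 := within_continuous_lin (ca _ cL4) (ca _ cg4) E4.
(* Constancy passes from the combination of the two first variations to the first variation of K. *)
have constE x (xab : x \in `[a, b]) := etrans
  (first_variation_lin hab haA hBb al0 al1 be0 be1 hL hg Ey (erefl K) xab) (HC x xab).
have aB : a < B := le_lt_trans haA hAB; have Ab : A < b := lt_le_trans hAB hBb.
have sub_aB z : z \in `[a, B] -> z \in `[a, b].
  by rewrite !in_itv/= => /andP[-> zB]; rewrite (le_trans zB).
have sub_Ab z : z \in `[A, b] -> z \in `[a, b].
  by rewrite !in_itv/= => /andP[Az ->]; rewrite (le_trans haA).
have dK3 := derivable_within_RL_right_lin aB hL3.1 hg3.1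
  (fun z zaB => E3 z (sub_aB z zaB)).
have dK4 := derivable_within_RL_left_lin Ab hL4.1 hg4.1
  (fun z zAb => E4 z (sub_Ab z zAb)).
split.
- exact: (euler_lagrange_mid hab haA hAB hBb al0 al1 be0 be1 cK2 cK3 cK4 constE dK3 dK4).
- by move=> aA x; exact: (euler_lagrange_left hab haA hAB hBb al0 al1 be0 be1 cK2 cK3 cK4 constE dK3 aA).
- by move=> Bb x; exact: (euler_lagrange_right hab haA hAB hBb al0 al1 be0 be1 cK2 cK3 cK4 constE dK4 Bb).
Qed.
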